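(* The kernel of $p_{b}:M(\mathrm{odd})/N1\to\mathbb{Z}/2[[x]]$ is $N2a$, and the kernel of $p_{a}:M(\mathrm{odd})/N1\to\mathbb{Z}/2[[x]]$ is $N2b$.
   Context: For even $k\ge 0$, $M_{k}$ is the set of $f\in\mathbb{Z}/2[[x]]$ for which there is a modular form of weight $k$ for $\Gamma_{0}(5)$ whose expansion at infinity (in $x=e^{2\pi i z}$) lies in $\mathbb{Z}[[x]]$ and reduces mod $2$ to $f$; $M=\bigcup_{m}M_{4m}$ and $M(\mathrm{odd})=M\cap x\,\mathbb{Z}/2[[x^{2}]]$. Let $F=\sum_{n\ \mathrm{odd},\,n>0}x^{n^{2}}$, $G=F(x^{5})$; $N1$ is the $\mathbb{Z}/2[G^{2}]$-submodule generated by $G$ (it lies in $M(\mathrm{odd})$). Define $J_{1}=F$, $J_{3}=F^{8}/G$, $J_{7}=F^{2}G$, $J_{9}=F^{4}G$, and $J_{k+10}=G^{2}J_{k}$. $N2a$ (resp. $N2b$) is the $\mathbb{Z}/2[G^{4}]$-submodule of $M(\mathrm{odd})/N1$ with basis the images of $J_{1},J_{3},J_{7},J_{9}$ (resp. $J_{11},J_{13},J_{17},J_{19}$). $\chi$ is the Dirichlet character modulo $20$ taking $1,3,7,9$ to $1$ and $11,13,17,19$ to $-1$; $p_{a}(\sum c_{n}x^{n})=\sum_{\chi(n)=1}c_{n}x^{n}$ and $p_{b}(\sum c_{n}x^{n})=\sum_{\chi(n)=-1}c_{n}x^{n}$. These maps kill $N1$, hence are defined on $M(\mathrm{odd})/N1$.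 *)

(* Defs.v *)
From mathcomp Require Import all_boot all_order all_algebra.
From mathcomp Require Import all_classical all_reals all_analysis.
From mathcomp Require Import complex Rstruct Rstruct_topology.
Import Order.TTheory GRing.Theory Num.Theory.
Import numFieldNormedType.Exports.

Set Implicit Arguments.
Unset Strict Implicit.
Unset Printing Implicit Defensive.

Local Open Scope ring_scope.
Local Open Scope complex_scope.
Local Open Scope classical_set_scope.

Definition RR : realType := Rdefinitions.R.

Definition CC := (RR[i])^o.

Definition ImC (z : CC) : RR := complex.Im z.
Definition ReC (z : CC) : RR := complex.Re z.

(* x = e^{2 pi i z} = e^{-2 pi Im z} (cos (2 pi Re z) + i sin (2 pi Re z)) *)
Definition qpar (z : CC) : CC :=
  ((expR (- (2 * pi * ImC z)) * cos (2 * pi * ReC z))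
     +i* (expR (- (2 * pi * ImC z)) * sin (2 * pi * ReC z)))%C.

Definition mobius (a b c d : int) (z : CC) : CC :=
  (a%:~R * z + b%:~R) / (c%:~R * z + d%:~R).

Definition jfac (c d : int) (z : CC) : CC := c%:~R * z + d%:~R.

(* f is a (holomorphic) modular form of weight k for Gamma_0(5):
   holomorphic on H, invariant under |_k Gamma_0(5), and holomorphic at all
   cusps (for every gamma in SL_2(Z), (f |_k gamma)(z) = (cz+d)^-k f(gamma z)
   is bounded as Im z -> +oo). *)
Definition modular_form_Gamma0_5 (k : nat) (f : CC -> CC) : Prop :=
  [/\ (forall z : CC, 0 < ImC z -> derivable f z 1),
      (forall a b c d : int, a * d - b * c = 1 -> (5 %| c)%Z ->
         forall z : CC, 0 < ImC z ->
           f (mobius a b c d z) = jfac c d z ^+ k * f z)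
    & (forall a b c d : int, a * d - b * c = 1 ->
         exists M Y : RR, forall z : CC, Y < ImC z ->
           `| f (mobius a b c d z) | <= M%:C * `| jfac c d z | ^+ k)].

Definition has_qexp (f : CC -> CC) (a : nat -> int) : Prop :=
  forall z : CC, 0 < ImC z ->
    (fun N : nat => \sum_(n < N) ((a n)%:~R * qpar z ^+ n : CC)) @ \oo --> f z.

Definition ps := nat -> 'F_2.

Definition ps0 : ps := fun _ => 0.
Definition ps1 : ps := fun n => (n == 0%N)%:R.
Definition psadd (f g : ps) : ps := fun n => f n + g n.
Definition psmul (f g : ps) : ps :=
  fun n => \sum_(i < n.+1) f i * g (n - i)%N.
Definition pspow (f : ps) (k : nat) : ps := iter k (psmul f) ps1.

Definition pseval (P : {poly 'F_2}) (g : ps) : ps :=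
  fun n => \sum_(i < size P) P`_i * pspow g i n.

(* f / x^k (used only when the first k coefficients of f vanish) *)
Definition psdivx (k : nat) (f : ps) : ps := fun n => f (n + k)%N.

Fixpoint inv_seq (u : ps) (n : nat) : seq 'F_2 :=
  match n with
  | 0 => [:: (u 0%N)^-1]
  | n'.+1 => let s := inv_seq u n' in
      rcons s (- (u 0%N)^-1 * \sum_(i < n'.+1) u i.+1 * nth 0 s (n' - i)%N)
  end.
Definition psinv (u : ps) : ps := fun n => nth 0 (inv_seq u n) n.

Definition Mk (k : nat) (f : ps) : Prop :=
  exists (phi : CC -> CC) (a : nat -> int),
    [/\ modular_form_Gamma0_5 k phi, has_qexp phi a
      & forall n, f n = (a n)%:~R].

Definition Modd (f : ps) : Prop :=
  (exists m : nat, Mk (4 * m) f) /\ (forall n, ~~ odd n -> f n = 0).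

(* F = sum_{n odd > 0} x^{n^2},  G = F(x^5) *)
Definition Fser : ps :=
  fun m => ([exists i : 'I_m.+1, odd i && (i * i == m)%N] : bool)%:R.
Definition Gser : ps := fun m => if (5 %| m)%N then Fser (m %/ 5)%N else 0.

Definition J1 : ps := Fser.
(* J3 = F^8 / G  (F^8 = x^8 + ..., G = x^5 (1 + ...)) *)
Definition J3 : ps :=
  psmul (psdivx 5 (pspow Fser 8)) (psinv (psdivx 5 Gser)).
Definition J7 : ps := psmul (pspow Fser 2) Gser.
Definition J9 : ps := psmul (pspow Fser 4) Gser.
Definition J11 : ps := psmul (pspow Gser 2) J1.
Definition J13 : ps := psmul (pspow Gser 2) J3.
Definition J17 : ps := psmul (pspow Gser 2) J7.
Definition J19 : ps := psmul (pspow Gser 2) J9.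

Definition inN1 (f : ps) : Prop :=
  exists Q : {poly 'F_2}, f =1 psmul (pseval Q (pspow Gser 2)) Gser.

Definition inN2a_modN1 (f : ps) : Prop :=
  exists (P1 P3 P7 P9 : {poly 'F_2}) (h : ps), inN1 h /\
    f =1 psadd (psadd (psadd (psmul (pseval P1 (pspow Gser 4)) J1)
                              (psmul (pseval P3 (pspow Gser 4)) J3))
                       (psadd (psmul (pseval P7 (pspow Gser 4)) J7)
                              (psmul (pseval P9 (pspow Gser 4)) J9))) h.
Definition inN2b_modN1 (f : ps) : Prop :=
  exists (P11 P13 P17 P19 : {poly 'F_2}) (h : ps), inN1 h /\
    f =1 psadd (psadd (psadd (psmul (pseval P11 (pspow Gser 4)) J11)
                              (psmul (pseval P13 (pspow Gser 4)) J13))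
                       (psadd (psmul (pseval P17 (pspow Gser 4)) J17)
                              (psmul (pseval P19 (pspow Gser 4)) J19))) h.

Definition pa (f : ps) : ps :=
  fun n => if (n %% 20)%N \in [:: 1; 3; 7; 9]%N then f n else 0.
Definition pb (f : ps) : ps :=
  fun n => if (n %% 20)%N \in [:: 11; 13; 17; 19]%N then f n else 0.

(* Main.v *)
(* Write e(z) = exp(2 pi i z) and let r be the reduction mod 2 of
   S + S(x^5), S = sum sigma(n) x^n.  The first half of the argument shows that the reductions mod 2
   of forms of weight 4m are exactly the polynomials of degree <= 2m in r.  The series E2 is
   quasi-modular (partial fractions of the cotangent), so E4, E6 and the discriminant Delta are
   modular, and integral combinations of E4, E4(5z) and the weight 2 form provide forms of weight 4
   reducing to 1, r and r^2.  That nothing else occurs is the Sturm bound: a form f of weight 4m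
   vanishing to order 2m + 1 at infinity is 0.  Here log |Delta| is built directly as the real part
   of a primitive of E2, and the maximum principle is applied to
   |f| y^(2m) (|Delta(z)| y^6)^b (|Delta(5z)| y^6)^(-a), with a and b such that this
   Gamma_0(5)-invariant function decays at both cusps.  As Delta reduces to F, comparing seven
   coefficients gives G = r^5 + r^6 and F = r + r^2 + r^5 + r^6.

   Put D = F + G = r + r^2.  An odd polynomial in r is D b^4 + D^3 c^4; the exponents of the two
   terms are 1 and 3 mod 4, so p_a and p_b only see their parts in the residues 1, 4 or
   2, 3 mod 5.  With R = r^4 and W = 1 + r(x^20) one has G^4 = R^5 + R^6 = W^5 + W^6, whence a
   relation expressing R^5 through lower powers of R with coefficients polynomials in W.  In suitable
   bases 1, R, ..., R^5 of the polynomials in R over those in G^4, each part becomes a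
   combination of two series that are independent over the series in x^5, and comparing degrees in W
   modulo 6 forces the unwanted coefficients to vanish. *)

Require Import Defs.
From HB Require Import structures.
From mathcomp Require Import all_boot all_order all_algebra.
From mathcomp Require Import all_classical all_reals all_analysis.
From mathcomp Require Import complex Rstruct Rstruct_topology.
From mathcomp Require Import ring lra zify.
From mathcomp Require Import sequences exp trigo realfun derive.
Import Order.TTheory GRing.Theory Num.Theory.
Import numFieldNormedType.Exports.
Set Implicit Arguments.
Unset Strict Implicit.
Unset Printing Implicit Defensive.
Local Open Scope ring_scope.
Local Open Scope complex_scope.

(** * The modulus of a complex number and the exponential e(z) *)

(** Two obstacles shape the proof. On the analytic side everything is done with power series on the
    unit disc, without contour integrals or a valence formula: averages over N-th roots of unity
    give Cauchy's estimates, powers of a series give the maximum principle. The exponents a, b in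
    the Sturm argument are fractions, which is why log |Delta| is needed rather than Delta. The
    supremum of the invariant function need not be located: any bound for it improves by a fixed
    factor below 1. On the algebraic side F lives on squares, so the residues modulo 5 of the
    exponents of F, F^2, F^4, F^8 are visible. Since D R = G and R + R^2 = D^4, multiplication by D
    turns R^2 + R^3, R^3 + R^5 and R^4 + R^5 into expressions in F and G. One generator, R^5, has no
    such expression. The relation with W trades it for the others, and W, being a series in x^20,
    commutes with the projections to classes modulo 5. *)

Notation C := (RR[i]).

(** The norm of [RR[i]] is itself complex valued; a real modulus gives access to the total order and
    to [lra] and [nra]. *)
Definition nm (z : C) : RR := Normc.normc z.

Lemma nmE (z : C) : nm z = Num.sqrt (complex.Re z ^+ 2 + complex.Im z ^+ 2).
Proof. by case: z. Qed.

Lemma normE (z : C) : `|z| = (nm z)%:C.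
Proof. by rewrite normc_def nmE. Qed.

Lemma nm_ge0 z : 0 <= nm z.
Proof. by rewrite nmE sqrtr_ge0. Qed.

Lemma nmM z w : nm (z * w) = nm z * nm w.
Proof. exact: Normc.normcM. Qed.

Lemma nmD z w : nm (z + w) <= nm z + nm w.
Proof. exact: le_normcD. Qed.

Lemma nmN z : nm (- z) = nm z.
Proof. exact: normcN. Qed.

Lemma nmBC z w : nm (z - w) = nm (w - z).
Proof. by rewrite -nmN opprB. Qed.

Lemma nmB z w : nm (z - w) <= nm z + nm w.
Proof. by rewrite -(nmN w); apply: nmD. Qed.

Lemma nm0 : nm 0 = 0. Proof. exact: Normc.normc0. Qed.
Lemma nm1 : nm 1 = 1. Proof. exact: Normc.normc1. Qed.
Lemma nmV z : nm z^-1 = (nm z)^-1. Proof. exact: Normc.normcV. Qed.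

Lemma nm_div z w : nm (z / w) = nm z / nm w.
Proof. by rewrite nmM nmV. Qed.

Lemma nmX z n : nm (z ^+ n) = nm z ^+ n.
Proof. by elim: n => [|n IH]; rewrite ?expr0 ?nm1 // !exprS nmM IH. Qed.

Lemma nm_eq0 z : nm z = 0 -> z = 0.
Proof. exact: Normc.eq0_normc. Qed.

Lemma nm_gt0 z : (0 < nm z) = (z != 0).
Proof.
rewrite lt_def nm_ge0 andbT; congr (~~ _).
by apply/eqP/eqP => [/nm_eq0|->]; rewrite ?nm0.
Qed.

Lemma nm_real (x : RR) : nm x%:C = `|x|.
Proof. by rewrite nmE /= expr0n /= addr0 sqrtr_sqr. Qed.

Lemma nm_nat n : nm n%:R = n%:R.
Proof.
have -> : (n%:R : C) = (n%:R : RR)%:C by rewrite rmorph_nat.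
by rewrite nm_real ger0_norm.
Qed.

Lemma nm_Re z : `|complex.Re z| <= nm z.
Proof.
rewrite nmE -sqrtr_sqr ler_sqrt; last by rewrite addr_ge0 ?sqr_ge0.
by rewrite lerDl sqr_ge0.
Qed.

Lemma nm_Im z : `|complex.Im z| <= nm z.
Proof.
rewrite nmE -sqrtr_sqr ler_sqrt; last by rewrite addr_ge0 ?sqr_ge0.
by rewrite lerDr sqr_ge0.
Qed.

Lemma nm_sqr z : nm z ^+ 2 = complex.Re z ^+ 2 + complex.Im z ^+ 2.
Proof. by rewrite nmE sqr_sqrtr // addr_ge0 ?sqr_ge0. Qed.

Lemma nm_le z : nm z <= `|complex.Re z| + `|complex.Im z|.
Proof.
rewrite -(ler_pXn2r (n:=2)) ?nnegrE ?nm_ge0 ?addr_ge0 // nm_sqr sqrrD.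
rewrite !real_normK ?num_real // lerD2r lerDl.
by rewrite mulrn_wge0 // mulr_ge0.
Qed.

Lemma nm_sum (I : Type) (r : seq I) (P : pred I) (f : I -> C) :
  nm (\sum_(i <- r | P i) f i) <= \sum_(i <- r | P i) nm (f i).
Proof.
elim/big_rec2: _ => [|i x y _ H]; first by rewrite nm0.
by apply: (le_trans (nmD _ _)); rewrite lerD2l.
Qed.

Lemma nm_sub_ge z w : nm z - nm w <= nm (z - w).
Proof.
have := nmD (z - w) w; rewrite subrK => h; lra.
Qed.

Lemma nmi : nm 'i%C = 1.
Proof. by rewrite nmE /= expr0n expr1n add0r sqrtr1. Qed.

Lemma ReM (z w : C) : complex.Re (z * w) =
  complex.Re z * complex.Re w - complex.Im z * complex.Im w.
Proof. by case: z w => [a b] [c d]. Qed.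

Lemma ImM (z w : C) : complex.Im (z * w) =
  complex.Re z * complex.Im w + complex.Im z * complex.Re w.
Proof. by case: z w => [a b] [c d]. Qed.

Lemma ReD (z w : C) : complex.Re (z + w) = complex.Re z + complex.Re w.
Proof. by case: z w => [a b] [c d]. Qed.

Lemma ImD (z w : C) : complex.Im (z + w) = complex.Im z + complex.Im w.
Proof. by case: z w => [a b] [c d]. Qed.

Lemma ReN (z : C) : complex.Re (- z) = - complex.Re z.
Proof. by case: z. Qed.

Lemma ImN (z : C) : complex.Im (- z) = - complex.Im z.
Proof. by case: z. Qed.

Lemma cplxP (z w : C) : complex.Re z = complex.Re w ->
  complex.Im z = complex.Im w -> z = w.
Proof. by case: z w => [a b] [c d] /= -> ->. Qed.

Lemma ImV (z : C) : complex.Im z^-1 = - complex.Im z / nm z ^+ 2.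
Proof. by rewrite nm_sqr; case: z => [a b] /=; rewrite mulNr. Qed.

Lemma ReV (z : C) : complex.Re z^-1 = complex.Re z / nm z ^+ 2.
Proof. by rewrite nm_sqr; case: z => [a b] /=. Qed.

Lemma Re_nat n : complex.Re (n%:R : C) = n%:R.
Proof. by rewrite -(rmorph_nat (real_complex RR)). Qed.

Lemma Im_nat n : complex.Im (n%:R : C) = 0.
Proof. by rewrite -(rmorph_nat (real_complex RR)). Qed.

Lemma Re_int (n : int) : complex.Re (n%:~R : C) = n%:~R.
Proof. by rewrite -(rmorph_int (real_complex RR)). Qed.

Lemma Im_int (n : int) : complex.Im (n%:~R : C) = 0.
Proof. by rewrite -(rmorph_int (real_complex RR)). Qed.

Lemma Im_gt0_neq0 (z : C) : 0 < complex.Im z -> z != 0.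
Proof. by apply: contraTneq => -> /=; rewrite ltxx. Qed.

Definition e (z : C) : C := qpar z.

Lemma eE (z : C) : e z =
  (expR (- (2 * pi * complex.Im z)) * cos (2 * pi * complex.Re z)) +i*
  (expR (- (2 * pi * complex.Im z)) * sin (2 * pi * complex.Re z)).
Proof. by []. Qed.

Lemma eD z w : e (z + w) = e z * e w.
Proof.
have h1 : 2 * pi * complex.Re (z + w) = 2 * pi * complex.Re z + 2 * pi * complex.Re w.
  by rewrite ReD mulrDr.
have h2 : - (2 * pi * complex.Im (z + w)) = - (2 * pi * complex.Im z) - 2 * pi * complex.Im w.
  by rewrite ImD mulrDr opprD.
rewrite !eE h1 h2 expRD cosD sinD.
apply: cplxP; rewrite ?ReM ?ImM /=; ring.
Qed.

Lemma nm_e z : nm (e z) = expR (- (2 * pi * complex.Im z)).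
Proof.
rewrite nmE eE /= !exprMn -mulrDr cos2Dsin2 mulr1 sqrtr_sqr.
by rewrite ger0_norm // expR_ge0.
Qed.

Lemma e0 : e 0 = 1.
Proof.
by apply: cplxP; rewrite eE /= !mulr0 oppr0 expR0 mul1r ?cos0 ?sin0.
Qed.

Lemma e1 : e 1 = 1.
Proof.
by apply: cplxP; rewrite eE /= !(mulr0, mulr1) oppr0 expR0 mul1r mulr_natl ?cos2pi ?sin2pi.
Qed.

Lemma e_neq0 z : e z != 0.
Proof. by rewrite -nm_gt0 nm_e expR_gt0. Qed.

Lemma eN z : e (- z) = (e z)^-1.
Proof.
by apply: (mulfI (e_neq0 z)); rewrite -eD subrr e0 divff // e_neq0.
Qed.

Lemma e_mulrn z n : e (z *+ n) = e z ^+ n.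
Proof. by elim: n => [|n IH]; rewrite ?mulr0n ?e0 // mulrS eD IH exprS. Qed.

Lemma nm_e_lt1 z : 0 < complex.Im z -> nm (e z) < 1.
Proof.
by move=> h; rewrite nm_e expR_lt1 oppr_lt0 !mulr_gt0 ?pi_gt0.
Qed.

Lemma Im_lt_nm_e z (y : RR) : y <= complex.Im z ->
  nm (e z) <= expR (- (2 * pi * y)).
Proof.
by move=> h; rewrite nm_e ler_expR lerN2 ler_pM2l // mulr_gt0 ?pi_gt0.
Qed.

Lemma e_surj (q : C) : q != 0 -> exists z, e z = q.
Proof.
move=> q0; have hq : 0 < nm q by rewrite nm_gt0.
set a := complex.Re q / nm q; set b := complex.Im q / nm q.
have hab : a ^+ 2 + b ^+ 2 = 1.
  by rewrite !expr_div_n -mulrDl -nm_sqr divff // expf_neq0 // gt_eqF.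
have ha : -1 <= a <= 1.
  by rewrite -ler_norml -(expr_le1 (n:=2)) ?normr_ge0 // real_normK ?num_real // -hab lerDl sqr_ge0.
(* [acos] only covers [0, pi]; the sign of the imaginary part selects the half circle. *)
pose t := if 0 <= b then acos a else - acos a.
have ct : cos t = a by rewrite /t; case: ifP => _; rewrite ?cosN acosK.
have st : sin t = b.
  have h : Num.sqrt (1 - a ^+ 2) = `|b| by rewrite -hab addrAC subrr add0r sqrtr_sqr.
  rewrite /t; case: ifP => hb; rewrite ?sinN sin_acos // h; first exact: ger0_norm.
  by rewrite ler0_norm ?opprK // leNgt; apply: contraFN hb => /ltW.
have hp : 0 < 2 * pi :> RR by rewrite mulr_gt0 ?pi_gt0.
have hp0 : 2 * pi != 0 :> RR by rewrite gt_eqF.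
exists ((t / (2 * pi)) +i* (- ln (nm q) / (2 * pi))).
have x1 : 2 * pi * (t / (2 * pi)) = t by rewrite mulrCA divff ?mulr1.
have x2 : - (2 * pi * (- ln (nm q) / (2 * pi))) = ln (nm q).
  by rewrite mulrCA divff ?mulr1 // opprK.
rewrite eE /= x1 x2 lnK ?posrE // ct st /a /b.
have h0 : nm q != 0 by rewrite gt_eqF.
rewrite !(mulrC (nm q)) !divfK //.
by case: (q).
Qed.

(** * Lower bounds for |1 - e(d)| *)

(** From 1 + s <= exp s and 1 - s <= exp(-s) = 1/exp s: the remainder lies between 0 and s^2/(1 -
    s). *)
Lemma expR_quad (s : RR) : `|s| <= 2^-1 -> `|expR s - 1 - s| <= 2 * s ^+ 2.
Proof.
rewrite ler_norml => /andP[h1 h2].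
have a := expR_ge1Dx s; have := expR_ge1Dx (- s).
have E0 := expR_gt0 s; have := expRxMexpNx_1 s.
move: (expR s) (expR (- s)) a E0 => E E' a E0 ee b.
have b1 : E * (1 - s) <= 1 by nra.
rewrite ger0_norm; last by lra.
rewrite expr2; nra.
Qed.

Lemma is_derive_sinR (x : RR) : is_derive x 1 (sin : RR -> RR) (cos x).
Proof. exact: is_derive_sin. Qed.

Lemma sin_mvt (x : RR) : 0 < x -> exists2 c, 0 < c < x & sin x = cos c * x.
Proof.
move=> x0.
have ds y : y \in `]0, x[%R -> is_derive y 1 (sin : RR -> RR) (cos y).
  by move=> _; exact: is_derive_sinR.
have cs : {within `[0, x]%classic, continuous (sin : RR -> RR)}%classic.
  by apply: continuous_subspaceT; exact: continuous_sin.
have [c] := MVT x0 ds cs.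
by rewrite in_itv /= sin0 !subr0 => h ->; exists c.
Qed.

Lemma sin_le_abs (x : RR) : `|sin x| <= `|x|.
Proof.
have [x0|x0|<-] := ltgtP 0 x; last by rewrite sin0.
  have [c _ ->] := sin_mvt x0.
  by rewrite normrM (gtr0_norm x0) ler_piMl ?cos_max // ltW.
have x0' : 0 < - x by rewrite oppr_gt0.
have [c _] := sin_mvt x0'; rewrite sinN => /(congr1 Num.norm).
by rewrite normrN => ->; rewrite normrM normrN ler_piMl ?cos_max.
Qed.

Lemma sin_sqr (x : RR) : sin x ^+ 2 <= x ^+ 2.
Proof.
rewrite -[sin x ^+ 2]real_normK ?num_real // -[x ^+ 2]real_normK ?num_real //.
by rewrite ler_pXn2r ?nnegrE //; exact: sin_le_abs.
Qed.

Lemma cosE_sin (x : RR) : cos x = 1 - 2 * sin (x / 2) ^+ 2.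
Proof.
rewrite {1}(_ : x = (x / 2) *+ 2); last by rewrite -mulr_natr divfK // pnatr_eq0.
rewrite cos_mulr2n cos2sin2; lra.
Qed.

Lemma cos_quad (x : RR) : `|cos x - 1| <= x ^+ 2.
Proof.
have h := cosE_sin x.
have hh := sin_sqr (x / 2); rewrite h; rewrite expr_div_n in hh.
have := sqr_ge0 (sin (x / 2)) => h0.
rewrite ler0_norm; first by have := sqr_ge0 x; lra.
lra.
Qed.

Lemma sin_cubic (x : RR) : `|sin x - x| <= `|x| ^+ 3.
Proof.
suff H (y : RR) : 0 < y -> `|sin y - y| <= y ^+ 3.
  have [x0|x0|<-] := ltgtP 0 x; last by rewrite sin0 subrr normr0 expr0n.
    by rewrite (gtr0_norm x0); exact: H.
  have := H (- x); rewrite sinN oppr_gt0 => /(_ x0).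
  by rewrite (ltr0_norm x0) -opprD normrN.
move=> y0; have [c /andP[c0 cy] ->] := sin_mvt y0.
rewrite -[X in _ - X]mul1r -mulrBl normrM (gtr0_norm y0) exprSr.
rewrite ler_pM2r //; apply: (le_trans (cos_quad _)).
by rewrite ler_pXn2r ?nnegrE; try exact: ltW.
Qed.

Lemma pi_lt4 : pi < 4 :> RR.
Proof. by have := pihalf_lt2 RR; rewrite ltr_pdivrMr // -natrM. Qed.

(** A crude bound on three ranges: the mean value theorem up to 1, monotonicity up to pi/2, the
    reflection t -> pi - t beyond. The end point 3/4 pi matches the strip |Re d| <= 3/4 of
    [e_lower]. *)
Lemma sin_lower (t : RR) : 0 <= t <= 3 / 4 * pi -> t / 16 <= sin t.
Proof.
move=> /andP[t0 t1]; have p4 := pi_lt4; have p2 := pi_ge2 RR.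
have small (u : RR) : 0 <= u <= 1 -> u / 2 <= sin u.
  move=> /andP[]; rewrite le_eqVlt => /predU1P[<-|u0] u1.
    by rewrite mul0r sin0.
  have [c /andP[c0 cu] ->] := sin_mvt u0.
  have c1 : c < 1 by apply: lt_le_trans u1.
  suff : 2^-1 <= cos c by move=> h; nra.
  have h := @cos2Dsin2 RR (c / 2).
  rewrite cosE_sin.
  have hh := sin_sqr (c / 2).
  have : (c / 2) ^+ 2 <= 4^-1 by nra.
  lra.
have mid (u : RR) : 1 <= u <= pi / 2 -> 2^-1 <= sin u.
  move=> /andP[u1 u2]; have h : 1 / 2 <= sin 1 :> RR by apply: small; lra.
  apply: (@le_trans _ _ (sin (1:RR))); first by lra.
  have : {in `[- (pi / 2), pi / 2]%R &, {mono (sin : RR -> RR) : x y / x <= y}}.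
    by apply: le_mono_in => x y hx hy; rewrite ltr_sin.
  move=> -> //; rewrite in_itv /=; lra.
have [t2|t2] := leP t 1; first by have := small t; lra.
have [t3|t3] := leP t (pi / 2); first by have := mid t; lra.
have -> : sin t = sin (pi - t) by rewrite sinB sinpi cospi; lra.
have [t4|t4] := leP (pi - t) 1.
  have := small (pi - t); lra.
have := mid (pi - t); lra.
Qed.

Definition tpi : C := (2 * pi)%:C * 'i.

(** Feeds both the derivative of [e] and the limit of N (e(v/N) - 1); the constant is crude. *)
Lemma e_lin : exists2 K : RR, 0 < K & forall d : C, nm d <= 16^-1 ->
  nm (e d - 1 - tpi * d) <= K * nm d ^+ 2.
Proof.
exists 1000; first by rewrite ltr0n.
move=> d hd.
set a := 2 * pi * complex.Re d; set s := - (2 * pi * complex.Im d).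
have p0 := pi_gt0 RR; have p4 := pi_lt4.
have hr := nm_Re d; have hi := nm_Im d; have n0 := nm_ge0 d.
have a1 : `|a| <= 8 * nm d.
  by rewrite /a normrM gtr0_norm ?mulr_gt0 //; nra.
have s1 : `|s| <= 8 * nm d.
  by rewrite /s normrN normrM gtr0_norm ?mulr_gt0 //; nra.
have hs : `|s| <= 2^-1 by lra.
have q1 := expR_quad hs; have c1 := cos_quad a; have d1 := sin_cubic a.
have -> : e d - 1 - tpi * d = (expR s * cos a - 1 - s) +i* (expR s * sin a - a).
  apply: cplxP; rewrite !(ReD, ImD, ReN, ImN, ReM, ImM, eE) /= -/a -/s /s /a; ring.
apply: (le_trans (nm_le _)) => /=.
have E2 : 0 < expR s <= 2.
  rewrite expR_gt0 /=; move: q1; rewrite ler_norml => /andP[_ q1].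
  move: hs; rewrite ler_norml => /andP[hs1 hs2]; nra.
have A : `|expR s * cos a - 1 - s| <= 2 * s ^+ 2 + 2 * a ^+ 2.
  rewrite (_ : _ - s = (expR s - 1 - s) + expR s * (cos a - 1)); last by ring.
  apply: (le_trans (ler_normD _ _)); apply: lerD => //.
  rewrite normrM gtr0_norm; last by case/andP: E2.
  case/andP: E2 => E0 E2; apply: ler_pM => //; exact: ltW.
have B : `|expR s * sin a - a| <= (2 * s ^+ 2 + `|s|) * `|a| + `|a| ^+ 3.
  rewrite (_ : _ - a = ((expR s - 1 - s) + s) * sin a + (sin a - a)); last by ring.
  apply: (le_trans (ler_normD _ _)); apply: lerD => //.
  rewrite normrM; apply: ler_pM => //; last exact: sin_le_abs.
  by apply: (le_trans (ler_normD _ _)); apply: lerD.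
have := lerD A B; move/le_trans; apply.
have ea : a ^+ 2 = `|a| ^+ 2 by rewrite real_normK ?num_real.
have es : s ^+ 2 = `|s| ^+ 2 by rewrite real_normK ?num_real.
rewrite ea es.
have : `|a| ^+ 2 <= 64 * nm d ^+ 2.
  by rewrite (_ : 64 * _ = (8 * nm d) ^+ 2) ?ler_pXn2r ?nnegrE ?mulr_ge0 //; ring.
have : `|s| ^+ 2 <= 64 * nm d ^+ 2.
  by rewrite (_ : 64 * _ = (8 * nm d) ^+ 2) ?ler_pXn2r ?nnegrE ?mulr_ge0 //; ring.
have sa : `|s| * `|a| <= 64 * nm d ^+ 2.
  by rewrite (_ : 64 * _ = (8 * nm d) * (8 * nm d)) ?ler_pM //; ring.
have A0 := normr_ge0 a; have S0 := normr_ge0 s.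
have ah : `|a| <= 2^-1 by lra.
move: (`|a|) (`|s|) (nm d) A0 S0 ah sa hs n0 => x y w *.
have : 2 * y ^+ 2 * x <= y ^+ 2 by have := sqr_ge0 y; nra.
have : x ^+ 3 <= 2^-1 * x ^+ 2 by rewrite exprSr; have := sqr_ge0 x; nra.
have := sqr_ge0 x; have := sqr_ge0 w; nra.
Qed.

Lemma sub1e_sqr (d : C) : nm (1 - e d) ^+ 2 =
  (1 - nm (e d)) ^+ 2 + 4 * nm (e d) * sin (pi * complex.Re d) ^+ 2.
Proof.
rewrite nm_sqr !(ReD, ImD, ReN, ImN, eE) nm_e /=.
set r := expR _.
rewrite (_ : pi * complex.Re d = (2 * pi * complex.Re d) / 2); last by field.
have h := cosE_sin (2 * pi * complex.Re d); have k := @cos2Dsin2 RR (2 * pi * complex.Re d).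
move: h k; move: (cos (2 * pi * complex.Re d)) (sin (2 * pi * complex.Re d))
  (sin (2 * pi * complex.Re d / 2)) => x v u h k.
have -> : u ^+ 2 = (1 - x) / 2 by lra.
rewrite [RHS](_ : _ = 1 + r ^+ 2 - 2 * r * x); last by field.
rewrite [LHS](_ : _ = 1 + r ^+ 2 * (x ^+ 2 + v ^+ 2) - 2 * r * x); last by ring.
by rewrite k mulr1.
Qed.

(** In [sub1e_sqr] the first square controls Im d and the sine term controls Re d. As 3/4 < 1, the
    strip stays away from the nonzero integers, the other zeros of 1 - e(d). The bound dominates the
    terms of the finite partial fractions. *)
Lemma e_lower (Y : RR) : 0 <= Y -> exists2 c : RR, 0 < c & forall d : C,
  `|complex.Re d| <= 3 / 4 -> 0 <= complex.Im d <= Y -> c * nm d <= nm (1 - e d).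
Proof.
move=> Y0; set r0 := expR (- (2 * pi * Y)).
have p0 := pi_gt0 RR; have p4 := pi_lt4; have p2 := pi_ge2 RR.
have r01 : 0 < r0 <= 1.
  by rewrite expR_gt0 expR_le1 oppr_le0 !mulr_ge0 // ltW.
have hY : 0 < 1 + 8 * Y by lra.
have [c [c0 c1 c2]] : exists c : RR, [/\ 0 < c, c ^+ 2 <= r0 / 256 & c * (1 + 8 * Y) <= 1].
  (* The first bound serves the real part, with 256 = 16^2 coming from [sin_lower]; the second
     serves the imaginary part. *)
  exists (Order.min (r0 / 256) ((1 + 8 * Y)^-1)); split.
  - by rewrite lt_min; case/andP: r01 => r00 _; rewrite divr_gt0 // invr_gt0.
  - set m := Order.min _ _.
    have m1 : m <= r0 / 256 by rewrite ge_min lexx.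
    have m0 : 0 < m by rewrite lt_min; case/andP: r01 => r00 _; rewrite divr_gt0 // invr_gt0.
    case/andP: r01 => r00 r1; nra.
  - by rewrite -ler_pdivlMr // div1r ge_min lexx orbT.
exists c => // d hx /andP[hy0 hyY].
rewrite -(ler_pXn2r (n:=2)) ?nnegrE ?mulr_ge0 ?nm_ge0 ?(ltW c0) //.
rewrite sub1e_sqr exprMn nm_sqr mulrDr addrC; apply: lerD.
  have t0 : 0 <= 2 * pi * complex.Im d by rewrite !mulr_ge0 // ltW.
  have := expR_ge1Dx (2 * pi * complex.Im d).
  have := expRxMexpNx_1 (2 * pi * complex.Im d).
  rewrite nm_e; have := expR_gt0 (- (2 * pi * complex.Im d)).
  have E1 : expR (- (2 * pi * complex.Im d)) <= 1 by rewrite expR_le1 oppr_le0.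
  move: (expR (- (2 * pi * complex.Im d))) (expR (2 * pi * complex.Im d)) E1 => E' E E1 E'0 EE h.
  rewrite -exprMn ler_pXn2r ?nnegrE ?mulr_ge0 ?subr_ge0 // ?(ltW c0) //.
  have k1 : complex.Im d <= 2 * pi * complex.Im d by nra.
  have k2 : 2 * pi * complex.Im d <= 8 * Y by nra.
  have k3 : E' * (1 + 2 * pi * complex.Im d) <= 1 by nra.
  have k4 : 2 * pi * complex.Im d <= (1 - E') * (1 + 8 * Y) by nra.
  have k5 : c * complex.Im d <= c * ((1 - E') * (1 + 8 * Y)) by rewrite ler_pM2l //; lra.
  by apply: (le_trans k5); nra.
have e0' : r0 <= nm (e d).
  by rewrite nm_e ler_expR lerN2 ler_pM2l // mulr_gt0.
set x := complex.Re d in hx *.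
have sx : (pi * x) ^+ 2 / 256 <= sin (pi * x) ^+ 2.
  have : `|pi * x| / 16 <= `|sin (pi * x)|.
    have H (u : RR) : 0 <= u <= 3 / 4 -> pi * u / 16 <= sin (pi * u).
      by move=> /andP[u0 u1]; apply: sin_lower; rewrite mulr_ge0 ?(ltW p0) //= mulrC ler_pM2r.
    rewrite normrM (gtr0_norm p0).
    have [x0|x0] := leP 0 x.
      rewrite ger0_norm // in hx *.
      by apply: (le_trans (H x _)); [rewrite x0 | exact: ler_norm].
    rewrite ltr0_norm // in hx *.
    apply: (le_trans (H (- x) _)); first by lra.
    by rewrite mulrN sinN -normrN ler_norm.
  rewrite -(ler_pXn2r (n:=2)) ?nnegrE ?divr_ge0 //.
  by rewrite expr_div_n !real_normK ?num_real // (_ : 16 ^+ 2 = 256) //; lra.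
case/andP: r01 => r00 r1.
apply: (@le_trans _ _ (r0 / 256 * x ^+ 2)).
  by apply: ler_pM => //; exact: sqr_ge0.
have x2 := sqr_ge0 x.
have : x ^+ 2 <= (pi * x) ^+ 2 by rewrite exprMn ler_peMl //; nra.
move=> h.
have : r0 * ((pi * x) ^+ 2 / 256) <= nm (e d) * sin (pi * x) ^+ 2.
  by apply: ler_pM => //; [exact: ltW | rewrite divr_ge0 // sqr_ge0].
nra.
Qed.

(** * Formal power series *)

(** A separate name for [nat -> R] that carries the Cauchy product. Over F_2 it is convertible with
    [ps], so [psmul] and [psadd] are its ring operations by conversion. *)
Definition fps (R : comNzRingType) := nat -> R.

Section FpsRing.
Variable R : comNzRingType.
Implicit Types f g h : fps R.

HB.instance Definition _ := gen_eqMixin (fps R).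
HB.instance Definition _ := gen_choiceMixin (fps R).

Let zero : fps R := fun _ => 0.
Let one : fps R := fun n => (n == 0%N)%:R.
Let add f g : fps R := fun n => f n + g n.
Let opp f : fps R := fun n => - f n.
Let mul f g : fps R := fun n => \sum_(i < n.+1) f i * g (n - i)%N.

Lemma fps_ext f g : (forall n, f n = g n) -> f = g.
Proof. by move=> h; apply/funext. Qed.

Let addA : associative add. Proof. by move=> f g h; apply: fps_ext => n; exact: addrA. Qed.
Let addC : commutative add. Proof. by move=> f g; apply: fps_ext => n; exact: addrC. Qed.
Let add0 : left_id zero add. Proof. by move=> f; apply: fps_ext => n; exact: add0r. Qed.
Let addN : left_inverse zero opp add. Proof. by move=> f; apply: fps_ext => n; exact: addNr. Qed.

HB.instance Definition _ := GRing.isZmodule.Build (fps R) addA addC add0 addN.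

Let tr f n : {poly R} := \poly_(i < n.+1) f i.

Let tr_coef f n i : (i <= n)%N -> (tr f n)`_i = f i.
Proof. by move=> h; rewrite coef_poly ltnS h. Qed.

(** Up to degree n only the truncations matter, so associativity and commutativity are inherited
    from polynomials. *)
Let mul_tr f g n m : (m <= n)%N -> mul f g m = (tr f n * tr g n)`_m.
Proof.
move=> mn; rewrite coefM; apply: eq_bigr => i _; rewrite !tr_coef //.
  by rewrite (leq_trans (leq_subr _ _)).
by rewrite (leq_trans _ mn) // -ltnS.
Qed.

Let mulA : associative mul.
Proof.
move=> f g h; apply: fps_ext => n.
transitivity ((tr f n * (tr g n * tr h n))`_n).
  rewrite coefM; apply: eq_bigr => i _; rewrite tr_coef ?leq_ord // (@mul_tr _ _ n) // leq_subr //.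
rewrite mulrA coefM; apply: eq_bigr => i _.
by rewrite (@mul_tr f g n) ?leq_ord // tr_coef // leq_subr.
Qed.

Let mulC : commutative mul.
Proof. by move=> f g; apply: fps_ext => n; rewrite !(@mul_tr _ _ n) // mulrC. Qed.

Let mul1 : left_id one mul.
Proof.
move=> f; apply: fps_ext => n; rewrite /mul big_ord_recl /one /= mul1r subn0 big1 ?addr0 //.
by move=> i _; rewrite mul0r.
Qed.

Let mulD : left_distributive mul add.
Proof.
move=> f g h; apply: fps_ext => n; rewrite /mul /add -big_split /=.
by apply: eq_bigr => i _; rewrite mulrDl.
Qed.

Let one_neq0 : one != zero.
Proof. by apply/eqP => /(congr1 (fun f => f 0%N)) /eqP; rewrite /one /zero oner_eq0. Qed.

HB.instance Definition _ := GRing.Zmodule_isComNzRing.Build (fps R) mulA mulC mul1 mulD one_neq0.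

Lemma fps0 n : (0 : fps R) n = 0. Proof. by []. Qed.
Lemma fps1 n : (1 : fps R) n = (n == 0%N)%:R. Proof. by []. Qed.
Lemma fpsD f g n : (f + g) n = f n + g n. Proof. by []. Qed.
Lemma fpsN f n : (- f) n = - f n. Proof. by []. Qed.
Lemma fpsM f g n : (f * g) n = \sum_(i < n.+1) f i * g (n - i)%N. Proof. by []. Qed.

Lemma fps_natM k f n : (k%:R * f) n = k%:R * f n.
Proof.
elim: k => [|k IH]; first by rewrite !mul0r.
by rewrite -[k.+1]addn1 !natrD !mulrDl !mul1r fpsD IH.
Qed.

Lemma fps_sum (I : Type) (r : seq I) (P : pred I) (F : I -> fps R) n :
  (\sum_(i <- r | P i) F i) n = \sum_(i <- r | P i) F i n.
Proof. by elim/big_rec2: _ => // i x y _ <-. Qed.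

Lemma fpsM0 f g : (f * g) 0%N = f 0%N * g 0%N.
Proof. by rewrite fpsM big_ord1. Qed.

Lemma fpsX0 f k : (f ^+ k) 0%N = f 0%N ^+ k.
Proof. by elim: k => // k IH; rewrite !exprS fpsM0 IH. Qed.

Definition fpsC (c : R) : fps R := fun n => if n == 0%N then c else 0.

Lemma fpsCM c f n : (fpsC c * f) n = c * f n.
Proof.
rewrite fpsM big_ord_recl /fpsC /= subn0 big1 ?addr0 // => i _.
by rewrite mul0r.
Qed.

Lemma fpsC_zmod : zmod_morphism fpsC.
Proof. by move=> a b; apply: fps_ext => -[|n] //=; rewrite fpsD fpsN /fpsC /= subr0. Qed.

Lemma fpsC_monoid : monoid_morphism fpsC.
Proof.
split; first by apply: fps_ext => -[|n].
by move=> a b; apply: fps_ext => n; rewrite fpsCM /fpsC; case: eqP; rewrite ?mulr0.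
Qed.

HB.instance Definition _ := GRing.isZmodMorphism.Build R (fps R) fpsC fpsC_zmod.
HB.instance Definition _ := GRing.isMonoidMorphism.Build R (fps R) fpsC fpsC_monoid.

(** The derivation x d/dx, which is (2 pi i)^-1 d/dz on expansions in x = e(z). *)
Definition theta f : fps R := fun n => n%:R * f n.

Lemma thetaD f g : theta (f + g) = theta f + theta g.
Proof. by apply: fps_ext => n; rewrite /theta !fpsD mulrDr. Qed.

Lemma thetaN f : theta (- f) = - theta f.
Proof. by apply: fps_ext => n; rewrite /theta !fpsN mulrN. Qed.

Lemma thetaM f g : theta (f * g) = theta f * g + f * theta g.
Proof.
apply: fps_ext => n; rewrite /theta fpsD !fpsM -big_split mulr_sumr /=.
apply: eq_bigr => i _; have -> : n%:R = i%:R + (n - i)%:R :> R.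
  by rewrite -natrD subnKC // leq_ord.
by move: (i%:R) ((n - i)%:R) (f i) (g (n - i)%N) => a b c d; ring.
Qed.

Lemma theta_nat k : theta k%:R = 0.
Proof.
apply: fps_ext => -[|n]; first by rewrite /theta mul0r.
by rewrite /theta -[k%:R]mulr1 fps_natM fps1 !mulr0.
Qed.

(** The substitution x -> x^m; on forms it is z -> m z, and over F_2 with m = 2 it is squaring. *)
Definition dil (m : nat) f : fps R := fun n => if (m %| n)%N then f (n %/ m)%N else 0.

Lemma sum_dil (m : nat) f N : (0 < m)%N ->
  \sum_(n < N) dil m f n = \sum_(j < (N + m.-1) %/ m) f j.
Proof.
move=> m0; elim: N => [|N IH].
  by rewrite big_ord0 add0n divn_small ?big_ord0 // prednK.
rewrite big_ord_recr /= IH /dil addSnnS prednK // (divnDr N (dvdnn m)) divnn m0.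
case: ifP => hN.
  rewrite addn1 big_ord_recr /=; congr (\sum_(i < _) f i + _).
  by rewrite divnDl // (@divn_small m.-1 m) ?addn0 // prednK.
rewrite addr0 addn1; congr (\sum_(i < _) f i).
move/negbT: hN => hN; rewrite {1}(divn_eq N m) -addnA divnMDl //.
have r0 : (0 < N %% m)%N by rewrite lt0n.
have rm := ltn_pmod N m0.
rewrite (_ : (N %% m + m.-1)%N = ((N %% m).-1 + m)%N); last first.
  by rewrite -{1}(prednK r0) addSnnS prednK.
rewrite (divnDr _ (dvdnn m)) divnn m0 (@divn_small (N %% m).-1 m) ?add0n ?addn1 //.
by apply: leq_ltn_trans rm; rewrite leq_pred.
Qed.

Lemma dilM m f g : (0 < m)%N -> dil m (f * g) = dil m f * dil m g.
Proof.
move=> m0; apply: fps_ext => n; rewrite [RHS]fpsM.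
case: (boolP (m %| n)%N) => [/dvdnP[k ->]|hn].
  rewrite {1}/dil dvdn_mull // mulnK // fpsM.
  have := @sum_dil m (fun j => f j * g (k - j)%N) (k * m).+1 m0.
  rewrite addSnnS prednK // divnDr // mulnK // divnn m0 addn1 => <-.
  apply: eq_bigr => i _; rewrite /dil dvdn_subr ?dvdn_mull //; last by rewrite -ltnS.
  case: ifP => h; rewrite ?mul0r //; congr (_ * g _).
  by case/dvdnP: h => j ->; rewrite -mulnBl !mulnK.
rewrite {1}/dil (negbTE hn) big1 // => i _; rewrite /dil.
case: ifP => h; rewrite ?mul0r //; case: ifP => h'; rewrite ?mulr0 //.
by case/negP: hn; rewrite -(subnKC (leq_ord i)) dvdn_add.
Qed.

Lemma dilD m f g : dil m (f + g) = dil m f + dil m g.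
Proof. by apply: fps_ext => n; rewrite /dil !fpsD; case: ifP; rewrite ?addr0. Qed.

Lemma dilN m f : dil m (- f) = - dil m f.
Proof. by apply: fps_ext => n; rewrite /dil !fpsN; case: ifP; rewrite ?oppr0. Qed.

Lemma dil1 m : dil m 1 = 1.
Proof.
apply: fps_ext => n; rewrite /dil !fps1; case: (posnP n) => [->|n0].
  by rewrite dvdn0 div0n.
case: ifP => // h; case: eqP => // h0.
by move: n0; rewrite -(divnK h) h0 mul0n.
Qed.

Lemma dil_nat m k : dil m k%:R = k%:R.
Proof.
elim: k => [|k IH]; first by apply: fps_ext => n; rewrite /dil; case: ifP.
by rewrite -[k.+1]addn1 natrD dilD IH dil1.
Qed.

Lemma dilX m f k : (0 < m)%N -> dil m (f ^+ k) = dil m f ^+ k.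
Proof. by move=> m0; elim: k => [|k IH]; rewrite ?expr0 ?dil1 // !exprS dilM // IH. Qed.

Lemma dil_dil m p f : (0 < m)%N -> (0 < p)%N -> dil m (dil p f) = dil (m * p) f.
Proof.
move=> m0 p0; apply: fps_ext => n; rewrite /dil.
case: (boolP (m * p %| n)%N) => [/dvdnP[k ->]|h].
  rewrite mulnA mulnAC dvdn_mull // mulnK // dvdn_mull // mulnK //.
  by rewrite mulnAC -mulnA mulnK // muln_gt0 m0.
case: ifP => // h1; case: ifP => // h2; case/negP: h.
by rewrite -(divnK h1) mulnC dvdn_mul.
Qed.

End FpsRing.

Section FpsMap.
Variables (R S : comNzRingType) (phi : {rmorphism R -> S}).

Definition fmap (f : fps R) : fps S := fun n => phi (f n).

Lemma fmap_zmod : zmod_morphism fmap.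
Proof. by move=> f g; apply: fps_ext => n; rewrite /fmap !fpsD !fpsN rmorphB. Qed.

Lemma fmap_monoid : monoid_morphism fmap.
Proof.
split; first by apply: fps_ext => n; rewrite /fmap !fps1 rmorph_nat.
move=> f g; apply: fps_ext => n; rewrite /fmap !fpsM rmorph_sum.
by apply: eq_bigr => i _; rewrite rmorphM.
Qed.

HB.instance Definition _ := GRing.isZmodMorphism.Build (fps R) (fps S) fmap fmap_zmod.
HB.instance Definition _ := GRing.isMonoidMorphism.Build (fps R) (fps S) fmap fmap_monoid.

Lemma fmap_theta f : fmap (theta f) = theta (fmap f).
Proof. by apply: fps_ext => n; rewrite /fmap /theta rmorphM rmorph_nat. Qed.

Lemma fmap_dil m f : fmap (dil m f) = dil m (fmap f).
Proof. by apply: fps_ext => n; rewrite /fmap /dil; case: ifP; rewrite ?rmorph0. Qed.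

End FpsMap.

Section FpsOrder.
Variable R : idomainType.
Implicit Types f g : fps R.

Definition ord_at f d := (forall i, (i < d)%N -> f i = 0) /\ f d != 0.

Lemma ord_ex f : f != 0 -> exists d, ord_at f d.
Proof.
move=> f0; have h : exists n, f n != 0.
  apply: contrapT => H; case/negP: f0; apply/eqP; apply: fps_ext => n.
  by apply/eqP; apply: contrapT => /negP h; apply: H; exists n.
exists (ex_minn h); case: ex_minnP => d d0 dm; split => // i id.
by apply/eqP; apply: contraTT id => /dm; rewrite -leqNgt.
Qed.

Lemma fpsM_low f g a b n : (forall i, (i < a)%N -> f i = 0) -> (forall i, (i < b)%N -> g i = 0) ->
  (n < a + b)%N -> (f * g) n = 0.
Proof.
move=> fa gb nab; rewrite fpsM big1 // => i _.
have [ia|ai] := ltnP i a; first by rewrite fa // mul0r.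
rewrite gb ?mulr0 //; have := leq_ord i; lia.
Qed.

Lemma fpsM_lead f g a b : (forall i, (i < a)%N -> f i = 0) -> (forall i, (i < b)%N -> g i = 0) ->
  (f * g) (a + b)%N = f a * g b.
Proof.
move=> fa gb; rewrite fpsM.
have ab : (a < (a + b).+1)%N by rewrite ltnS leq_addr.
rewrite (bigD1 (Ordinal ab)) //= addKn big1 ?addr0 // => i; rewrite -val_eqE /= => ia.
have [h|h] := ltnP i a; first by rewrite fa // mul0r.
rewrite gb ?mulr0 //; have := leq_ord i; lia.
Qed.

Lemma ord_atM f g a b : ord_at f a -> ord_at g b -> ord_at (f * g) (a + b).
Proof.
move=> [fa fa0] [gb gb0]; split; first by move=> i; apply: fpsM_low.
by rewrite fpsM_lead // mulf_neq0.
Qed.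

Lemma ord_atX f a k : ord_at f a -> ord_at (f ^+ k) (a * k).
Proof.
move=> h; elim: k => [|k IH]; last by rewrite exprS mulnS; exact: ord_atM.
by rewrite muln0 expr0; split => //; rewrite fps1 oner_eq0.
Qed.

Lemma ord_at_neq0 f a : ord_at f a -> f != 0.
Proof. by move=> [_]; apply: contraNneq => ->. Qed.

Lemma fps_mulf_eq0 f g : f * g = 0 -> f = 0 \/ g = 0.
Proof.
move=> h; have [->|f0] := eqVneq f 0; first by left.
have [->|g0] := eqVneq g 0; first by right.
have [a ha] := ord_ex f0; have [b hb] := ord_ex g0.
by have := ord_at_neq0 (ord_atM ha hb); rewrite h eqxx.
Qed.

Lemma fps_mulI f g h : f != 0 -> f * g = f * h -> g = h.
Proof.
move=> f0 e; have : f * (g - h) = 0 by rewrite mulrBr e subrr.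
by case/fps_mulf_eq0 => [/eqP|/eqP]; [rewrite (negbTE f0)|rewrite subr_eq0 => /eqP].
Qed.

End FpsOrder.

(** * Sequences and series of complex numbers *)

(** Limits are kept elementary; [lim_to_cvg] and [cvg_lim_to] relate them to the filter convergence
    of [has_qexp]. *)
Definition lim_to (u : nat -> C) (l : C) :=
  forall eps : RR, 0 < eps -> exists N, forall n, (N <= n)%N -> nm (u n - l) < eps.

Definition lim0 (b : nat -> RR) :=
  forall eps : RR, 0 < eps -> exists N, forall n, (N <= n)%N -> b n < eps.

Definition hs (c : nat -> C) (l : C) := lim_to (fun N => \sum_(n < N) c n) l.

Lemma lim_ext u v l : (forall n, u n = v n) -> lim_to u l -> lim_to v l.
Proof. by move=> uv h eps /h[N HN]; exists N => n /HN; rewrite uv. Qed.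

Lemma lim_ext_near u v l N0 : (forall n, (N0 <= n)%N -> u n = v n) ->
  lim_to u l -> lim_to v l.
Proof.
move=> uv h eps /h[N HN]; exists (maxn N0 N) => n; rewrite geq_max => /andP[a b].
by rewrite -uv //; exact: HN.
Qed.

Lemma hs_ext c d l : (forall n, c n = d n) -> hs c l -> hs d l.
Proof. by move=> cd; apply: lim_ext => N; apply: eq_bigr => i _. Qed.

Lemma lim_uniq u l l' : lim_to u l -> lim_to u l' -> l = l'.
Proof.
move=> h h'; apply/eqP; rewrite -subr_eq0 -[_ == _]negbK -nm_gt0; apply/negP => p.
have p2 : 0 < nm (l - l') / 2 by rewrite divr_gt0.
have [N HN] := h _ p2; have [N' HN'] := h' _ p2.
have a := HN (maxn N N') (leq_maxl _ _); have b := HN' (maxn N N') (leq_maxr _ _).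
have := nmB (u (maxn N N') - l') (u (maxn N N') - l).
rewrite (_ : _ - _ - (_ - _) = l - l'); last by ring.
lra.
Qed.

Lemma hs_uniq c l l' : hs c l -> hs c l' -> l = l'.
Proof. exact: lim_uniq. Qed.

Lemma lim_bound u l (b : nat -> RR) N0 : (forall n, (N0 <= n)%N -> nm (u n - l) <= b n) ->
  lim0 b -> lim_to u l.
Proof.
move=> h hb eps /hb[N HN]; exists (maxn N0 N) => n; rewrite geq_max => /andP[a1 a2].
by apply: le_lt_trans (h n a1) (HN _ a2).
Qed.

Lemma lim_cst l : lim_to (fun=> l) l.
Proof. by move=> eps e0; exists 0%N => n _; rewrite subrr nm0. Qed.

Lemma limD u v l k : lim_to u l -> lim_to v k -> lim_to (fun n => u n + v n) (l + k).
Proof.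
move=> hu hv eps e0; have p2 : 0 < eps / 2 by rewrite divr_gt0.
have [N HN] := hu _ p2; have [N' HN'] := hv _ p2.
exists (maxn N N') => n; rewrite geq_max => /andP[/HN a /HN' b].
rewrite (_ : _ - _ = (u n - l) + (v n - k)); last by ring.
by apply: le_lt_trans (nmD _ _) _; lra.
Qed.

Lemma limZ u l k : lim_to u l -> lim_to (fun n => k * u n) (k * l).
Proof.
move=> hu eps e0; have k1 : 0 < nm k + 1 by have := nm_ge0 k; lra.
have [N HN] := hu (eps / (nm k + 1)) (divr_gt0 e0 k1).
exists N => n /HN; rewrite ltr_pdivlMr // -mulrBr nmM => h.
have := nm_ge0 (u n - l); nra.
Qed.

Lemma limN u l : lim_to u l -> lim_to (fun n => - u n) (- l).
Proof.
move=> h; rewrite -mulN1r; apply: lim_ext (limZ (-1) h) => n.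
by rewrite mulN1r.
Qed.

Lemma limB u v l k : lim_to u l -> lim_to v k -> lim_to (fun n => u n - v n) (l - k).
Proof. by move=> h /limN; apply: limD. Qed.

Lemma lim_nm_le u l B : lim_to u l -> (forall n, nm (u n) <= B) -> nm l <= B.
Proof.
move=> h hB; rewrite leNgt; apply/negP => p.
have p2 : 0 < nm l - B by rewrite subr_gt0.
have [N HN] := h _ p2; have := HN N (leqnn _); have := hB N.
by have := nm_sub_ge l (u N); rewrite nmBC; lra.
Qed.

Lemma lim_bounded u l : lim_to u l -> exists B, forall n, nm (u n) <= B.
Proof.
move=> h; have [N HN] := h 1 ltr01.
exists (nm l + 1 + \sum_(i < N) nm (u i)) => n.
have S0 : 0 <= \sum_(i < N) nm (u i) by apply: sumr_ge0 => i _; exact: nm_ge0.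
have [nN|/HN] := ltnP n N.
  have := nm_ge0 l; rewrite (bigD1 (Ordinal nN)) //=.
  have : 0 <= \sum_(i < N | i != Ordinal nN) nm (u i) by apply: sumr_ge0 => i _; exact: nm_ge0.
  lra.
by have := nm_sub_ge (u n) l; lra.
Qed.

Lemma limM u v l k : lim_to u l -> lim_to v k -> lim_to (fun n => u n * v n) (l * k).
Proof.
move=> hu hv; have [B hB] := lim_bounded hv.
have B0 : 0 <= B by apply: le_trans (nm_ge0 _) (hB 0%N).
move=> eps e0.
have b1 : 0 < B + 1 by lra.
have l1 : 0 < nm l + 1 by have := nm_ge0 l; lra.
have [N HN] := hu (eps / 2 / (B + 1)) (divr_gt0 (divr_gt0 e0 (ltr0Sn _ 1)) b1).
have [N' HN'] := hv (eps / 2 / (nm l + 1)) (divr_gt0 (divr_gt0 e0 (ltr0Sn _ 1)) l1).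
exists (maxn N N') => n; rewrite geq_max => /andP[/HN a /HN' b].
rewrite (_ : _ - _ = (u n - l) * v n + l * (v n - k)); last by ring.
apply: le_lt_trans (nmD _ _) _; rewrite !nmM.
move: a b; rewrite !ltr_pdivlMr // => a b.
have := hB n; have := nm_ge0 (v n); have := nm_ge0 (u n - l); have := nm_ge0 (v n - k).
have := nm_ge0 l; nra.
Qed.

Lemma limV u l : l != 0 -> lim_to u l -> lim_to (fun n => (u n)^-1) l^-1.
Proof.
move=> l0 h eps e0; have lp : 0 < nm l by rewrite nm_gt0.
have d0 : 0 < Order.min (nm l / 2) (eps * (nm l ^+ 2 / 2)).
  by rewrite lt_min divr_gt0 //= mulr_gt0 // divr_gt0 // exprn_gt0.
have [N HN] := h _ d0; exists N => n /HN; rewrite lt_min => /andP[a b].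
have un : nm l / 2 < nm (u n) by have := nm_sub_ge l (u n); rewrite nmBC; lra.
have u0 : u n != 0 by rewrite -nm_gt0; lra.
rewrite (_ : _ - _ = (l - u n) / (u n * l)); last by field; rewrite l0 u0.
rewrite nm_div nmM nmBC ltr_pdivrMr ?mulr_gt0 //; last by lra.
apply: (lt_le_trans b); rewrite ler_pM2l // expr2 -mulrA.
by nra.
Qed.

Lemma lim_shift u l k : lim_to u l -> lim_to (fun n => u (n + k)%N) l.
Proof.
by move=> h eps /h[N HN]; exists N => n nN; apply: HN; apply: leq_trans nN (leq_addr _ _).
Qed.

Lemma lim_comp u l (f : nat -> nat) : (forall n, (n <= f n)%N) -> lim_to u l ->
  lim_to (fun n => u (f n)) l.
Proof.
by move=> hf h eps /h[N HN]; exists N => n nN; apply: HN; apply: leq_trans nN (hf n).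
Qed.

Lemma lim_sum (K : nat) (u : nat -> nat -> C) (l : nat -> C) :
  (forall k, lim_to (fun n => u n k) (l k)) ->
  lim_to (fun n => \sum_(k < K) u n k) (\sum_(k < K) l k).
Proof.
move=> h; elim: K => [|K IH].
  rewrite big_ord0; apply: lim_ext (lim_cst 0) => n; by rewrite big_ord0.
rewrite big_ord_recr /=; apply: lim_ext (limD IH (h K)) => n.
by rewrite big_ord_recr.
Qed.

Lemma hsD c d l k : hs c l -> hs d k -> hs (fun n => c n + d n) (l + k).
Proof. by move=> h h'; apply: lim_ext (limD h h') => n; rewrite big_split. Qed.

Lemma hsZ c l k : hs c l -> hs (fun n => k * c n) (k * l).
Proof. by move=> h; apply: lim_ext (limZ k h) => n; rewrite mulr_sumr. Qed.

Lemma hsB c d l k : hs c l -> hs d k -> hs (fun n => c n - d n) (l - k).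
Proof. by move=> h h'; apply: lim_ext (limB h h') => n; rewrite sumrB. Qed.

Lemma hs_sum (K : nat) (c : nat -> nat -> C) (l : nat -> C) :
  (forall k, hs (c k) (l k)) ->
  hs (fun n => \sum_(k < K) c k n) (\sum_(k < K) l k).
Proof.
move=> h; elim: K => [|K IH].
  rewrite big_ord0; apply: lim_ext (lim_cst 0) => n; rewrite big1 // => i _.
  by rewrite big_ord0.
rewrite big_ord_recr /=; apply: hs_ext (hsD IH (h K)) => n.
by rewrite big_ord_recr.
Qed.

Lemma hs_shift c l : hs c l -> hs (fun n => c n.+1) (l - c 0%N).
Proof.
move=> h; apply: lim_ext (limB (lim_shift 1 h) (lim_cst (c 0%N))) => n.
by rewrite addn1 big_ord_recl /= addrC addKr; apply: eq_bigr => i _.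
Qed.

Lemma hs_unshift c l : hs (fun n => c n.+1) l -> hs c (c 0%N + l).
Proof.
move=> h eps /h[N HN]; exists N.+1 => -[//|n] /HN.
rewrite big_ord_recl /= (_ : _ - (_ + _) = \sum_(i < n) c (bump 0 i) - l) //.
by rewrite opprD addrACA subrr add0r.
Qed.

Lemma hs_finite c K : (forall n, (K <= n)%N -> c n = 0) -> hs c (\sum_(k < K) c k).
Proof.
move=> h; apply: (@lim_ext_near (fun=> \sum_(k < K) c k) _ _ K _ (lim_cst _)) => n Kn.
rewrite -(subnKC Kn) big_split_ord /= [X in _ + X]big1 ?addr0 // => i _.
by apply: h; rewrite leq_addr.
Qed.

Lemma lim0_inv (K : RR) : lim0 (fun n => K / n.+1%:R).
Proof.
move=> eps e0; exists (Num.Def.truncn (`|K| / eps)).+1 => n hn.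
rewrite ltr_pdivrMr ?ltr0n // mulrC -ltr_pdivrMr //.
apply: (@le_lt_trans _ _ (`|K| / eps)); first by rewrite ler_pM2r ?invr_gt0 // ler_norm.
have k0 : 0 <= `|K| / eps by rewrite divr_ge0 // ltW.
apply: lt_trans (truncnS_gt _) _; by rewrite ltr_nat ltnS.
Qed.

Lemma bernoulli_ineq (t : RR) n : 0 <= t -> 1 + n%:R * t <= (1 + t) ^+ n.
Proof.
move=> t0; elim: n => [|n IH]; first by rewrite mul0r addr0 expr0.
rewrite exprS -natr1; have : 0 <= n%:R :> RR by []; nra.
Qed.

Lemma lim0_geom (K t : RR) : 0 <= t < 1 -> lim0 (fun n => K * t ^+ n).
Proof.
move=> /andP[t0 t1].
have [->|tn] := eqVneq t 0.
  by move=> eps e0; exists 1%N => -[//|n] _; rewrite expr0n /= mulr0.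
have tp : 0 < t by rewrite lt_def tn.
set s := t^-1 - 1.
have s0 : 0 < s by rewrite /s subr_gt0 invf_gt1.
move=> eps e0; have [N HN] := lim0_inv (`|K| / s) e0.
exists N.+1 => -[//|n] /HN h; apply: le_lt_trans h.
have : (n.+1)%:R * s <= t ^- n.+1.
  have := bernoulli_ineq n.+1 (ltW s0); rewrite /s addrCA subrr addr0 exprVn => h.
  by apply: le_trans h; rewrite lerDr.
have np : 0 < n.+1%:R :> RR by rewrite ltr0n.
have tnp : 0 < t ^+ n.+1 by rewrite exprn_gt0.
move=> h; apply: (@le_trans _ _ (`|K| * t ^+ n.+1)).
  by rewrite ler_pM2r // ler_norm.
rewrite -mulrA; apply: ler_wpM2l => //.
rewrite -invfM -[leLHS]invrK lef_pV2 ?posrE ?invr_gt0 ?mulr_gt0 //.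
by rewrite mulrC.
Qed.

Lemma geom_le (t : RR) N : 0 <= t < 1 -> \sum_(n < N) t ^+ n <= (1 - t)^-1.
Proof.
move=> /andP[t0 t1]; rewrite -[leRHS]mul1r ler_pdivlMr ?subr_gt0 //.
have h := subrX1 t N.
have : 0 <= t ^+ N by exact: exprn_ge0.
move: h; move: (\sum_(n < N) t ^+ n) (t ^+ N) => S u h u0; nra.
Qed.

Definition sumb (M : nat -> RR) := (forall n, 0 <= M n) /\
  exists B, forall N, \sum_(n < N) M n <= B.

Lemma sumb_tail M : sumb M -> forall eps, 0 < eps ->
  exists K, forall n, \sum_(K <= k < n) M k < eps.
Proof.
move=> [M0 [B hB]] eps e0.
set A := [set s | exists N, s = \sum_(n < N) M n]%classic.
have hA : has_sup A.
  split; first by exists 0; exists 0%N; rewrite big_ord0.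
  by exists B => _ [N ->].
have [_ [K ->] hK] := sup_adherent e0 hA.
exists K => n.
have [Kn|Kn] := leqP K n; last by rewrite big_geq // ltnW.
have : \sum_(k < n) M k <= sup A by apply: sup_upper_bound => //; exists n.
rewrite -[X in X <= _](big_mkord xpredT) (@big_cat_nat _ _ _ K) //= big_mkord.
lra.
Qed.

Lemma sumb_le M M' : (forall n, 0 <= M' n <= M n) -> sumb M -> sumb M'.
Proof.
move=> h [M0 [B hB]]; split; first by move=> n; case/andP: (h n).
exists B => N; apply: le_trans (hB N); apply: ler_sum => i _; by case/andP: (h i).
Qed.

Lemma sumbZ M (k : RR) : 0 <= k -> sumb M -> sumb (fun n => k * M n).
Proof.
move=> k0 [M0 [B hB]]; split; first by move=> n; rewrite mulr_ge0.
by exists (k * B) => N; rewrite -mulr_sumr ler_wpM2l.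
Qed.

Lemma sumb_geom (K t : RR) : 0 <= K -> 0 <= t < 1 -> sumb (fun n => K * t ^+ n).
Proof.
move=> K0 ht; apply: sumbZ => //; split.
  by move=> n; rewrite exprn_ge0 //; case/andP: ht.
by exists (1 - t)^-1 => N; exact: geom_le.
Qed.

Lemma sumb_inv2 : sumb (fun n => (n.+1%:R ^+ 2)^-1).
Proof.
split; first by move=> n; rewrite invr_ge0 sqr_ge0.
exists 2 => N.
have H : \sum_(n < N.+1) (n.+1%:R ^+ 2)^-1 <= 2 - N.+1%:R^-1 :> RR.
  elim: N => [|N IH]; first by rewrite big_ord1 expr1n invr1; lra.
  rewrite big_ord_recr /=; apply: le_trans (lerD IH (lexx _)) _.
  rewrite -[N.+2%:R]natr1; have : 0 < N.+1%:R :> RR by rewrite ltr0n.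
  move: (N.+1%:R) => x x0.
  rewrite -addrA lerD2l -subr_ge0 opprD opprK.
  rewrite (_ : _ + _ = (x * (x + 1) ^+ 2)^-1).
    by rewrite invr_ge0 mulr_ge0 ?sqr_ge0 // ltW.
  by field; rewrite !gt_eqF // ?addr_gt0.
apply: (@le_trans _ _ (\sum_(n < N.+1) (n.+1%:R ^+ 2)^-1)).
  by rewrite big_ord_recr lerDl invr_ge0 sqr_ge0.
by apply: (le_trans H); rewrite lerBlDr lerDl invr_ge0.
Qed.

Lemma cauchyR (u : nat -> RR) : (forall eps, 0 < eps -> exists N, forall n,
   (N <= n)%N -> `|u n - u N| < eps) ->
  exists l, forall eps, 0 < eps -> exists N, forall n, (N <= n)%N -> `|u n - l| < eps.
Proof.
move=> h; have cu : cvg (u @ \oo)%classic.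
  apply: cauchy_cvg; apply/cauchy_ballP => eps e0.
  have [N HN] := h _ (divr_gt0 e0 (ltr0Sn _ 1)).
  pose A := [set u n | n in [set n | (N <= n)%N]]%classic.
  exists (A, A); first by split; exists N => // n /= hn; exists n.
  case=> x y [/= [n hn <-] [n' hn' <-]].
  have := HN _ hn; have := HN _ hn'; rewrite /ball /=.
  have := ler_distD (u N) (u n) (u n'); rewrite (distrC (u N) (u n')); lra.
exists (limn u) => eps e0; have := cu => /cvgrPdist_lt /(_ _ e0)[N _ HN].
by exists N => n nN; rewrite distrC; apply: HN.
Qed.

Lemma hs_exists c M : (forall n, nm (c n) <= M n) -> sumb M -> exists l, hs c l.
Proof.
move=> cM sM.
have H eps : 0 < eps -> exists N, forall n, (N <= n)%N ->
    nm (\sum_(k < n) c k - \sum_(k < N) c k) < eps.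
  move=> e0; have [K HK] := sumb_tail sM e0; exists K => n Kn.
  rewrite -!(big_mkord xpredT c) (@big_cat_nat _ _ _ K 0 n) //= addrAC subrr add0r.
  apply: le_lt_trans (nm_sum _ _ _) _; apply: le_lt_trans (HK n).
  by apply: ler_sum => i _.
have [a ha] : exists l, forall eps, 0 < eps -> exists N, forall n, (N <= n)%N ->
    `|complex.Re (\sum_(k < n) c k) - l| < eps.
  apply: cauchyR => eps /H[N HN]; exists N => n /HN; apply: le_lt_trans.
  by rewrite -ReN -ReD nm_Re.
have [b hb] : exists l, forall eps, 0 < eps -> exists N, forall n, (N <= n)%N ->
    `|complex.Im (\sum_(k < n) c k) - l| < eps.
  apply: cauchyR => eps /H[N HN]; exists N => n /HN; apply: le_lt_trans.
  by rewrite -ImN -ImD nm_Im.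
exists (a +i* b) => eps e0; have e2 : 0 < eps / 2 by rewrite divr_gt0.
have [N HN] := ha _ e2; have [N' HN'] := hb _ e2.
exists (maxn N N') => n; rewrite geq_max => /andP[/HN h1 /HN' h2].
by apply: le_lt_trans (nm_le _) _; rewrite ReD ImD ReN ImN /=; lra.
Qed.

Lemma hs_tail c l M K eps : hs c l -> (forall n, nm (c n) <= M n) ->
  (forall n, \sum_(K <= k < n) M k <= eps) -> nm (l - \sum_(k < K) c k) <= eps.
Proof.
move=> h cM hK.
have h2 := limB (lim_shift K h) (lim_cst (\sum_(k < K) c k)).
apply: (lim_nm_le h2) => n.
rewrite -!(big_mkord xpredT c) (@big_cat_nat _ _ _ K 0 (n + K)) ?leq_addl //=.
rewrite addrAC subrr add0r; apply: le_trans (nm_sum _ _ _) _.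
by apply: le_trans (hK (n + K)%N); apply: ler_sum => i _.
Qed.

Lemma hs_nm_le c l M B : hs c l -> (forall n, nm (c n) <= M n) ->
  (forall n, \sum_(k < n) M k <= B) -> nm l <= B.
Proof.
move=> h cM hB; have := @hs_tail c l M 0 B h cM; rewrite big_ord0 subr0; apply.
by move=> n; rewrite big_mkord.
Qed.

(** Dominated convergence for series: cut at K where the tail of the majorant is below eps/4, then
    pass to the limit in finitely many terms. [N0] admits hypotheses that hold only from some rank
    on. *)
Lemma tannery (a : nat -> nat -> C) (l : nat -> C) (S : nat -> C) (L : C) (M : nat -> RR) N0 :
  sumb M -> (forall N k, (N0 <= N)%N -> nm (a N k) <= M k) ->
  (forall k, lim_to (a^~ k) (l k)) -> (forall N, (N0 <= N)%N -> hs (a N) (S N)) -> hs l L ->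
  lim_to S L.
Proof.
move=> sM aM al hS hL.
have lM k : nm (l k) <= M k.
  apply: (lim_nm_le (lim_shift N0 (al k))) => n; by apply: aM; rewrite leq_addl.
move=> eps e0; have e4 : 0 < eps / 4 by rewrite divr_gt0.
have [K HK] := sumb_tail sM e4.
have HK' n : \sum_(K <= k < n) M k <= eps / 4 by apply: ltW.
have [N1 HN1] := lim_sum K al e4.
exists (maxn N0 N1) => N; rewrite geq_max => /andP[hN0 hN1].
have t1 := hs_tail (hS N hN0) (fun k => aM N k hN0) HK'.
have t2 := hs_tail hL lM HK'.
have t3 := HN1 N hN1; rewrite nmBC in t2.
rewrite (_ : S N - L = (S N - \sum_(k < K) a N k) +
  ((\sum_(k < K) a N k - \sum_(k < K) l k) + (\sum_(k < K) l k - L))); last by ring.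
apply: le_lt_trans (nmD _ _) _.
have := nmD (\sum_(k < K) a N k - \sum_(k < K) l k) (\sum_(k < K) l k - L).
lra.
Qed.

Lemma hs_dil m c l : (0 < m)%N -> hs c l -> hs (dil m c) l.
Proof.
move=> m0 h eps /h[N HN]; exists (N * m)%N => n hn; rewrite sum_dil //.
by apply: HN; rewrite leq_divRL //; apply: leq_trans hn (leq_addr _ _).
Qed.

(** * Power series on the unit disc and their derivatives *)

(** Equivalent to convergence on the open unit disc, in a form stable under sums, Cauchy products, x
    d/dx and x -> x^m. *)
Definition tame (c : nat -> C) := forall r : RR, 0 < r < 1 ->
  exists B, forall n, nm (c n) * r ^+ n <= B.

Lemma tame_maj c (t : RR) : tame c -> 0 <= t < 1 ->
  exists K th, [/\ 0 <= K, 0 <= th < 1 & forall n, nm (c n) * t ^+ n <= K * th ^+ n].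
Proof.
move=> tc /andP[t0 t1].
have r01 : 0 < (1 + t) / 2 < 1 by lra.
have [B hB] := tc _ r01; set r := (1 + t) / 2 in r01 hB; have [r0 r1] := andP r01.
exists B, (t / r); split.
- by apply: le_trans (hB 0%N); rewrite expr0 mulr1 nm_ge0.
- rewrite divr_ge0 ?(ltW r0) //= ltr_pdivrMr // mul1r /r; lra.
move=> n; rewrite expr_div_n mulrA ler_pdivlMr ?exprn_gt0 //.
rewrite mulrAC; apply: ler_wpM2r (hB n); exact: exprn_ge0.
Qed.

Lemma tame_sumb c (t : RR) : tame c -> 0 <= t < 1 -> sumb (fun n => nm (c n) * t ^+ n).
Proof.
move=> tc ht; have [K [th [K0 hth h]]] := tame_maj tc ht.
apply: sumb_le (sumb_geom K0 hth) => n; rewrite h andbT mulr_ge0 ?nm_ge0 //.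
by apply: exprn_ge0; case/andP: ht.
Qed.

Lemma tame_sumbq c q : tame c -> nm q < 1 -> sumb (fun n => nm (c n * q ^+ n)).
Proof.
move=> tc q1; have h : 0 <= nm q < 1 by rewrite nm_ge0.
by apply: sumb_le (tame_sumb tc h) => n; rewrite nmM nmX lexx mulr_ge0 ?nm_ge0 // exprn_ge0 ?nm_ge0.
Qed.

(** A total function: [xget] returns 0 where the series diverges. *)
Definition pev (c : nat -> C) (q : C) : C :=
  xget 0 [set l | hs (fun n => c n * q ^+ n) l]%classic.

Lemma pevP c q : tame c -> nm q < 1 -> hs (fun n => c n * q ^+ n) (pev c q).
Proof.
move=> tc q1; have [l hl] := hs_exists (fun=> lexx _) (tame_sumbq tc q1).
by rewrite /pev; case: xgetP => [y _ //|/(_ l)].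
Qed.

Lemma pev_hs c q l : tame c -> nm q < 1 -> hs (fun n => c n * q ^+ n) l -> pev c q = l.
Proof. by move=> tc q1; apply: hs_uniq; apply: pevP. Qed.

Lemma tame_of_hs c : (forall r : RR, 0 < r < 1 -> exists l, hs (fun n => c n * r%:C ^+ n) l) ->
  tame c.
Proof.
move=> h r /andP[r0 r1]; have [l hl] := h r (introT andP (conj r0 r1)).
have [B hB] := lim_bounded hl.
exists (B + B) => n.
have := nmB (\sum_(k < n.+1) c k * r%:C ^+ k) (\sum_(k < n) c k * r%:C ^+ k).
rewrite {1}big_ord_recr /= [X in nm X <= _](_ : _ = c n * r%:C ^+ n); last by ring.
rewrite nmM nmX nm_real ger0_norm ?(ltW r0) //.
by move/le_trans; apply; apply: lerD; exact: hB.
Qed.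

Lemma tame_le c d : tame c -> (forall n, nm (d n) <= nm (c n)) -> tame d.
Proof.
move=> tc h r hr; have [B hB] := tc r hr; exists B => n; apply: le_trans (hB n).
by rewrite ler_wpM2r // exprn_ge0 // ltW //; case/andP: hr.
Qed.

Lemma tameD c d : tame c -> tame d -> tame (fun n => c n + d n).
Proof.
move=> tc td r hr; have [B hB] := tc r hr; have [B' hB'] := td r hr.
exists (B + B') => n; apply: le_trans (lerD (hB n) (hB' n)).
by rewrite -mulrDl ler_wpM2r ?nmD // exprn_ge0 // ltW //; case/andP: hr.
Qed.

Lemma tameZ c k : tame c -> tame (fun n => k * c n).
Proof.
move=> tc r hr; have [B hB] := tc r hr.
by exists (nm k * B) => n; rewrite nmM -mulrA ler_wpM2l ?nm_ge0.
Qed.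

(** n t^n is at most 1 + t + ... + t^(n - 1). *)
Lemma natr_geom_le (t : RR) n : 0 <= t < 1 -> n%:R * t ^+ n <= (1 - t)^-1.
Proof.
move=> ht; apply: le_trans (geom_le n ht).
have [t0 t1] := andP ht.
rewrite -[n in n%:R]card_ord -sum1_card natr_sum mulr_suml; apply: ler_sum => i _.
by rewrite mul1r; apply: ler_wiXn2l => //; [exact: ltW|exact: ltnW (ltn_ord i)].
Qed.

Lemma tame_nat c : tame c -> tame (fun n => n%:R * c n).
Proof.
move=> tc r hr; have [r0 r1] := andP hr.
have [K [th [K0 hth h]]] := tame_maj tc (introT andP (conj (ltW r0) r1)).
exists (K * (1 - th)^-1) => n; rewrite nmM nm_nat -mulrA.
apply: le_trans (ler_wpM2l (ler0n _ n) (h n)) _.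
rewrite mulrCA; apply: ler_wpM2l => //; exact: natr_geom_le.
Qed.

Lemma tame_natI c d : tame c -> (forall n, nm (d n) <= n%:R * nm (c n)) -> tame d.
Proof.
move=> tc h; apply: (tame_le (tame_nat tc)) => n.
by rewrite nmM nm_nat.
Qed.

Lemma tame_shift c : tame c -> tame (fun n => c n.+1).
Proof.
move=> tc r hr; have [B hB] := tc r hr; have [r0 r1] := andP hr.
exists (B / r) => n; rewrite ler_pdivlMr // -mulrA -exprSr; exact: hB.
Qed.

Lemma tame_cst1 : tame (fun=> 1).
Proof.
move=> r /andP[r0 r1]; exists 1 => n; rewrite nm1 mul1r.
by apply: exprn_ile1; exact: ltW.
Qed.

Lemma tame_dil m c : (0 < m)%N -> tame c -> tame (dil m c).
Proof.
move=> m0 tc r hr; have [B hB] := tc r hr; have [r0 r1] := andP hr.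
exists B => n; rewrite /dil; case: ifP => _; last first.
  by rewrite nm0 mul0r; apply: le_trans (hB 0%N); rewrite expr0 mulr1 nm_ge0.
apply: le_trans (hB (n %/ m)%N); apply: ler_wpM2l; first exact: nm_ge0.
by apply: ler_wiXn2l; rewrite ?leq_div //; exact: ltW.
Qed.

Definition conv (c d : nat -> C) (n : nat) : C := \sum_(i < n.+1) c i * d (n - i)%N.

Lemma sum_conv c d N :
  \sum_(n < N) conv c d n = \sum_(i < N) c i * \sum_(j < N - i) d j.
Proof.
elim: N => [|N IH]; first by rewrite !big_ord0.
rewrite big_ord_recr /= IH /conv !big_ord_recr /= subSnn big_ord1 subnn addrA.
congr (_ + _); rewrite -big_split /=; apply: eq_bigr => i _.
by rewrite (subSn (ltnW (ltn_ord i))) big_ord_recr mulrDr.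
Qed.

(** Mertens's theorem as an instance of [tannery]: the N-th partial sum of the product is a sum over
    i < N of c_i times a partial sum of d, and the partial sums of d are bounded. *)
Lemma hs_conv c d A B M : (forall n, nm (c n) <= M n) -> sumb M -> hs c A -> hs d B ->
  hs (conv c d) (A * B).
Proof.
move=> cM sM hA hB.
have [D hD] := lim_bounded hB.
have D0 : 0 <= D by apply: le_trans (nm_ge0 _) (hD 0%N).
pose a N i := if (i < N)%N then c i * \sum_(j < N - i) d j else 0.
have M0 i : 0 <= M i by case: sM.
apply: (@tannery a (fun i => c i * B) _ _ (fun n => D * M n) 0).
- exact: sumbZ.
- move=> N k _; rewrite /a; case: ifP => _; last by rewrite nm0 mulr_ge0.
  by rewrite nmM mulrC ler_pM ?nm_ge0.
- move=> k; have h : lim_to (fun n => c k * \sum_(j < n - k) d j) (c k * B).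
    apply: limZ => eps /hB[N HN]; exists (N + k)%N => n hn; apply: HN.
    by rewrite leq_subRL ?(leq_trans (leq_addl N k)) // addnC.
  by apply: (@lim_ext_near _ _ _ k.+1 _ h) => n kn; rewrite /a kn.
- move=> N _; rewrite sum_conv.
  have := @hs_finite (a N) N; rewrite (eq_bigr (fun i : 'I_N => c i * \sum_(j < N - i) d j)).
    by apply => n hn; rewrite /a ltnNge hn.
  by move=> i _; rewrite /a ltn_ord.
by rewrite mulrC; apply: hs_ext (hsZ B hA) => n; rewrite mulrC.
Qed.

Lemma conv_X c d q n : conv c d n * q ^+ n =
  conv (fun n => c n * q ^+ n) (fun n => d n * q ^+ n) n.
Proof.
rewrite /conv mulr_suml; apply: eq_bigr => i _.
have -> : q ^+ n = q ^+ i * q ^+ (n - i) by rewrite -exprD subnKC // leq_ord.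
ring.
Qed.

Lemma tame_conv c d : tame c -> tame d -> tame (conv c d).
Proof.
move=> tc td; apply: tame_of_hs => r hr; have [r0 r1] := andP hr.
have q1 : nm r%:C < 1 by rewrite nm_real gtr0_norm.
exists (pev c r%:C * pev d r%:C).
apply: hs_ext (hs_conv (fun=> lexx _) (tame_sumbq tc q1) (pevP tc q1) (pevP td q1)) => n.
by rewrite conv_X.
Qed.

Lemma pevM c d q : tame c -> tame d -> nm q < 1 -> pev (conv c d) q = pev c q * pev d q.
Proof.
move=> tc td q1; apply: pev_hs => //; first exact: tame_conv.
apply: hs_ext (hs_conv (fun=> lexx _) (tame_sumbq tc q1) (pevP tc q1) (pevP td q1)) => n.
by rewrite conv_X.
Qed.

Lemma pevD c d q : tame c -> tame d -> nm q < 1 ->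
  pev (fun n => c n + d n) q = pev c q + pev d q.
Proof.
move=> tc td q1; apply: pev_hs => //; first exact: tameD.
by apply: hs_ext (hsD (pevP tc q1) (pevP td q1)) => n; rewrite mulrDl.
Qed.

Lemma pevZ c k q : tame c -> nm q < 1 -> pev (fun n => k * c n) q = k * pev c q.
Proof.
move=> tc q1; apply: pev_hs => //; first exact: tameZ.
by apply: hs_ext (hsZ k (pevP tc q1)) => n; rewrite mulrA.
Qed.

Lemma nmX_lt1 q m : (0 < m)%N -> nm q < 1 -> nm (q ^+ m) < 1.
Proof. by move=> m0 q1; rewrite nmX exprn_ilt1 ?nm_ge0 // -lt0n. Qed.

Lemma pev_dil m c q : (0 < m)%N -> tame c -> nm q < 1 ->
  pev (dil m c) q = pev c (q ^+ m).
Proof.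
move=> m0 tc q1; apply: pev_hs => //; first exact: tame_dil.
have h := hs_dil m0 (pevP tc (nmX_lt1 m0 q1)).
apply: hs_ext h => n; rewrite /dil; case: ifP => [hn|_]; rewrite ?mul0r //.
by rewrite -exprM mulnC divnK.
Qed.

Lemma pev_shift c q : tame c -> nm q < 1 -> pev c q = c 0%N + q * pev (fun n => c n.+1) q.
Proof.
move=> tc q1; apply: pev_hs => //.
have h := hsZ q (pevP (tame_shift tc) q1).
have := @hs_unshift (fun n => c n * q ^+ n) (q * pev (fun n => c n.+1) q).
rewrite expr0 mulr1; apply; apply: hs_ext h => n; rewrite exprS; ring.
Qed.

(* A quadratic error term is available since all functions in play are analytic. *)
Definition has_d (f : C -> C) (z l : C) := exists K d : RR, 0 < d /\
  forall h, nm h <= d -> nm (f (z + h) - f z - l * h) <= K * nm h ^+ 2.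

Lemma has_dK f z l : has_d f z l -> exists K d : RR, [/\ 0 < d, d <= 1, 0 <= K &
  forall h, nm h <= d -> nm (f (z + h) - f z - l * h) <= K * nm h ^+ 2].
Proof.
move=> [K [d [d0 H]]]; exists `|K|, (Order.min d 1); split => //.
- by rewrite lt_min d0 ltr01.
- by rewrite ge_min lexx orbT.
move=> h; rewrite le_min => /andP[h1 _]; apply: (le_trans (H h h1)).
by rewrite ler_wpM2r ?sqr_ge0 ?ler_norm.
Qed.

Lemma has_d_lip f z l : has_d f z l -> exists K d : RR, [/\ 0 < d, d <= 1, 0 <= K &
  forall h, nm h <= d -> nm (f (z + h) - f z) <= K * nm h].
Proof.
move=> /has_dK[K [d [d0 d1 K0 H]]]; exists (K + nm l), d; split => //.
  by rewrite addr_ge0 ?nm_ge0.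
move=> h hd; have := H h hd.
have := nmD (f (z + h) - f z - l * h) (l * h); rewrite subrK nmM.
have := nm_ge0 h; have h1 : nm h <= 1 by apply: le_trans hd d1.
move=> h0 a b; have : nm h ^+ 2 <= nm h by rewrite expr2; nra.
nra.
Qed.

Lemma has_d_ext f g z l : (exists2 d : RR, 0 < d & forall h, nm h <= d -> f (z + h) = g (z + h)) ->
  has_d f z l -> has_d g z l.
Proof.
move=> [d d0 fg] [K [d' [d'0 H]]]; exists K, (Order.min d d'); split.
  by rewrite lt_min d0.
move=> h; rewrite le_min => /andP[h1 h2].
have fz : f z = g z by have := fg 0; rewrite addr0 nm0 => -> //; exact: ltW.
by rewrite -fg // -fz; exact: H.
Qed.

Lemma has_d_exti f g z l : (forall w, f w = g w) -> has_d f z l -> has_d g z l.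
Proof. by move=> fg; apply: has_d_ext; exists 1. Qed.

Lemma has_d_cst k z : has_d (fun=> k) z 0.
Proof.
by exists 0, 1; split => // h _; rewrite !mul0r !subr0 subrr nm0.
Qed.

Lemma has_d_id z : has_d id z 1.
Proof.
exists 0, 1; split => // h _; rewrite (_ : _ - _ = 0); last by rewrite /=; ring.
by rewrite nm0 mul0r.
Qed.

Lemma has_dD f g z l k : has_d f z l -> has_d g z k -> has_d (fun w => f w + g w) z (l + k).
Proof.
move=> [K [d [d0 H]]] [K' [d' [d'0 H']]]; exists (K + K'), (Order.min d d'); split.
  by rewrite lt_min d0.
move=> h; rewrite le_min => /andP[h1 h2].
rewrite (_ : _ - _ = (f (z + h) - f z - l * h) + (g (z + h) - g z - k * h)); last by ring.
apply: (le_trans (nmD _ _)); rewrite [leRHS]mulrDl; apply: lerD; [exact: H|exact: H'].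
Qed.

Lemma has_dM f g z l k : has_d f z l -> has_d g z k ->
  has_d (fun w => f w * g w) z (l * g z + f z * k).
Proof.
move=> hf hg.
have [K [d [d0 d1 K0 H]]] := has_dK hf; have [K' [d' [d'0 d'1 K'0 H']]] := has_dK hg.
have [L [r [r0 r1 L0 HL]]] := has_d_lip hf; have [L' [r' [r'0 r'1 L'0 HL']]] := has_d_lip hg.
exists (K * nm (g z) + nm (f z) * K' + L * L'), (Order.min (Order.min d d') (Order.min r r')).
split; first by rewrite !lt_min d0 d'0 r0.
move=> h; rewrite !le_min => /andP[/andP[h1 h2] /andP[h3 h4]].
rewrite (_ : _ - _ = (f (z + h) - f z - l * h) * g z + f z * (g (z + h) - g z - k * h)
   + (f (z + h) - f z) * (g (z + h) - g z)); last by ring.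
apply: (le_trans (nmD _ _)); rewrite [leRHS]mulrDl; apply: lerD.
  apply: (le_trans (nmD _ _)); rewrite [leRHS]mulrDl !nmM; apply: lerD.
    by rewrite mulrAC ler_wpM2r ?nm_ge0 // H.
  by rewrite -mulrA ler_wpM2l ?nm_ge0 // H'.
rewrite nmM expr2 mulrACA; apply: ler_pM; rewrite ?nm_ge0 //; [exact: HL|exact: HL'].
Qed.

Lemma has_dZ f z l k : has_d f z l -> has_d (fun w => k * f w) z (k * l).
Proof.
move=> hf; have := has_dM (has_d_cst k z) hf; rewrite mul0r add0r; exact.
Qed.

Lemma has_dN f z l : has_d f z l -> has_d (fun w => - f w) z (- l).
Proof.
move=> hf; rewrite -mulN1r; apply: has_d_exti (has_dZ (-1) hf) => w; by rewrite mulN1r.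
Qed.

Lemma has_dB f g z l k : has_d f z l -> has_d g z k -> has_d (fun w => f w - g w) z (l - k).
Proof. by move=> hf hg; apply: (has_dD hf (has_dN hg)). Qed.

Lemma has_d_comp f g z l k : has_d f z l -> has_d g (f z) k ->
  has_d (fun w => g (f w)) z (k * l).
Proof.
move=> hf hg.
have [K [d [d0 d1 K0 H]]] := has_dK hf; have [K' [d' [d'0 d'1 K'0 H']]] := has_dK hg.
have [L [r [r0 r1 L0 HL]]] := has_d_lip hf.
have L1 : 0 < L + 1 by lra.
exists (K' * L ^+ 2 + nm k * K), (Order.min (Order.min d r) (d' / (L + 1))).
split; first by rewrite !lt_min d0 r0 divr_gt0.
move=> h; rewrite !le_min => /andP[/andP[h1 h2]]; rewrite ler_pdivlMr // => h3.
have e1 := HL h h2; have h0 := nm_ge0 h.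
have e2 : nm (f (z + h) - f z) <= d' by nra.
have e4 : f z + (f (z + h) - f z) = f (z + h) by ring.
have e3 := H' _ e2; rewrite e4 in e3.
rewrite (_ : _ - _ = (g (f (z + h)) - g (f z) - k * (f (z + h) - f z)) +
   k * (f (z + h) - f z - l * h)); last by ring.
apply: (le_trans (nmD _ _)); rewrite [leRHS]mulrDl; apply: lerD.
  apply: (le_trans e3); rewrite -mulrA; apply: ler_wpM2l => //.
  by rewrite -exprMn ler_pXn2r ?nnegrE ?mulr_ge0 ?nm_ge0.
by rewrite nmM -mulrA ler_wpM2l ?nm_ge0 // H.
Qed.

Lemma has_d_inv z : z != 0 -> has_d (fun w => w^-1) z (- z ^- 2).
Proof.
move=> z0; have zp : 0 < nm z by rewrite nm_gt0.
exists (2 / nm z ^+ 3), (nm z / 2); split; first by rewrite divr_gt0.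
move=> h hh; have zh : nm z / 2 <= nm (z + h).
  have := nm_sub_ge z (- h); rewrite opprK nmN; lra.
have zh0 : z + h != 0 by rewrite -nm_gt0; lra.
rewrite (_ : _ - _ = h ^+ 2 / (z ^+ 2 * (z + h))); last by field; rewrite z0 zh0.
rewrite nm_div nmM !nmX mulrC; apply: ler_wpM2r; first exact: sqr_ge0.
rewrite ler_pdivlMr ?exprn_gt0 // mulrC ler_pdivrMr ?mulr_gt0 ?exprn_gt0 //; last by lra.
rewrite exprSr mulrCA; apply: ler_wpM2l; first exact: sqr_ge0.
lra.
Qed.

Lemma has_d_uniq f z l k : has_d f z l -> has_d f z k -> l = k.
Proof.
move=> /has_dK[K [d [d0 d1 K0 H]]] /has_dK[K' [d' [d'0 d'1 K'0 H']]].
apply/eqP; rewrite -subr_eq0 -[_ == _]negbK -nm_gt0; apply/negP => p.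
have KK : 0 < K + K' + 1 by lra.
pose t : RR := Order.min (Order.min d d') (nm (l - k) / (K + K' + 1)).
have t0 : 0 < t by rewrite !lt_min d0 d'0 divr_gt0.
have := lexx t; rewrite {2}/t !le_min => /andP[/andP[td td']].
rewrite ler_pdivlMr // => tk.
have nt : nm t%:C = t by rewrite nm_real gtr0_norm.
have := H t%:C; have := H' t%:C; rewrite nt => /(_ td') a /(_ td) b.
have := nmB (f (z + t%:C) - f z - k * t%:C) (f (z + t%:C) - f z - l * t%:C).
rewrite (_ : _ - _ - (_ - _) = (l - k) * t%:C); last by ring.
rewrite nmM nt => c; have : nm (l - k) * t <= (K + K') * (t * t) by rewrite expr2 in a b; lra.
by rewrite mulrA ler_pM2r //; lra.
Qed.

(** Multiplying through by r avoids the exponent n - 1; [diff_pow2_le] uses r^2 in the same way for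
    the second-order remainder. *)
Lemma diff_pow_le (q h : C) (r : RR) n : nm q <= r -> nm (q + h) <= r ->
  nm ((q + h) ^+ n - q ^+ n) * r <= n%:R * nm h * r ^+ n.
Proof.
move=> hq hqh; have r0 : 0 <= r by apply: le_trans (nm_ge0 _) hq.
elim: n => [|n IH]; first by rewrite !expr0 subrr nm0 !mul0r.
rewrite (_ : _ - _ = ((q + h) ^+ n - q ^+ n) * q + (q + h) ^+ n * h); last by rewrite !exprS; ring.
apply: le_trans (ler_wpM2r r0 (nmD _ _)) _; rewrite !nmM nmX.
have a : nm (q + h) ^+ n <= r ^+ n by rewrite lerXn2r ?nnegrE ?nm_ge0.
have h0 := nm_ge0 h; have q0 := nm_ge0 q.
have p0 : 0 <= nm (q + h) ^+ n by rewrite exprn_ge0 ?nm_ge0.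
have n0 : 0 <= n%:R :> RR by [].
have d0 := nm_ge0 ((q + h) ^+ n - q ^+ n).
rewrite (exprS r n) -natr1.
move: (nm (_ - _)) (nm q) (nm h) (nm (q + h) ^+ n) (r ^+ n) (n%:R : RR) IH a hq h0 q0 p0 n0 d0.
move=> D x y u v m IH a hq h0 q0 p0 n0 d0.
have : x * (D * r) <= r * (m * y * v) by apply: ler_pM => //; exact: mulr_ge0.
have : u * y * r <= v * y * r by rewrite ler_wpM2r // ler_wpM2r.
lra.
Qed.

Lemma diff_pow2_le (q h : C) (r : RR) n : nm q <= r -> nm (q + h) <= r ->
  nm ((q + h) ^+ n - q ^+ n - n%:R * q ^+ n.-1 * h) * r ^+ 2 <= n%:R ^+ 2 * nm h ^+ 2 * r ^+ n.
Proof.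
move=> hq hqh; have r0 : 0 <= r by apply: le_trans (nm_ge0 _) hq.
elim: n => [|n IH]; first by rewrite !expr0 subrr !mul0r subrr nm0 !mul0r expr0n /= !mul0r.
have -> : (q + h) ^+ n.+1 - q ^+ n.+1 - n.+1%:R * q ^+ n.+1.-1 * h =
  q * ((q + h) ^+ n - q ^+ n - n%:R * q ^+ n.-1 * h) + h * ((q + h) ^+ n - q ^+ n).
  rewrite /= -natr1 !exprS; case: n {IH} => [|n] /=; first by rewrite !expr0; ring.
  by rewrite !exprS; ring.
apply: le_trans (ler_wpM2r (sqr_ge0 r) (nmD _ _)) _; rewrite !nmM.
have D := diff_pow_le n hq hqh.
have h0 := nm_ge0 h; have q0 := nm_ge0 q.
have n0 : 0 <= n%:R :> RR by [].
have rn : 0 <= r ^+ n by apply: exprn_ge0.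
have E0 := nm_ge0 ((q + h) ^+ n - q ^+ n - n%:R * q ^+ n.-1 * h).
have D0 := nm_ge0 ((q + h) ^+ n - q ^+ n).
rewrite (exprS r n) -natr1.
move: (nm ((q + h) ^+ n - q ^+ n - n%:R * q ^+ n.-1 * h)) (nm ((q + h) ^+ n - q ^+ n)) (nm q) (nm h) (r ^+ n) (n%:R : RR) IH D hq h0 q0 n0 rn E0 D0.
move=> E D x y v m IH HD hq h0 q0 n0 rn E0 D0.
have : x * (E * r ^+ 2) <= r * (m ^+ 2 * y ^+ 2 * v).
  by apply: ler_pM => //; rewrite mulr_ge0 // sqr_ge0.
have : y * (D * r) * r <= y * (m * y * v) * r.
  by rewrite ler_wpM2r // ler_wpM2l.
have : 0 <= y * y * v * r by rewrite !mulr_ge0.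
have : 0 <= m * (y * y * v * r) by rewrite !mulr_ge0.
lra.
Qed.

Definition dser (c : nat -> C) (n : nat) : C := n.+1%:R * c n.+1.

Lemma tame_dser c : tame c -> tame (dser c).
Proof. by move=> tc; have := tame_shift (tame_nat tc). Qed.

Lemma pev_dser c q : tame c -> nm q < 1 ->
  hs (fun n => c n * (n%:R * q ^+ n.-1)) (pev (dser c) q).
Proof.
move=> tc q1.
have := @hs_unshift (fun n => c n * (n%:R * q ^+ n.-1)) (pev (dser c) q).
rewrite mul0r mulr0 add0r; apply; apply: hs_ext (pevP (tame_dser tc) q1) => n.
by rewrite /dser /=; ring.
Qed.

(** Termwise differentiation on a disc of radius r halfway between |q| and 1: by [diff_pow2_le] the
    remainders add up to at most |h|^2 r^-2 times the sum of n^2 |c_n| r^n. *)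
Lemma has_d_pev c q : tame c -> nm q < 1 -> has_d (pev c) q (pev (dser c) q).
Proof.
move=> tc q1; have q0 := nm_ge0 q.
pose r := (1 + nm q) / 2; have r0 : 0 < r by rewrite /r; lra.
have r1 : r < 1 by rewrite /r; lra.
have [S0 [B hB]] := tame_sumb (tame_nat (tame_nat tc)) (introT andP (conj (ltW r0) r1)).
exists (B / r ^+ 2), (r - nm q); split; first by rewrite /r; lra.
move=> h hh; have qh : nm (q + h) <= r by apply: (le_trans (nmD _ _)); lra.
have qr : nm q <= r by rewrite /r; lra.
have qh1 : nm (q + h) < 1 by apply: le_lt_trans qh r1.
have H := hsB (hsB (pevP tc qh1) (pevP tc q1)) (hsZ h (pev_dser tc q1)).
rewrite [leRHS]mulrAC ler_pdivlMr ?exprn_gt0 // (mulrC (pev (dser c) q)).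
have n2 : nm (r%:C ^+ 2) = r ^+ 2 by rewrite nmX nm_real gtr0_norm.
rewrite [leLHS]mulrC -n2 -nmM.
rewrite [leRHS](mulrC B).
apply: (hs_nm_le (hsZ (r%:C ^+ 2) H)
  (M := fun n => nm h ^+ 2 * (nm (n%:R * (n%:R * c n)) * r ^+ n))).
  move=> n; rewrite (_ : _ - _ = c n * ((q + h) ^+ n - q ^+ n - n%:R * q ^+ n.-1 * h)); last by ring.
  rewrite nmM n2 !nmM !nm_nat mulrCA.
  have := ler_wpM2l (nm_ge0 (c n)) (diff_pow2_le n qr qh).
  rewrite [X in X <= _ -> _](_ : _ = nm (c n) * (r ^+ 2 *
    nm ((q + h) ^+ n - q ^+ n - n%:R * q ^+ n.-1 * h))); last by ring.
  move/le_trans; apply; rewrite le_eqVlt; apply/orP; left; apply/eqP; ring.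
by move=> n; rewrite -mulr_sumr ler_wpM2l ?sqr_ge0.
Qed.

(** * Partial fractions of the cotangent *)

(** For u = e(w), [koebe u] is -1/(4 sin(pi w)^2) and [cayley u] is i cot(pi w). As a power series,
    [koebe u] is the sum of n u^n. *)
Definition koebe (u : C) : C := u / (1 - u) ^+ 2.
Definition cayley (u : C) : C := (1 + u) / (1 - u).

Lemma nm_tpi : nm tpi = 2 * pi.
Proof. by rewrite nmM nm_real nmi mulr1 ger0_norm // mulr_ge0 // pi_ge0. Qed.

Lemma tpi_neq0 : tpi != 0.
Proof. by rewrite -nm_gt0 nm_tpi mulr_gt0 // pi_gt0. Qed.

Section RootsOfUnity.
Variable N : nat.
Hypothesis N0 : (0 < N)%N.

Let z : C := e N%:R^-1.

Lemma zN : z ^+ N = 1.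
Proof. by rewrite /z -e_mulrn -(mulr_natr N%:R^-1) mulVf ?e1 // pnatr_eq0 -lt0n. Qed.

(** [e_lower] with Y = 0 excludes e(y) = 1 for 0 < |y| <= 3/4; a fraction j/N above 3/4 is first
    moved by -1. *)
Lemma zj_neq1 j : (0 < j < N)%N -> z ^+ j != 1.
Proof.
move=> /andP[j0 jN]; rewrite /z -e_mulrn -(mulr_natr N%:R^-1).
pose x : RR := j%:R / N%:R.
have np : 0 < N%:R :> RR by rewrite ltr0n.
have x0 : 0 < x by rewrite divr_gt0 // ltr0n.
have x1 : x < 1 by rewrite ltr_pdivrMr // mul1r ltr_nat.
have -> : N%:R^-1 * j%:R = x%:C :> C by rewrite rmorphM fmorphV !rmorph_nat mulrC.
have [c c0 H] := e_lower (lexx (0 : RR)).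
have K (y : RR) : y != 0 -> `|y| <= 3 / 4 -> e y%:C != 1.
  move=> y0 hy; have h2 : 0 <= complex.Im y%:C <= (0 : RR) by rewrite /= lexx.
  have := H y%:C hy h2; rewrite nm_real; apply: contraTneq => ->; rewrite subrr nm0 -ltNge.
  by rewrite mulr_gt0 // normr_gt0.
have [h|h] := leP x (3 / 4); first by apply: K; [rewrite gt_eqF|rewrite ger0_norm // ltW].
have -> : e x%:C = e (x - 1)%:C by rewrite rmorphB /= eD eN e1 invr1 mulr1.
by apply: K; [rewrite subr_eq0 lt_eqF | rewrite ler0_norm; lra].
Qed.

Lemma sum_zj j : (j < N)%N -> \sum_(k < N) (z ^+ k) ^+ j = if j == 0%N then N%:R else 0.
Proof.
move=> jN; case: eqVneq => [->|j0].
  under eq_bigr do rewrite expr0.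
  by rewrite sumr_const card_ord.
have hj : z ^+ j != 1 by apply: zj_neq1; rewrite jN lt0n j0.
have h := subrX1 (z ^+ j) N.
rewrite -exprM mulnC exprM zN expr1n subrr in h.
under eq_bigr do rewrite -exprM mulnC exprM.
apply/eqP; move/esym/eqP: h; rewrite mulf_eq0 subr_eq0 (negbTE hj) //.
Qed.

Variable p : C.
Hypothesis pN : p ^+ N != 1.

Lemma zp_neq1 k : 1 - z ^+ k * p != 0.
Proof.
rewrite subr_eq0; apply: contra_neq pN => h.
have := congr1 (fun x => x ^+ N) h; rewrite expr1n exprMn -exprM mulnC exprM zN expr1n mul1r.
by move->.
Qed.

Lemma zpN k : (z ^+ k * p) ^+ N = p ^+ N.
Proof. by rewrite exprMn -exprM mulnC exprM zN expr1n mul1r. Qed.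

Let P1 : 1 - p ^+ N != 0.
Proof. by rewrite subr_eq0 eq_sym. Qed.

(** As (z^k p)^N = p^N, each term is a finite geometric sum over 1 - p^N; orthogonality of the roots
    of unity keeps only the exponent 0. *)
Lemma sum_inv1 : \sum_(k < N) (1 - z ^+ k * p)^-1 = N%:R / (1 - p ^+ N).
Proof.
apply: (mulIf P1); rewrite divfK // mulr_suml.
transitivity (\sum_(k < N) \sum_(j < N) (z ^+ k * p) ^+ j).
  apply: eq_bigr => k _; apply: (mulfI (zp_neq1 k)).
  rewrite mulVKf ?zp_neq1 // -(zpN k) -[1 in LHS](expr1n _ N).
  by rewrite expr1n -opprB subrX1 -mulNr opprB.
rewrite exchange_big /= (eq_bigr (fun j : 'I_N => (if j == 0%N :> nat then N%:R else 0) * p ^+ j)).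
  rewrite (bigD1 (Ordinal N0)) //= expr0 mulr1 big1 ?addr0 // => i.
  by rewrite -val_eqE /= => /negbTE ->; rewrite mul0r.
move=> j _; rewrite -sum_zj // mulr_suml; apply: eq_bigr => k _.
by rewrite exprMn.
Qed.

Lemma sum_arith_geom (u : C) n :
  (\sum_(j < n) j.+1%:R * u ^+ j) * (1 - u) ^+ 2 = 1 - u ^+ n - n%:R * u ^+ n * (1 - u).
Proof.
elim: n => [|n IH]; first by rewrite big_ord0 !mul0r expr0 subrr subr0.
rewrite big_ord_recr /= mulrDl IH -[n.+1%:R]natr1 (exprS u n); ring.
Qed.

(** The same with the sum of (j + 1) u^j, whose closed form brings back the first powers treated in
    [sum_inv1]. *)
Lemma sum_inv2 : \sum_(k < N) (1 - z ^+ k * p) ^- 2 =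
  (N%:R + N%:R * p ^+ N * (N%:R / (1 - p ^+ N))) / (1 - p ^+ N).
Proof.
apply: (mulIf P1); rewrite divfK // mulr_suml -sum_inv1.
transitivity (\sum_(k < N) (\sum_(j < N) j.+1%:R * (z ^+ k * p) ^+ j +
   N%:R * p ^+ N * (1 - z ^+ k * p)^-1)).
  apply: eq_bigr => k _; have h := sum_arith_geom (z ^+ k * p) N.
  rewrite zpN in h; have h0 := zp_neq1 k.
  apply: (mulIf (expf_neq0 2 h0)); rewrite mulrAC mulVf ?expf_neq0 // mul1r mulrDl h.
  by field.
rewrite big_split /= -mulr_sumr; congr (_ + _).
rewrite exchange_big /= (eq_bigr (fun j : 'I_N => j.+1%:R * (if j == 0%N :> nat then N%:R else 0) * p ^+ j)).
  rewrite (bigD1 (Ordinal N0)) //= expr0 mulr1 mul1r big1 ?addr0 // => i.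
  by rewrite -val_eqE /= => /negbTE ->; rewrite mulr0 mul0r.
move=> j _; rewrite -sum_zj // mulr_sumr mulr_suml; apply: eq_bigr => k _.
by rewrite exprMn mulrA.
Qed.

Lemma sum_cayley : \sum_(k < N) cayley (z ^+ k * p) = N%:R * cayley (p ^+ N).
Proof.
transitivity (\sum_(k < N) (2 * (1 - z ^+ k * p)^-1 - 1)).
  by apply: eq_bigr => k _; rewrite /cayley; field; exact: zp_neq1.
rewrite sumrB -mulr_sumr sum_inv1 sumr_const card_ord /cayley; field; exact: P1.
Qed.

Lemma sum_koebe : \sum_(k < N) koebe (z ^+ k * p) = N%:R ^+ 2 * koebe (p ^+ N).
Proof.
transitivity (\sum_(k < N) ((1 - z ^+ k * p) ^- 2 - (1 - z ^+ k * p)^-1)).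
  apply: eq_bigr => k _; rewrite /koebe; have := zp_neq1 k; move: (z ^+ k * p) => u u1.
  by field.
rewrite sumrB sum_inv1 sum_inv2 /koebe; have := P1; move: (p ^+ N) => u u1.
by field.
Qed.

End RootsOfUnity.

(** For N = 2K + 1 the N-th roots of unity can be indexed by -K, ..., K, so that the terms pair as
    in the symmetric series over w + k and w - k. *)
Lemma sum_symm (g : C -> C) (w : C) K : let N := K.*2.+1%:R : C in
  \sum_(k < K.*2.+1) g (e N^-1 ^+ k * e (w / N)) =
  g (e (w / N)) + \sum_(k < K) (g (e ((w + k.+1%:R) / N)) + g (e ((w - k.+1%:R) / N))).
Proof.
move=> N; have N0 : N != 0 by rewrite pnatr_eq0.
have E k : e N^-1 ^+ k * e (w / N) = e ((w + k%:R) / N).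
  by rewrite -e_mulrn -eD mulrDl addrC -[N^-1 *+ k]mulr_natl.
rewrite big_ord_recl /= expr0 mul1r; congr (_ + _).
under eq_bigr => k _ do rewrite E /bump /= add1n.
rewrite -addnn big_split_ord big_split /=; congr (_ + _).
rewrite (reindex_inj rev_ord_inj) /=; apply: eq_bigr => k _; congr (g _).
have -> : (w - k.+1%:R) / N = (w + (K + (K - k.+1)).+1%:R) / N - 1.
  apply: (mulIf N0); rewrite [RHS]mulrBl !divfK // mul1r /N.
  have -> : (K.*2.+1 = K + (K - k.+1) + 1 + k.+1)%N.
    by rewrite addnAC addn1 -addnA subnK // addnn.
  rewrite (natrD _ (K + (K - k.+1) + 1) k.+1) addn1; ring.
by rewrite eD eN e1 invr1 mulr1.
Qed.

Lemma lim_e1 (v : C) : lim_to (fun K => K.*2.+1%:R * (e (v / K.*2.+1%:R) - 1)) (tpi * v).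
Proof.
have [A A0 HA] := e_lin.
have p16 : 0 < 16^-1 :> RR by rewrite invr_gt0 ltr0n.
have [N0 HN0] := lim0_inv (nm v) p16.
apply: (@lim_bound _ _ (fun K => (A * nm v ^+ 2) / K.+1%:R) N0) => [K hK|]; last exact: lim0_inv.
set N : C := K.*2.+1%:R; have Nn0 : N != 0 by rewrite pnatr_eq0.
have np : 0 < nm N by rewrite nm_gt0.
have nN : nm N = K.*2.+1%:R by rewrite nm_nat.
have kN : K.+1%:R <= nm N by rewrite nN ler_nat ltnS -addnn leq_addr.
have kp : 0 < K.+1%:R :> RR by rewrite ltr0n.
rewrite (_ : _ - _ = N * (e (v / N) - 1 - tpi * (v / N))); last by field.
have hv : nm (v / N) <= nm v / K.+1%:R.
  by rewrite nm_div ler_wpM2l ?nm_ge0 // lef_pV2.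
have h16 : nm (v / N) <= 16^-1 by apply: le_trans hv (ltW (HN0 K hK)).
rewrite nmM; apply: (le_trans (ler_wpM2l (ltW np) (HA _ h16))).
rewrite nm_div expr_div_n expr2 mulrCA.
rewrite (_ : nm N * (nm v * nm v / nm N ^+ 2) = nm v ^+ 2 / nm N); last first.
  by field; rewrite gt_eqF.
rewrite mulrA; apply: ler_wpM2l; first by rewrite mulr_ge0 ?sqr_ge0 ?(ltW A0).
by rewrite lef_pV2.
Qed.

Lemma lim_invN : lim_to (fun K => (K.*2.+1%:R)^-1) 0.
Proof.
apply: (@lim_bound _ _ (fun K => 1 / K.+1%:R) 0); last exact: lim0_inv.
move=> K _; rewrite subr0 nmV nm_nat div1r lef_pV2 ?posrE ?ltr0n //.
by rewrite ler_nat ltnS -addnn leq_addr.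
Qed.

Lemma lim_e (v : C) : lim_to (fun K => e (v / K.*2.+1%:R)) 1.
Proof.
have h := limD (lim_cst 1) (limM lim_invN (lim_e1 v)).
rewrite mul0r addr0 in h; apply: lim_ext h => K.
by rewrite mulKf ?pnatr_eq0 // addrC subrK.
Qed.

Lemma lim_1e (v : C) : v != 0 ->
  lim_to (fun K => (K.*2.+1%:R * (1 - e (v / K.*2.+1%:R)))^-1) (- (tpi * v))^-1.
Proof.
move=> v0; apply: limV; first by rewrite oppr_eq0 mulf_neq0 // tpi_neq0.
by apply: lim_ext (limN (lim_e1 v)) => K; rewrite -mulrN opprB.
Qed.

Lemma lim_cayley (v : C) : v != 0 ->
  lim_to (fun K => cayley (e (v / K.*2.+1%:R)) / K.*2.+1%:R) (- (2 / (tpi * v))).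
Proof.
move=> v0; have h := limM (limD (lim_cst 1) (lim_e v)) (lim_1e v0).
rewrite (_ : - _ = (1 + 1) * (- (tpi * v))^-1); last by rewrite invrN mulrN.
by apply: lim_ext h => K; rewrite /cayley invfM mulrA mulrAC -!mulrA; congr (_ * _).
Qed.

Lemma lim_koebe (v : C) : v != 0 ->
  lim_to (fun K => koebe (e (v / K.*2.+1%:R)) / K.*2.+1%:R ^+ 2) ((tpi * v) ^- 2).
Proof.
move=> v0; have h := limM (lim_e v) (limM (lim_1e v0) (lim_1e v0)).
rewrite mul1r -expr2 exprVn sqrrN in h.
apply: lim_ext h => K; rewrite /koebe -expr2 exprVn exprMn invfM mulrA mulrAC -!mulrA.
by congr (_ * _); rewrite mulrC.
Qed.

Section PartialFractions.
Variables (w : C) (kap : RR).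
Hypotheses (w0 : w != 0) (ew1 : e w != 1) (Iw : 0 <= complex.Im w) (kap0 : 0 < kap).
Hypothesis hk : forall k, kap * k.+1%:R <= nm (w + k.+1%:R) /\ kap * k.+1%:R <= nm (w - k.+1%:R).

Lemma e_shift_lower : exists (c : RR) (K0 : nat), 0 < c /\ forall K (v : C), (K0 <= K)%N ->
  complex.Im v = complex.Im w -> `|complex.Re v| <= `|complex.Re w| + K%:R ->
  c * (nm v / K.*2.+1%:R) <= nm (1 - e (v / K.*2.+1%:R)).
Proof.
have [c c0 H] := e_lower Iw; exists c.
(* K >= 2 |Re w| gives (|Re w| + K)/(2K + 1) <= 3/4, the range of [e_lower]. *)
exists (Num.Def.truncn (2 * `|complex.Re w|)).+1; split => // K v hK Iv Rv.
have np : 0 < K.*2.+1%:R :> RR by rewrite ltr0n.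
have E : (K.*2.+1%:R : C) = (K.*2.+1%:R : RR)%:C by rewrite rmorph_nat.
have R1 : complex.Re (v / K.*2.+1%:R) = complex.Re v / K.*2.+1%:R.
  by rewrite E ReM -fmorphV /= mulr0 subr0.
have I1 : complex.Im (v / K.*2.+1%:R) = complex.Im w / K.*2.+1%:R.
  by rewrite E ImM -fmorphV /= mulr0 add0r Iv.
have := H (v / K.*2.+1%:R); rewrite R1 I1 nm_div nm_nat; apply.
  rewrite normrM normfV (gtr0_norm np) ler_pdivrMr //.
  have k2 : 2 * `|complex.Re w| <= K%:R.
    by apply: ltW; apply: lt_le_trans (truncnS_gt _) _; rewrite ler_nat.
  have -> : K.*2.+1%:R = 2 * K%:R + 1 :> RR by rewrite -addn1 natrD -mul2n natrM.
  lra.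
rewrite divr_ge0 ?(ltW np) //= ler_pdivrMr // ler_peMr //.
by rewrite ler1n.
Qed.

Lemma wk_neq0 k : w + k.+1%:R != 0 /\ w - k.+1%:R != 0.
Proof.
have [h1 h2] := hk k; have p : 0 < kap * k.+1%:R by rewrite mulr_gt0 // ltr0n.
by rewrite -!nm_gt0; split; [apply: lt_le_trans h1|apply: lt_le_trans h2].
Qed.

Lemma nm_e_divN (v : C) K : complex.Im v = complex.Im w -> nm (e (v / K.*2.+1%:R)) <= 1.
Proof.
move=> Iv; rewrite nm_e expR_le1 oppr_le0 mulr_ge0 ?mulr_ge0 ?pi_ge0 //.
have -> : (K.*2.+1%:R : C) = (K.*2.+1%:R : RR)%:C by rewrite rmorph_nat.
by rewrite ImM -fmorphV /= mulr0 add0r Iv mulr_ge0 // invr_ge0.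
Qed.

Lemma Im_wk k : complex.Im (w + k.+1%:R) = complex.Im w /\ complex.Im (w - k.+1%:R) = complex.Im w.
Proof. by rewrite !ImD ImN Im_nat oppr0 addr0. Qed.

Lemma inv_bounds : exists (c : RR) (K0 : nat), 0 < c /\ forall K m, (K0 <= K)%N -> (m < K)%N ->
  [/\ 1 - e ((w + m.+1%:R) / K.*2.+1%:R) != 0, 1 - e ((w - m.+1%:R) / K.*2.+1%:R) != 0,
   nm (K.*2.+1%:R * (1 - e ((w + m.+1%:R) / K.*2.+1%:R)))^-1 <= (c * m.+1%:R)^-1 &
   nm (K.*2.+1%:R * (1 - e ((w - m.+1%:R) / K.*2.+1%:R)))^-1 <= (c * m.+1%:R)^-1].
Proof.
have [c [K0 [c0 H]]] := e_shift_lower; exists (c * kap), K0; split; first exact: mulr_gt0.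
move=> K m hK mK.
have R (v : C) : complex.Im v = complex.Im w -> `|complex.Re v| <= `|complex.Re w| + K%:R ->
    kap * m.+1%:R <= nm v -> 1 - e (v / K.*2.+1%:R) != 0 /\
    nm (K.*2.+1%:R * (1 - e (v / K.*2.+1%:R)))^-1 <= (c * kap * m.+1%:R)^-1.
  move=> Iv Rv hv; have h := H K v hK Iv Rv.
  have np : 0 < K.*2.+1%:R :> RR by rewrite ltr0n.
  have p : 0 < kap * m.+1%:R by rewrite mulr_gt0 // ltr0n.
  have p2 : 0 < nm (1 - e (v / K.*2.+1%:R)).
    by apply: lt_le_trans h; rewrite mulr_gt0 // divr_gt0 //; apply: lt_le_trans hv.
  split; first by rewrite -nm_gt0.
  have q : c * kap * m.+1%:R <= K.*2.+1%:R * nm (1 - e (v / K.*2.+1%:R)).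
    apply: (@le_trans _ _ (c * nm v)); first by rewrite -mulrA ler_wpM2l // ltW.
    by rewrite mulrA ler_pdivrMr // mulrC [leRHS]mulrC in h; rewrite mulrC.
  have m0 : 0 < m.+1%:R :> RR by rewrite ltr0n.
  by rewrite nmV nmM nm_nat lef_pV2 // posrE ?mulr_gt0.
have mk : m.+1%:R <= K%:R :> RR by rewrite ler_nat.
have [k1 k2] := hk m; have [i1 i2] := Im_wk m.
have [] := R _ i1 _ k1.
  by rewrite ReD Re_nat; apply: le_trans (ler_normD _ _) _; rewrite normr_nat lerD2l.
have [] := R _ i2 _ k2; last by [].
by rewrite ReD ReN Re_nat; apply: le_trans (ler_normD _ _) _; rewrite normrN normr_nat lerD2l.
Qed.

Lemma natN_neq0 K : (K.*2.+1%:R : C) != 0.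
Proof. by rewrite pnatr_eq0. Qed.

Lemma e_divN_X K : e (w / K.*2.+1%:R) ^+ K.*2.+1 = e w.
Proof. by rewrite -e_mulrn -[_ / _ *+ _]mulr_natr divfK // natN_neq0. Qed.

(* Both expansions are the limit of a finite partial fraction over the [N]-th roots of unity. *)
Lemma cot_series : hs (fun m => (w + m.+1%:R)^-1 + (w - m.+1%:R)^-1)
  (- (tpi / 2) * cayley (e w) - w^-1).
Proof.
have [c [K0 [c0 H]]] := inv_bounds.
have [D hD] := lim_bounded (lim_e1 (w + w)).
have D0 : 0 <= D by apply: le_trans (nm_ge0 _) (hD 0%N).
pose a K m := if (m < K)%N then
  cayley (e ((w + m.+1%:R) / K.*2.+1%:R)) / K.*2.+1%:R +
  cayley (e ((w - m.+1%:R) / K.*2.+1%:R)) / K.*2.+1%:R else 0.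
pose S K := cayley (e w) - cayley (e (w / K.*2.+1%:R)) / K.*2.+1%:R.
pose l m := - (2 / (tpi * (w + m.+1%:R))) + - (2 / (tpi * (w - m.+1%:R))).
pose M m := (2 * D * c ^- 2) * (m.+1%:R ^+ 2)^-1.
have sM : sumb M by apply: sumbZ sumb_inv2; rewrite !mulr_ge0 // invr_ge0 exprn_ge0 // ltW.
have aM K m : (K0 <= K)%N -> nm (a K m) <= M m.
  move=> hK; rewrite /a; case: ifP => mK; last by rewrite nm0; case: sM.
  have [z1 z2 b1 b2] := H K m hK mK.
  have := hD K.
  have -> : e ((w + w) / K.*2.+1%:R) = e ((w + m.+1%:R) / K.*2.+1%:R) * e ((w - m.+1%:R) / K.*2.+1%:R).
    have E : w + m.+1%:R + (w - m.+1%:R) = w + w by rewrite addrACA subrr addr0.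
    by rewrite -eD -mulrDl E.
  have := natN_neq0 K; move: (K.*2.+1%:R) (e _) (e _) z1 z2 b1 b2 => N v u z1 z2 b1 b2 N0 hh.
  (* A single term is only O(1/m). In the pair the numerators combine to 1 - u v with u v = e(2w/N),
     and N (u v - 1) is bounded, so the pair is O(1/m^2). *)
  rewrite (_ : _ + _ = - 2 * (N * (u * v - 1)) * ((N * (1 - u))^-1 * (N * (1 - v))^-1)); last first.
    by rewrite /cayley; field; rewrite ?N0 ?z1 ?z2.
  rewrite [nm _]nmM [nm (- 2 * _)]nmM [nm (_^-1 * _)]nmM nmN nm_nat /M -!mulrA.
  apply: ler_wpM2l => //; apply: ler_pM; rewrite ?mulr_ge0 ?nm_ge0 //.
  apply: (le_trans (ler_pM (nm_ge0 _) (nm_ge0 _) b1 b2)).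
  by rewrite -invfM -expr2 exprMn invfM.
have al m : lim_to (a^~ m) (l m).
  have [z1 z2] := wk_neq0 m.
  apply: (@lim_ext_near _ _ _ m.+1 _ (limD (lim_cayley z1) (lim_cayley z2))) => K hK.
  by rewrite /a hK.
have hS K : (K0 <= K)%N -> hs (a K) (S K).
  move=> hK; have h : S K = \sum_(m < K) a K m.
    have pN1 : e (w / K.*2.+1%:R) ^+ K.*2.+1 != 1 by rewrite e_divN_X.
    have := sum_cayley (ltn0Sn _) pN1; rewrite (sum_symm cayley) e_divN_X => hh.
    rewrite /S (_ : cayley (e w) = (K.*2.+1%:R * cayley (e w)) / K.*2.+1%:R); last first.
      by rewrite mulrC mulKf // natN_neq0.
    rewrite -hh -mulrBl addrAC subrr add0r mulr_suml; apply: eq_bigr => m _.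
    by rewrite /a ltn_ord mulrDl.
  rewrite h; apply: hs_finite => n hn; by rewrite /a ltnNge hn.
have lM m : nm (l m) <= M m.
  by apply: (lim_nm_le (lim_shift K0 (al m))) => n; apply: aM; rewrite leq_addl.
have [L hL] := hs_exists lM sM.
have SL := tannery sM (fun N k h => aM N k h) al hS hL.
have LE := lim_uniq SL (limB (lim_cst (cayley (e w))) (lim_cayley w0)).
have t0 := tpi_neq0.
have -> : - (tpi / 2) * cayley (e w) - w^-1 = - (tpi / 2) * L.
  rewrite LE; field; by rewrite w0 t0.
apply: hs_ext (hsZ (- (tpi / 2)) hL) => m; have [z1 z2] := wk_neq0 m.
rewrite /l; move: (w + m.+1%:R) (w - m.+1%:R) z1 z2 => x y z1 z2.
by field; rewrite z1 z2 t0.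
Qed.

(** Lipschitz's formula in weight 2. The terms are O(1/m^2) one by one, because |e((w + m)/N)| <= 1
    when Im w >= 0. *)
Lemma lip_series : hs (fun m => (w + m.+1%:R)^- 2 + (w - m.+1%:R)^- 2)
  (tpi ^+ 2 * koebe (e w) - w ^- 2).
Proof.
have [c [K0 [c0 H]]] := inv_bounds.
pose a K m := if (m < K)%N then
  koebe (e ((w + m.+1%:R) / K.*2.+1%:R)) / K.*2.+1%:R ^+ 2 +
  koebe (e ((w - m.+1%:R) / K.*2.+1%:R)) / K.*2.+1%:R ^+ 2 else 0.
pose S K := koebe (e w) - koebe (e (w / K.*2.+1%:R)) / K.*2.+1%:R ^+ 2.
pose l m := (tpi * (w + m.+1%:R)) ^- 2 + (tpi * (w - m.+1%:R)) ^- 2.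
pose M m := 2 * c ^- 2 * (m.+1%:R ^+ 2)^-1.
have sM : sumb M by apply: sumbZ sumb_inv2; rewrite mulr_ge0 // invr_ge0 exprn_ge0 // ltW.
have aM K m : (K0 <= K)%N -> nm (a K m) <= M m.
  move=> hK; rewrite /a; case: ifP => mK; last by rewrite nm0; case: sM.
  have [z1 z2 b1 b2] := H K m hK mK; have [i1 i2] := Im_wk m.
  have B (x : C) : nm x <= 1 -> nm (K.*2.+1%:R * (1 - x))^-1 <= (c * m.+1%:R)^-1 -> 1 - x != 0 ->
      nm (koebe x / K.*2.+1%:R ^+ 2) <= c ^- 2 * (m.+1%:R ^+ 2)^-1.
    move=> x1 b x0; have N0 := natN_neq0 K.
    rewrite (_ : koebe x / _ = x * (K.*2.+1%:R * (1 - x))^-1 ^+ 2); last first.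
      by rewrite /koebe; move: (K.*2.+1%:R) N0 => N N0; field; rewrite ?x0 ?N0.
    rewrite nmM -[leRHS]mul1r nmX; apply: ler_pM; rewrite ?nm_ge0 ?exprn_ge0 ?nm_ge0 //.
    have -> : c ^- 2 * (m.+1%:R ^+ 2)^-1 = (c * m.+1%:R)^-1 ^+ 2.
      by rewrite [in RHS]invfM exprMn !exprVn.
    by apply: lerXn2r b; rewrite nnegrE ?nm_ge0 // invr_ge0 mulr_ge0 // ltW.
  apply: (le_trans (nmD _ _)); rewrite /M -mulrA mulr_natl mulr2n.
  by apply: lerD; apply: B => //; exact: nm_e_divN.
have al m : lim_to (a^~ m) (l m).
  have [z1 z2] := wk_neq0 m.
  apply: (@lim_ext_near _ _ _ m.+1 _ (limD (lim_koebe z1) (lim_koebe z2))) => K hK.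
  by rewrite /a hK.
have hS K : (K0 <= K)%N -> hs (a K) (S K).
  move=> hK; have h : S K = \sum_(m < K) a K m.
    have pN1 : e (w / K.*2.+1%:R) ^+ K.*2.+1 != 1 by rewrite e_divN_X.
    have := sum_koebe (ltn0Sn _) pN1; rewrite (sum_symm koebe) e_divN_X => hh.
    rewrite /S (_ : koebe (e w) = (K.*2.+1%:R ^+ 2 * koebe (e w)) / K.*2.+1%:R ^+ 2); last first.
      by rewrite mulrC mulKf // expf_neq0 // natN_neq0.
    rewrite -hh -mulrBl addrAC subrr add0r mulr_suml; apply: eq_bigr => m _.
    by rewrite /a ltn_ord mulrDl.
  rewrite h; apply: hs_finite => n hn; by rewrite /a ltnNge hn.
have lM m : nm (l m) <= M m.
  by apply: (lim_nm_le (lim_shift K0 (al m))) => n; apply: aM; rewrite leq_addl.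
have [L hL] := hs_exists lM sM.
have SL := tannery sM (fun N k h => aM N k h) al hS hL.
have LE := lim_uniq SL (limB (lim_cst (koebe (e w))) (lim_koebe w0)).
have t0 := tpi_neq0.
have -> : tpi ^+ 2 * koebe (e w) - w ^- 2 = tpi ^+ 2 * L.
  rewrite LE; field; by rewrite w0 t0.
apply: hs_ext (hsZ (tpi ^+ 2) hL) => m; have [z1 z2] := wk_neq0 m.
rewrite /l; move: (w + m.+1%:R) (w - m.+1%:R) z1 z2 => x y z1 z2.
by field; rewrite z1 z2 t0.
Qed.

End PartialFractions.

(** * The quasi-modularity of E2 *)

(* The divisor sum, with divisors enumerated as [n / d]. *)
Definition sg (n : nat) : nat := (\sum_(m < n | (m.+1 %| n)%N) n %/ m.+1)%N.

Definition sgC (n : nat) : C := (sg n)%:R.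

Lemma sg_le n : (sg n <= n * n)%N.
Proof.
rewrite /sg; apply: (@leq_trans (\sum_(m < n) n)%N); last by rewrite sum_nat_const card_ord.
rewrite big_mkcond; apply: leq_sum => i _; case: ifP => // _; exact: leq_div.
Qed.

Lemma tame_n : tame (fun n => n%:R).
Proof. by apply: (tame_natI tame_cst1) => n; rewrite nm1 mulr1 nm_nat. Qed.

Lemma tame_n2 : tame (fun n => n%:R * n%:R).
Proof. exact: tame_nat tame_n. Qed.

Lemma tame_sg : tame sgC.
Proof. by apply: (tame_le tame_n2) => n; rewrite /sgC -natrM !nm_nat ler_nat sg_le. Qed.

Definition Gq (q : C) : C := pev sgC q.

Lemma sub1_neq0 q : nm q < 1 -> 1 - q != 0.
Proof. by move=> q1; rewrite subr_eq0; apply: contraTneq q1 => <-; rewrite nm1 ltxx. Qed.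

Lemma pev_1 q : nm q < 1 -> pev (fun=> 1) q = (1 - q)^-1.
Proof.
move=> q1; apply: (mulIf (sub1_neq0 q1)); rewrite mulVf ?sub1_neq0 //.
have h := pev_shift tame_cst1 q1; rewrite mulrBr mulr1.
by rewrite {1}h mulrC addrK.
Qed.

Lemma pev_nat q : nm q < 1 -> pev (fun n => n%:R) q = koebe q.
Proof.
move=> q1; have E n : conv (fun=> 1) (fun=> 1) n = n.+1%:R.
  by rewrite /conv; under eq_bigr do rewrite mul1r; rewrite sumr_const card_ord.
rewrite (pev_shift tame_n q1) add0r /koebe expr2 invfM -(pev_1 q1); congr (_ * _).
rewrite -pevM //; try exact: tame_cst1.
by congr pev; apply/funext => n; rewrite E.
Qed.

Lemma sum_dvd_le N n : (\sum_(m < N | (m.+1 %| n)%N) n %/ m.+1 <= n * n)%N.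
Proof.
case: n => [|n]; first by rewrite big1 // => i _; rewrite div0n.
rewrite -(big_mkord (fun m => (m.+1 %| n.+1)%N) (fun m => n.+1 %/ m.+1)%N).
apply: leq_trans (sg_le n.+1); rewrite /sg.
rewrite -(big_mkord (fun m => (m.+1 %| n.+1)%N) (fun m => n.+1 %/ m.+1)%N).
have [h|h] := leqP N n.+1.
  by rewrite (@big_cat_nat _ _ _ N 0 n.+1) //= leq_addr.
rewrite (@big_cat_nat _ _ _ n.+1 0 N) ?(ltnW h) //= [X in (_ + X)%N]big1_seq ?addn0 //.
move=> i /andP[d]; rewrite mem_index_iota => /andP[a b].
by have := dvdn_leq (ltn0Sn _) d; rewrite leqNgt ltnS a.
Qed.

Lemma sum_dvd_eq N n : (n <= N)%N -> (\sum_(m < N | (m.+1 %| n)%N) n %/ m.+1)%N = sg n.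
Proof.
move=> h; case: n h => [|n] h.
  by rewrite /sg big_ord0 big1 // => i _; rewrite div0n.
rewrite /sg -!(big_mkord (fun m => (m.+1 %| n.+1)%N) (fun m => n.+1 %/ m.+1)%N).
rewrite (@big_cat_nat _ _ _ n.+1 0 N) //= [X in (_ + X)%N]big1_seq ?addn0 //.
move=> i /andP[d]; rewrite mem_index_iota => /andP[a b].
by have := dvdn_leq (ltn0Sn _) d; rewrite leqNgt ltnS a.
Qed.

(** koebe(q^m) is the sum of k q^(m k). Collecting q^n over finitely many m leaves a truncated
    divisor sum, at most n^2, which provides the majorant. *)
Lemma lambert q : nm q < 1 -> hs (fun m => koebe (q ^+ m.+1)) (Gq q).
Proof.
move=> q1.
pose a N n : C := (\sum_(m < N | (m.+1 %| n)%N) n %/ m.+1)%N%:R * q ^+ n.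
apply: (@tannery a (fun n => sgC n * q ^+ n) _ _ (fun n => nm (n%:R * n%:R * q ^+ n)) 0).
- exact: tame_sumbq tame_n2 q1.
- move=> N n _; rewrite /a !nmM ler_wpM2r ?nm_ge0 //.
  by rewrite -!nmM -natrM !nm_nat ler_nat sum_dvd_le.
- move=> n; apply: (@lim_ext_near (fun=> sgC n * q ^+ n) _ _ n _ (lim_cst _)) => N hN.
  by rewrite /a sum_dvd_eq.
- move=> N _; have H k : hs (dil k.+1 (fun n => n%:R * (q ^+ k.+1) ^+ n)) (koebe (q ^+ k.+1)).
    rewrite -pev_nat ?nmX_lt1 //; apply: hs_dil => //; apply: pevP tame_n _.
    exact: nmX_lt1.
  apply: hs_ext (hs_sum N H) => n.
  rewrite /a natr_sum mulr_suml [RHS]big_mkcond; apply: eq_bigr => m _.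
  rewrite /dil; case: ifP => // h.
  by rewrite -exprM mulnC divnK.
exact: pevP tame_sg q1.
Qed.

Lemma e_half : e 2^-1 = -1.
Proof.
have E : (2^-1 : C) = (2^-1 : RR)%:C by rewrite fmorphV rmorph_nat.
have p : 2 * pi * 2^-1 = pi :> RR by rewrite mulrAC divff ?mul1r // pnatr_eq0.
by rewrite E; apply: cplxP; rewrite eE /= !mulr0 oppr0 expR0 mul1r p ?cospi ?sinpi ?oppr0.
Qed.

Lemma natC_neq0 n : (n.+1%:R : C) != 0.
Proof. by rewrite pnatr_eq0. Qed.

(** [tpi] squared is -4 pi^2, so the value is zeta(2) = pi^2/6. At w = 1/2 [lip_series] sums the
    inverse squares of the odd numbers, which are 3/4 of the whole. *)
Lemma zeta2_series : hs (fun m => m.+1%:R ^- 2) (- (tpi ^+ 2 / 24)).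
Proof.
have hb n : nm (n.+1%:R ^- 2 : C) <= (n.+1%:R ^+ 2)^-1 by rewrite nmV nmX nm_nat.
have [Z hZ] := hs_exists hb sumb_inv2.
have hodd n : nm (n.*2.+1%:R ^- 2 : C) <= (n.+1%:R ^+ 2)^-1.
  rewrite nmV nmX nm_nat lef_pV2 ?posrE ?exprn_gt0 ?ltr0n //.
  by apply: lerXn2r; rewrite ?nnegrE // ler_nat ltnS -addnn leq_addr.
have [Od hO] := hs_exists hodd sumb_inv2.
have ZO : Z = Od + Z / 4.
  have h1 := limD hO (limZ 4^-1 hZ); rewrite (mulrC 4^-1) in h1.
  have h2 : lim_to (fun N => \sum_(k < N.*2) (k.+1%:R ^- 2 : C)) Z.
    by apply: (lim_comp (f := fun N => N.*2) _ hZ) => n; rewrite -addnn leq_addr.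
  apply: lim_uniq h2 _; apply: lim_ext h1 => N.
  elim: N => [|N IH]; first by rewrite !big_ord0 mulr0 addr0.
  rewrite doubleS !big_ord_recr /= -IH.
  have -> : (N.*2.+2%:R : C) = 2 * N.+1%:R by rewrite -doubleS -mul2n natrM.
  move: (natC_neq0 N) (natC_neq0 N.*2); move: (N.+1%:R) (N.*2.+1%:R) => x y x0 y0.
  by field; rewrite x0 y0.
have w0 : (2^-1 : C) != 0 by rewrite invr_eq0 pnatr_eq0.
have ew : e 2^-1 != 1.
  rewrite e_half eq_sym -subr_eq0 opprK -mulr2n pnatr_eq0 //.
have iw : 0 <= complex.Im (2^-1 : C).
  have -> : (2^-1 : C) = (2^-1 : RR)%:C by rewrite fmorphV rmorph_nat.
  by [].
have k0 : 0 < 2^-1 :> RR by rewrite invr_gt0 ltr0n.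
have hk k : 2^-1 * k.+1%:R <= nm (2^-1 + k.+1%:R) /\ 2^-1 * k.+1%:R <= nm (2^-1 - k.+1%:R).
  have E : (2^-1 : C) = (2^-1 : RR)%:C by rewrite fmorphV rmorph_nat.
  have E' : (k.+1%:R : C) = (k.+1%:R : RR)%:C by rewrite rmorph_nat.
  have k1 : 1 <= k.+1%:R :> RR by rewrite ler1n.
  rewrite E E' -rmorphD -rmorphB !nm_real; split.
    by apply: le_trans (ler_norm _); lra.
  by rewrite -normrN; apply: le_trans (ler_norm _); lra.
have H := lip_series w0 ew iw k0 hk.
have H' := hsZ 4 (hsD (hs_shift hO) hO).
have := hs_uniq H (hs_ext _ H').
have E n : 4 * (n.+1.*2.+1%:R ^- 2 + n.*2.+1%:R ^- 2) =
    (2^-1 + n.+1%:R) ^- 2 + (2^-1 - n.+1%:R) ^- 2 :> C.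
  have D m : (m.*2.+1%:R : C) = 2 * m%:R + 1 by rewrite -addn1 natrD -mul2n natrM.
  have -> : (2^-1 : C) + n.+1%:R = n.+1.*2.+1%:R / 2 by rewrite D; field.
  have -> : (2^-1 : C) - n.+1%:R = - (n.*2.+1%:R / 2).
    by rewrite D -[n.+1]addn1 natrD; field.
  move: (natC_neq0 n.*2) (natC_neq0 n.+1.*2); move: (n.*2.+1%:R) (n.+1.*2.+1%:R) => x y x0 y0.
  by field; rewrite x0 y0.
move/(_ E); rewrite e_half /koebe opprK => h.
have t4 : tpi ^+ 2 / 4 = - 8 * Od.
  have two0 : (1 + 1 : C) ^+ 2 != 0 by rewrite expf_neq0 // -mulr2n pnatr_eq0.
  have : tpi ^+ 2 * (-1 / (1 + 1) ^+ 2) - 2^-1 ^- 2 = 4 * (Od - 1 + Od).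
    by rewrite h double0 expr1n invr1.
  move=> h2; have -> : tpi ^+ 2 / 4 = - (tpi ^+ 2 * (-1 / (1 + 1) ^+ 2) - 2^-1 ^- 2) - 4 by field.
  rewrite h2; ring.
have -> : - (tpi ^+ 2 / 24) = Z; last exact: hZ.
have Z34 : Z = 4 / 3 * Od by rewrite [in RHS](_ : Od = Z - Z / 4); [field|rewrite {1}ZO; ring].
rewrite Z34; have -> : tpi ^+ 2 / 24 = (tpi ^+ 2 / 4) / 6 by field.
by rewrite t4; field.
Qed.

Section Eisenstein2.
Variable z : C.
Hypothesis Iz : 0 < complex.Im z.

Let y := complex.Im z.

Lemma z_neq0 : z != 0. Proof. exact: Im_gt0_neq0. Qed.

Lemma nmz_gt0 : 0 < nm z. Proof. by rewrite nm_gt0 z_neq0. Qed.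

Lemma lattice_lower_Im (a : nat) (x : RR) : a%:R * y <= nm (a%:R * z + x%:C).
Proof.
apply: le_trans (nm_Im _); rewrite ImD ImM Im_nat Re_nat mul0r addr0 /= addr0.
exact: ler_norm.
Qed.

(** After division by z, the imaginary part of a + x/z is that of x/z. *)
Lemma lattice_lower_Re (a : nat) (x : RR) : `|x| * (y / nm z) <= nm (a%:R * z + x%:C).
Proof.
have z0 := z_neq0; have zp := nmz_gt0.
have -> : a%:R * z + x%:C = z * (a%:R + x%:C / z) by field.
rewrite nmM -ler_pdivrMl //; apply: le_trans (nm_Im _).
rewrite ImD Im_nat add0r ImM ImV /= mul0r addr0 normrM mulrCA; apply: ler_wpM2l => //.
rewrite normrM normrN normfV (gtr0_norm Iz) (ger0_norm (sqr_ge0 _)) -/y.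
by rewrite mulrCA -invfM expr2.
Qed.

Lemma Im_Ninv (x : RR) : 0 < x -> 0 < complex.Im (- (x%:C / z)).
Proof.
move=> x0; rewrite ImN ImM ImV /= mul0r addr0 mulNr mulrN opprK mulr_gt0 // divr_gt0 //.
by rewrite exprn_gt0 // nmz_gt0.
Qed.

End Eisenstein2.

Section UpperHalfPlaneSeries.
Variable w : C.
Hypothesis Iw : 0 < complex.Im w.

Let hk k : complex.Im w / nm w * k.+1%:R <= nm (w + k.+1%:R) /\
  complex.Im w / nm w * k.+1%:R <= nm (w - k.+1%:R).
Proof.
have h1 := lattice_lower_Re Iw 1 (k.+1%:R); have h2 := lattice_lower_Re Iw 1 (- k.+1%:R).
rewrite normrN in h2; rewrite normr_nat mulrC !mul1r in h1 h2.
by rewrite rmorphN rmorph_nat in h2; rewrite rmorph_nat in h1; split.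
Qed.

Let ew1 : e w != 1.
Proof. by apply: contraTneq (nm_e_lt1 Iw) => ->; rewrite nm1 ltxx. Qed.

Let kp : 0 < complex.Im w / nm w.
Proof. by rewrite divr_gt0 // nmz_gt0. Qed.

Lemma cot_series_H : hs (fun m => (w + m.+1%:R)^-1 + (w - m.+1%:R)^-1)
  (- (tpi / 2) * cayley (e w) - w^-1).
Proof. exact: cot_series (z_neq0 Iw) ew1 (ltW Iw) kp hk. Qed.

Lemma lip_series_H : hs (fun m => (w + m.+1%:R)^- 2 + (w - m.+1%:R)^- 2)
  (tpi ^+ 2 * koebe (e w) - w ^- 2).
Proof. exact: lip_series (z_neq0 Iw) ew1 (ltW Iw) kp hk. Qed.

End UpperHalfPlaneSeries.

Section SOfEisenstein2.
Variable z : C.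
Hypothesis Iz : 0 < complex.Im z.

Let y := complex.Im z.

Let hh : C := 2^-1.
(** Eisenstein's double sum of (a z + n)^-2 converges only conditionally, and its two orders of
    summation differ. Subtracting 1/((v - 1/2)(v + 1/2)), which telescopes in n, leaves terms of
    order |v|^-4. The rows [beta] are then dominated by a multiple of a^-2 uniformly in N, and the
    two orders can be compared. *)
Let g (v : C) := v ^- 2 - ((v - hh) * (v + hh))^-1.
Let beta N (w : C) := g w + \sum_(n < N) (g (w + n.+1%:R) + g (w - n.+1%:R)).

Let gE (v h : C) : v != 0 -> v - h != 0 -> v + h != 0 ->
  v ^- 2 - ((v - h) * (v + h))^-1 = - (h ^+ 2 * (v ^- 2 * ((v - h) * (v + h))^-1)).
Proof. by move=> v0 v1 v2; field; rewrite v0 v1 v2. Qed.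

Let hhR : hh = (2^-1 : RR)%:C.
Proof. by rewrite /hh fmorphV rmorph_nat. Qed.

Let az_neq0 a (x : RR) : a.+1%:R * z + x%:C != 0.
Proof.
rewrite -nm_gt0; apply: lt_le_trans (lattice_lower_Im z a.+1 x).
by rewrite mulr_gt0 // ltr0n.
Qed.

Let g_le a (x : RR) : nm (g (a.+1%:R * z + x%:C)) <=
  nm (a.+1%:R * z + x%:C) ^- 2 * (y ^- 2 * (a.+1%:R ^+ 2)^-1).
Proof.
have v1 : a.+1%:R * z + x%:C - hh = a.+1%:R * z + (x - 2^-1)%:C by rewrite hhR rmorphB addrA.
have v2 : a.+1%:R * z + x%:C + hh = a.+1%:R * z + (x + 2^-1)%:C by rewrite hhR rmorphD addrA.
have h0 := az_neq0 a x; have h1 := az_neq0 a (x - 2^-1); have h2 := az_neq0 a (x + 2^-1).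
have b1 := lattice_lower_Im z a.+1 (x - 2^-1); have b2 := lattice_lower_Im z a.+1 (x + 2^-1).
rewrite /g gE ?v1 ?v2 // nmN nmM -[leRHS]mul1r.
apply: ler_pM; rewrite ?nm_ge0 //.
  rewrite nmX hhR nm_real ger0_norm ?invr_ge0 // expr_le1 // ?invr_ge0 //.
  by rewrite invf_le1 // ler1n.
rewrite nmM nmV nmX; apply: ler_pM; rewrite ?nm_ge0 ?invr_ge0 ?exprn_ge0 ?nm_ge0 //.
rewrite nmV nmM -invfM -exprMn lef_pV2 ?posrE ?mulr_gt0 ?exprn_gt0 ?nm_gt0 ?mulr_gt0 ?ltr0n //.
by rewrite mulrC expr2; apply: ler_pM; rewrite ?mulr_ge0 ?(ltW Iz).
Qed.

Let az (a n : nat) : (a.+1%:R * z + n.+1%:R = a.+1%:R * z + (n.+1%:R)%:C) /\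
  (a.+1%:R * z - n.+1%:R = a.+1%:R * z + (- n.+1%:R)%:C).
Proof. by split; rewrite ?rmorphN rmorph_nat. Qed.

Let beta_le : exists2 B : RR, 0 <= B & forall N a,
  nm (beta N (a.+1%:R * z)) <= B * (a.+1%:R ^+ 2)^-1.
Proof.
have [S0 [S hS]] := sumb_inv2.
have zp := nmz_gt0 Iz.
pose B := y ^- 2 * (y ^- 2 + 2 * (y / nm z) ^- 2 * S).
have S00 : 0 <= S by apply: le_trans (hS 0%N); rewrite big_ord0.
have y2 : 0 <= y ^- 2 by rewrite invr_ge0 sqr_ge0.
have yz : 0 < y / nm z by rewrite divr_gt0.
exists B; first by rewrite !(mulr_ge0, addr_ge0) // invr_ge0 sqr_ge0.
move=> N a; apply: le_trans (nmD _ _) _.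
have a1 : 1 <= a.+1%:R :> RR by rewrite ler1n.
pose A := y ^- 2 * (a.+1%:R ^+ 2)^-1.
have A0 : 0 <= A by rewrite mulr_ge0 // invr_ge0 sqr_ge0.
have -> : B * (a.+1%:R ^+ 2)^-1 = y ^- 2 * A + (2 * (y / nm z) ^- 2 * S) * A.
  by rewrite /B /A; ring.
apply: lerD.
  have := g_le a 0; rewrite addr0 => /le_trans; apply; apply: ler_wpM2r => //.
  have h := lattice_lower_Im z a.+1 0; rewrite addr0 in h.
  have h' : y <= nm (a.+1%:R * z) by apply: le_trans h; rewrite ler_peMl // ltW.
  rewrite lef_pV2 ?posrE ?exprn_gt0 //; last by apply: lt_le_trans h'.
  by apply: lerXn2r h'; rewrite nnegrE ?nm_ge0 // ltW.
apply: le_trans (nm_sum _ _ _) _.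
have term (n : nat) (x : RR) : `|x| = n.+1%:R -> nm (g (a.+1%:R * z + x%:C)) <=
    (y / nm z) ^- 2 * (n.+1%:R ^+ 2)^-1 * A.
  move=> xn; apply: (le_trans (g_le a x)); apply: ler_wpM2r => //.
  have h := lattice_lower_Re Iz a.+1 x; rewrite xn in h.
  have p : 0 < n.+1%:R * (y / nm z) by rewrite mulr_gt0 // ltr0n.
  rewrite -invfM -exprMn lef_pV2 ?posrE ?exprn_gt0 //; last 2 first.
  - exact: lt_le_trans h.
  - by rewrite mulrC.
  by rewrite mulrC; apply: lerXn2r h; rewrite nnegrE ?nm_ge0 // ltW.
apply: (@le_trans _ _ (\sum_(n < N) (2 * (y / nm z) ^- 2 * (n.+1%:R ^+ 2)^-1 * A))).
  apply: ler_sum => n _; have [e1 e2] := az a n; rewrite e1 e2.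
  apply: (le_trans (nmD _ _)).
  have -> : 2 * (y / nm z) ^- 2 * (n.+1%:R ^+ 2)^-1 * A =
    (y / nm z) ^- 2 * (n.+1%:R ^+ 2)^-1 * A + (y / nm z) ^- 2 * (n.+1%:R ^+ 2)^-1 * A by ring.
  by apply: lerD; apply: term; rewrite ?normrN normr_nat.
rewrite -mulr_suml; apply: ler_wpM2r => //.
rewrite -mulr_sumr; apply: ler_wpM2l (hS N).
by rewrite mulr_ge0 // invr_ge0 sqr_ge0.
Qed.

Let hN (N : nat) : C := N%:R + hh.

(** 1/((v - 1/2)(v + 1/2)) = 1/(v - 1/2) - 1/(v + 1/2), so over v = w - N, ..., w + N only the two
    ends, at distance N + 1/2 from w, survive. *)
Let beta_tele N a : let w := a.+1%:R * z in
  beta N w = w ^- 2 + \sum_(n < N) ((w + n.+1%:R) ^- 2 + (w - n.+1%:R) ^- 2)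
    - ((w - hN N)^-1 - (w + hN N)^-1).
Proof.
move=> w.
have dbl : hh + hh = 1 by rewrite /hh; field.
have sp (v h : C) : h + h = 1 -> v - h != 0 -> v + h != 0 ->
    ((v - h) * (v + h))^-1 = (v - h)^-1 - (v + h)^-1.
  move=> h2 v1 v2; apply: (mulfI (mulf_neq0 v1 v2)); rewrite divff ?mulf_neq0 //.
  rewrite mulrBr mulrAC divff // mul1r mulfK // -h2; ring.
have nz (x : RR) : w + x%:C != 0 by exact: az_neq0.
have nzm (k : nat) : w + k%:R - hh != 0 /\ w + k%:R + hh != 0.
  rewrite -addrA -[w + k%:R + hh]addrA; split.
    by rewrite hhR -(rmorph_nat (real_complex RR)) -rmorphB; exact: nz.
  by rewrite hhR -(rmorph_nat (real_complex RR)) -rmorphD; exact: nz.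
have nzp (k : nat) : w - k%:R - hh != 0 /\ w - k%:R + hh != 0.
  rewrite -addrA -[w - k%:R + hh]addrA; split.
    by rewrite hhR -(rmorph_nat (real_complex RR)) -rmorphN -rmorphB; exact: nz.
  by rewrite hhR -(rmorph_nat (real_complex RR)) -rmorphN -rmorphD; exact: nz.
elim: N => [|N IH].
  rewrite /beta !big_ord0 !addr0 /hN add0r /g sp //.
    by have [] := nzm 0%N; rewrite addr0.
  by have [] := nzm 0%N; rewrite addr0.
rewrite /beta big_ord_recr /= addrA -/(beta N w) IH [in RHS]big_ord_recr /= /g.
have [p1 p2] := nzm N.+1; have [m1 m2] := nzp N.+1.
rewrite !sp //.
have -> : w + N.+1%:R - hh = w + hN N.
  by rewrite /hN -natr1 -addrA -[1]dbl; ring.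
have -> : w - N.+1%:R + hh = w - hN N.
  by rewrite /hN -natr1 -[1]dbl; ring.
have -> : w + N.+1%:R + hh = w + hN N.+1 by rewrite /hN addrA.
have -> : w - N.+1%:R - hh = w - hN N.+1 by rewrite /hN opprD addrA.
move: (\sum_(i < N) _) => S; ring.
Qed.

Let realN (x : RR) : (- x)%:C = - x%:C :> C.
Proof. exact: rmorphN. Qed.

Let hNR N : hN N = (N%:R + 2^-1)%:C.
Proof. by rewrite /hN hhR rmorphD rmorph_nat. Qed.

Let lim_hN (v : nat -> C) (c : RR) : 0 < c -> (forall N, c * (N%:R + 2^-1) <= nm (v N)) ->
  lim_to (fun N => (v N)^-1) 0.
Proof.
move=> c0 H; apply: (@lim_bound _ _ (fun N => (2 / c) / N.+1%:R) 0); last exact: lim0_inv.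
move=> N _; rewrite subr0 nmV.
have N0 : 0 <= N%:R :> RR by [].
have p : 0 < c * (N%:R + 2^-1) by rewrite mulr_gt0 // ltr_wpDl.
apply: (@le_trans _ _ (c * (N%:R + 2^-1))^-1).
  by rewrite lef_pV2 ?posrE //; exact: lt_le_trans (H N).
rewrite invfM (_ : 2 / c / N.+1%:R = c^-1 * (2 / N.+1%:R)); last by rewrite mulrAC mulrC.
apply: ler_wpM2l; first by rewrite invr_ge0 ltW.
rewrite ler_pdivlMr ?ltr0n // mulrC ler_pdivrMr ?ltr_wpDl // -[N.+1]addn1 natrD; lra.
Qed.

Let yz0 : 0 < y / nm z.
Proof. by rewrite divr_gt0 // nmz_gt0. Qed.

(** Row by row: as N grows the two ends vanish, and Lipschitz's formula at the point a z sums the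
    rest. *)
Let beta_lim a : lim_to (fun N => beta N (a.+1%:R * z)) (tpi ^+ 2 * koebe (e z ^+ a.+1)).
Proof.
have Iw : 0 < complex.Im (a.+1%:R * z).
  by rewrite ImM Re_nat Im_nat mul0r addr0 mulr_gt0 // ltr0n.
have L := lip_series_H Iw.
rewrite mulr_natl e_mulrn in L; rewrite -[z *+ _]mulr_natl in L.
have h1 : lim_to (fun N => (a.+1%:R * z - hN N)^-1) 0.
  apply: (lim_hN yz0) => N; have := lattice_lower_Re Iz a.+1 (- (N%:R + 2^-1)).
  by rewrite normrN ger0_norm ?addr_ge0 // [leLHS]mulrC realN -hNR.
have h2 : lim_to (fun N => (a.+1%:R * z + hN N)^-1) 0.
  apply: (lim_hN yz0) => N; have := lattice_lower_Re Iz a.+1 (N%:R + 2^-1).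
  by rewrite ger0_norm ?addr_ge0 // [leLHS]mulrC -hNR.
have := limB (limD (lim_cst ((a.+1%:R * z) ^- 2)) L) (limB h1 h2).
rewrite subrr subr0 addrC subrK; apply: lim_ext => N.
by rewrite beta_tele.
Qed.

Let Sz N : C := z ^- 2 * (- (tpi ^+ 2 / 24)) +
  \sum_(n < N) z ^- 2 * (tpi ^+ 2 * koebe (e (- (n.+1%:R / z))) - (- (n.+1%:R / z)) ^- 2)
  - z^-1 * (- (tpi / 2) * cayley (e (- (hN N / z))) - (- (hN N / z))^-1).

(** Column by column for fixed N: a z + n = z (a + n/z), so summing over a gives an expansion at the
    point -n/z, and the two ends form a cotangent series at -(N + 1/2)/z. *)
Let hs_Sz N : hs (fun a => beta N (a.+1%:R * z)) (Sz N).
Proof.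
have z0 := z_neq0 Iz.
have h1 := hsZ (z ^- 2) zeta2_series.
have h2 n : hs (fun a => (a.+1%:R * z + n.+1%:R) ^- 2 + (a.+1%:R * z - n.+1%:R) ^- 2)
    (z ^- 2 * (tpi ^+ 2 * koebe (e (- (n.+1%:R / z))) - (- (n.+1%:R / z)) ^- 2)).
  have n0 : 0 < n.+1%:R :> RR by rewrite ltr0n.
  have Iw := Im_Ninv Iz n0; rewrite rmorph_nat in Iw.
  apply: hs_ext (hsZ (z ^- 2) (lip_series_H Iw)) => a.
  have b1 := az_neq0 a n.+1%:R; have b2 := az_neq0 a (- n.+1%:R).
  rewrite realN in b2; rewrite rmorph_nat in b1 b2.
  move: (a.+1%:R) (n.+1%:R : C) b1 b2 => x k b1 b2.
  have -> : - (k / z) + x = (x * z - k) / z by field.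
  have -> : - (k / z) - x = - ((x * z + k) / z) by field.
  by field; rewrite z0 b1 b2.
have h3 : hs (fun a => (a.+1%:R * z - hN N)^-1 - (a.+1%:R * z + hN N)^-1)
    (z^-1 * (- (tpi / 2) * cayley (e (- (hN N / z))) - (- (hN N / z))^-1)).
  have n0 : 0 < N%:R + 2^-1 :> RR by rewrite ltr_wpDl.
  have Iw := Im_Ninv Iz n0; rewrite -hNR in Iw.
  apply: hs_ext (hsZ z^-1 (cot_series_H Iw)) => a.
  have b1 := az_neq0 a (N%:R + 2^-1); have b2 := az_neq0 a (- (N%:R + 2^-1)).
  rewrite realN in b2; rewrite -hNR in b1 b2.
  move: (a.+1%:R) (hN N) b1 b2 => x k b1 b2.
  have -> : - (k / z) + x = (x * z - k) / z by field.
  have -> : - (k / z) - x = - ((x * z + k) / z) by field.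
  by field; rewrite z0 b1 b2.
apply: hs_ext (hsB (hsD h1 (hs_sum N h2)) h3) => a.
rewrite beta_tele; congr (_ + _ - _).
by rewrite [in RHS]exprMn [in RHS]invfM mulrC.
Qed.

Let q' := e (- z^-1).

Let q'1 : nm q' < 1.
Proof. by apply: nm_e_lt1; have := Im_Ninv Iz (ltr01 : 0 < 1 :> RR); rewrite div1r. Qed.

(** As N grows, e(-(N + 1/2)/z) tends to 0 and the cotangent to a constant. The surviving term
    tpi/(2z) is the source of the defect of modularity of E2. *)
Let lim_Sz : lim_to Sz (z ^- 2 * (- (tpi ^+ 2 / 24)) + (z ^- 2 * tpi ^+ 2 * Gq q' + tpi ^+ 2 / 24)
  + z^-1 * (tpi / 2)).
Proof.
have z0 := z_neq0 Iz.
have h1 : hs (fun n => z ^- 2 * (tpi ^+ 2 * koebe (e (- (n.+1%:R / z))) -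
    (- (n.+1%:R / z)) ^- 2)) (z ^- 2 * tpi ^+ 2 * Gq q' + tpi ^+ 2 / 24).
  have := hsB (hsZ (z ^- 2 * tpi ^+ 2) (lambert q'1)) zeta2_series.
  rewrite opprK; apply: hs_ext => n.
  have -> : e (- (n.+1%:R / z)) = q' ^+ n.+1.
    by rewrite /q' -e_mulrn mulNrn -[z^-1 *+ n.+1]mulr_natl.
  move: (natC_neq0 n); move: (n.+1%:R : C) => k k0.
  move: (koebe _) => u; by field; rewrite z0 k0.
have h2 : lim_to (fun N => e (- (hN N / z))) 0.
  apply: (@lim_bound _ _ (fun N => nm (e (- (hh / z))) * nm q' ^+ N) 0).
    move=> N _; have -> : e (- (hN N / z)) = e (- (hh / z)) * q' ^+ N.
      rewrite /q' -e_mulrn -eD mulNrn -[z^-1 *+ N]mulr_natl.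
      by rewrite -opprD -mulrDl [hh + _]addrC.
    by rewrite subr0 nmM nmX.
  by apply: lim0_geom; rewrite nm_ge0.
have h3 : lim_to (fun N => cayley (e (- (hN N / z)))) 1.
  have n0 : (1 - 0 : C) != 0 by rewrite subr0 oner_eq0.
  have := limM (limD (lim_cst 1) h2) (limV n0 (limB (lim_cst 1) h2)).
  by rewrite addr0 subr0 invr1 mulr1.
have h4 : lim_to (fun N => (- (hN N / z))^-1) 0.
  have p : 0 < (nm z)^-1 by rewrite invr_gt0 nmz_gt0.
  apply: (lim_hN p) => N; rewrite nmN nm_div hNR nm_real ger0_norm ?addr_ge0 //.
  by rewrite mulrC.
have := limB (limD (lim_cst (z ^- 2 * (- (tpi ^+ 2 / 24)))) h1)
  (limZ z^-1 (limB (limZ (- (tpi / 2)) h3) h4)).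
by move=> X; rewrite [z^-1 * _](_ : _ = - (z^-1 * (- (tpi / 2) * 1 - 0))) //; ring.
Qed.

Lemma Gq_S : Gq (e (- z^-1)) = z ^+ 2 * Gq (e z) + (1 - z ^+ 2) / 24 - z / (2 * tpi).
Proof.
have z0 := z_neq0 Iz; have t0 := tpi_neq0.
have [B B0 hB] := beta_le.
have T := @tannery (fun N a => beta N (a.+1%:R * z)) _ _ _ _ 0 (sumbZ B0 sumb_inv2)
  (fun N a _ => hB N a) beta_lim (fun N _ => hs_Sz N) (hsZ (tpi ^+ 2) (lambert (nm_e_lt1 Iz))).
have := lim_uniq T lim_Sz; rewrite -/q' => h.
have -> : Gq (e z) = tpi ^- 2 * (tpi ^+ 2 * Gq (e z)) by rewrite mulKf // expf_neq0.
rewrite h; move: (Gq q') => G; field; by rewrite z0 t0.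
Qed.

End SOfEisenstein2.

Definition E2 (z : C) : C := 1 - 24 * Gq (e z).

Lemma E2_S z : 0 < complex.Im z -> E2 (- z^-1) = z ^+ 2 * E2 z + 12 * z / tpi.
Proof.
by move=> Iz; rewrite /E2 Gq_S //; have t0 := tpi_neq0; field; rewrite t0.
Qed.

(** * Integral q-expansions and the Eisenstein series E4, E6 *)

Definition toC (a : fps int) (n : nat) : C := (a n)%:~R.
Definition tm (a : fps int) := tame (toC a).
Definition ev (a : fps int) (z : C) : C := pev (toC a) (e z).

Lemma toC_M a b : toC (a * b) = conv (toC a) (toC b).
Proof.
apply/funext => n; rewrite /toC /conv fpsM rmorph_sum /=.
by apply: eq_bigr => i _; rewrite rmorphM.
Qed.

Lemma toC_D a b : toC (a + b) = fun n => toC a n + toC b n.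
Proof. by apply/funext => n; rewrite /toC fpsD rmorphD. Qed.

Lemma toC_N a : toC (- a) = fun n => -1 * toC a n.
Proof. by apply/funext => n; rewrite /toC fpsN rmorphN mulN1r. Qed.

Lemma toC_dil m a : toC (dil m a) = dil m (toC a).
Proof. by apply/funext => n; rewrite /toC /dil /dil; case: ifP. Qed.

Lemma toC_theta a : toC (theta a) = fun n => n%:R * toC a n.
Proof. by apply/funext => n; rewrite /toC /theta rmorphM rmorph_nat. Qed.

Lemma tmD a b : tm a -> tm b -> tm (a + b).
Proof. by rewrite /tm toC_D; exact: tameD. Qed.

Lemma tmN a : tm a -> tm (- a).
Proof. by rewrite /tm toC_N; exact: tameZ. Qed.

Lemma tmB a b : tm a -> tm b -> tm (a - b).
Proof. by move=> ta tb; apply: tmD ta (tmN tb). Qed.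

Lemma tmM a b : tm a -> tm b -> tm (a * b).
Proof. by rewrite /tm toC_M; exact: tame_conv. Qed.

Lemma tm1 : tm 1.
Proof.
apply: (tame_le tame_cst1) => n; rewrite /toC fps1 nm1.
by case: eqP; rewrite ?nm1 ?nm0.
Qed.

Lemma tm_nat k : tm k%:R.
Proof.
elim: k => [|k IH]; last by rewrite -natr1; exact: tmD IH tm1.
by rewrite mulr0n; apply: (tame_le tame_cst1) => n; rewrite /toC fps0 nm1 nm0.
Qed.

Lemma tmX a k : tm a -> tm (a ^+ k).
Proof. by move=> ta; elim: k => [|k IH]; [exact: tm1|rewrite exprS; exact: tmM]. Qed.

Lemma tm_theta a : tm a -> tm (theta a).
Proof. by rewrite /tm toC_theta; exact: tame_nat. Qed.

Lemma tm_dil m a : (0 < m)%N -> tm a -> tm (dil m a).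
Proof. by move=> m0; rewrite /tm toC_dil; exact: tame_dil. Qed.

Lemma tm_natM k a : (0 < k)%N -> tm (k%:R * a) -> tm a.
Proof.
move=> k0 h; apply: (tame_le h) => n; rewrite /toC fps_natM rmorphM rmorph_nat nmM nm_nat.
by rewrite ler_peMl ?nm_ge0 // ler1n.
Qed.

Section Ev.
Variable z : C.
Hypothesis Iz : 0 < complex.Im z.
Let q1 := nm_e_lt1 Iz.

Lemma evD a b : tm a -> tm b -> ev (a + b) z = ev a z + ev b z.
Proof. by move=> ta tb; rewrite /ev toC_D pevD. Qed.

Lemma evN a : tm a -> ev (- a) z = - ev a z.
Proof. by move=> ta; rewrite /ev toC_N pevZ // mulN1r. Qed.

Lemma evB a b : tm a -> tm b -> ev (a - b) z = ev a z - ev b z.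
Proof. by move=> ta tb; rewrite evD ?evN //; exact: tmN. Qed.

Lemma evM a b : tm a -> tm b -> ev (a * b) z = ev a z * ev b z.
Proof. by move=> ta tb; rewrite /ev toC_M pevM. Qed.

Lemma ev1 : ev 1 z = 1.
Proof.
apply: pev_hs => //; first exact: tm1.
have := @hs_finite (fun n => toC 1 n * e z ^+ n) 1; rewrite big_ord1 expr0 mulr1; apply.
by case=> // n _; rewrite /toC fps1 mul0r.
Qed.

Lemma ev_nat k : ev k%:R z = k%:R.
Proof.
elim: k => [|k IH]; last by rewrite -[in LHS]natr1 evD ?IH ?ev1 ?natr1 //; [exact: tm_nat|exact: tm1].
by apply/(@addrI _ (ev 0 z)); rewrite -evD ?addr0 //; exact: (tm_nat 0).
Qed.

Lemma ev_natM k a : tm a -> ev (k%:R * a) z = k%:R * ev a z.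
Proof. by move=> ta; rewrite evM ?ev_nat //; exact: tm_nat. Qed.

Lemma evX a k : tm a -> ev (a ^+ k) z = ev a z ^+ k.
Proof.
move=> ta; elim: k => [|k IH]; first by rewrite !expr0 ev1.
by rewrite !exprS evM ?IH //; exact: tmX.
Qed.

Lemma ev_dil m a : (0 < m)%N -> tm a -> ev (dil m a) z = ev a (m%:R * z).
Proof. by move=> m0 ta; rewrite /ev toC_dil pev_dil // -e_mulrn mulr_natl. Qed.

Lemma has_d_e (w : C) : has_d e w (tpi * e w).
Proof.
have [K K0 H] := e_lin; exists (nm (e w) * K), 16^-1; split; first by rewrite invr_gt0 ltr0n.
move=> h hh; rewrite eD (_ : _ - _ = e w * (e h - 1 - tpi * h)); last by ring.
by rewrite nmM -mulrA ler_wpM2l ?nm_ge0 // H.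
Qed.

Lemma ev_theta a : tm a -> ev (theta a) z = e z * pev (dser (toC a)) (e z).
Proof.
move=> ta; rewrite /ev toC_theta (pev_shift (tame_nat ta)) // mul0r add0r.
by [].
Qed.

Lemma has_d_ev a : tm a -> has_d (ev a) z (tpi * ev (theta a) z).
Proof.
move=> ta; have := has_d_comp (has_d_e z) (has_d_pev ta q1).
rewrite ev_theta //; move: (pev _ _) => X.
by rewrite (_ : tpi * (e z * X) = X * (tpi * e z)) //; ring.
Qed.

End Ev.

Lemma ev_T a z : ev a (z + 1) = ev a z.
Proof. by rewrite /ev eD e1 mulr1. Qed.

Lemma Im_Sz (z : C) : 0 < complex.Im z -> 0 < complex.Im (- z^-1).
Proof.
move=> Iz; have h : 0 < 1 :> RR by exact: ltr01.
by have := Im_Ninv Iz h; rewrite div1r.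
Qed.

Lemma H_near (z : C) : 0 < complex.Im z -> exists2 d : RR, 0 < d &
  forall h, nm h <= d -> 0 < complex.Im (z + h).
Proof.
move=> Iz; exists (complex.Im z / 2); first by rewrite divr_gt0.
move=> h hh; rewrite ImD; have := nm_Im h; rewrite ler_norml => /andP[h1 _]; lra.
Qed.

(** Differentiate both sides of a transformation law under z -> -1/z; derivatives in the sense of
    [has_d] are unique. *)
Lemma ev_theta_S a (g : C -> C) (z g' : C) : tm a -> 0 < complex.Im z ->
  (forall w, 0 < complex.Im w -> ev a (- w^-1) = g w) -> has_d g z g' ->
  tpi * ev (theta a) (- z^-1) = z ^+ 2 * g'.
Proof.
move=> ta Iz H hg; have z0 := z_neq0 Iz.
have h1 := has_d_comp (has_dN (has_d_inv z0)) (has_d_ev (Im_Sz Iz) ta).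
have h2 : has_d (fun w => ev a (- w^-1)) z g'.
  apply: has_d_ext hg; have [d d0 hd] := H_near Iz.
  by exists d => // h hh; rewrite H //; exact: hd.
rewrite -(has_d_uniq h1 h2) opprK; field; exact: z0.
Qed.

Lemma has_d_X z k : has_d (fun w => w ^+ k) z (k%:R * z ^+ k.-1).
Proof.
elim: k => [|k IH]; first by rewrite mul0r; apply: has_d_exti (has_d_cst 1 z).
have := has_dM (has_d_id z) IH; rewrite mul1r.
have -> : z ^+ k + id z * (k%:R * z ^+ k.-1) = k.+1%:R * z ^+ k.+1.-1.
  rewrite -natr1 /=; case: k {IH} => [|k] /=; first by rewrite !expr0; ring.
  by rewrite exprS; ring.
by apply: has_d_exti => w; rewrite exprS.
Qed.

Definition sgs : fps int := fun n => (sg n)%:Z.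
Definition E2s : fps int := 1 - 24 * sgs.
(** Ramanujan's differential equations serve as definitions of E4 and E6. Integrality is then
    immediate, and the laws under z -> -1/z follow from that of E2 by differentiation. *)
Definition E4s : fps int := E2s ^+ 2 - 12 * theta E2s.
Definition E6s : fps int := E2s * E4s - 3 * theta E4s.

Lemma tm_sgs : tm sgs.
Proof. by apply: (tame_le tame_sg) => n; rewrite /toC /sgs /sgC. Qed.

Lemma tm_E2s : tm E2s.
Proof. exact: tmB tm1 (tmM (tm_nat 24) tm_sgs). Qed.

Lemma tm_E4s : tm E4s.
Proof. exact: tmB (tmX 2 tm_E2s) (tmM (tm_nat 12) (tm_theta tm_E2s)). Qed.

Lemma tm_E6s : tm E6s.
Proof. exact: tmB (tmM tm_E2s tm_E4s) (tmM (tm_nat 3) (tm_theta tm_E4s)). Qed.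

Lemma ev_E2s z : 0 < complex.Im z -> ev E2s z = E2 z.
Proof.
move=> Iz; rewrite /E2s evB ?ev1 ?ev_natM //; try exact: tm_sgs; try exact: tm1.
exact: tmM (tm_nat 24) tm_sgs.
Qed.

Lemma theta_E2s_S z : 0 < complex.Im z ->
  tpi * ev (theta E2s) (- z^-1) =
  z ^+ 2 * (2 * z * E2 z + z ^+ 2 * (tpi * ev (theta E2s) z) + 12 / tpi).
Proof.
move=> Iz; apply: (ev_theta_S (g := fun w => w ^+ 2 * ev E2s w + 12 / tpi * w) tm_E2s Iz).
  move=> w Iw; rewrite (ev_E2s (Im_Sz Iw)) (E2_S Iw) (ev_E2s Iw); congr (_ + _).
  exact: mulrAC.
have h := has_dD (has_dM (has_d_X z 2) (has_d_ev Iz tm_E2s)) (has_dZ (12 / tpi) (has_d_id z)).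
by rewrite mulr1 ev_E2s // expr1 in h.
Qed.

Lemma ev_E4sE z : 0 < complex.Im z -> ev E4s z = E2 z ^+ 2 - 12 * ev (theta E2s) z.
Proof.
move=> Iz; rewrite /E4s evB ?evX ?ev_E2s ?ev_natM //; try exact: tm_E2s.
- exact: tm_theta tm_E2s.
- exact: tmX tm_E2s.
- exact: tmM (tm_nat 12) (tm_theta tm_E2s).
Qed.

Lemma E4_S z : 0 < complex.Im z -> ev E4s (- z^-1) = z ^+ 4 * ev E4s z.
Proof.
move=> Iz; rewrite !ev_E4sE ?Im_Sz // E2_S //.
have t0 := tpi_neq0; have h := theta_E2s_S Iz.
have -> : ev (theta E2s) (- z^-1) = (tpi * ev (theta E2s) (- z^-1)) / tpi by rewrite mulrC mulKf.
rewrite h; field; exact: t0.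
Qed.

Lemma ev_E6sE z : 0 < complex.Im z -> ev E6s z = E2 z * ev E4s z - 3 * ev (theta E4s) z.
Proof.
move=> Iz; rewrite /E6s evB ?evM ?ev_E2s ?ev_nat //; try exact: tm_E2s; try exact: tm_E4s.
- exact: tm_nat.
- exact: tm_theta tm_E4s.
- exact: tmM tm_E2s tm_E4s.
- exact: tmM (tm_nat 3) (tm_theta tm_E4s).
Qed.

Lemma E6_S z : 0 < complex.Im z -> ev E6s (- z^-1) = z ^+ 6 * ev E6s z.
Proof.
move=> Iz; rewrite !ev_E6sE ?Im_Sz // E2_S // E4_S //.
have t0 := tpi_neq0.
have h : tpi * ev (theta E4s) (- z^-1) =
    z ^+ 2 * (4 * z ^+ 3 * ev E4s z + z ^+ 4 * (tpi * ev (theta E4s) z)).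
  apply: (ev_theta_S (g := fun w => w ^+ 4 * ev E4s w) tm_E4s Iz) => [w Iw|].
    exact: E4_S.
  exact: has_dM (has_d_X z 4) (has_d_ev Iz tm_E4s).
have -> : ev (theta E4s) (- z^-1) = (tpi * ev (theta E4s) (- z^-1)) / tpi by rewrite mulrC mulKf.
rewrite h; field; exact: t0.
Qed.

(** * Modular forms on Gamma_0(5) *)

Lemma jfac_neq0 (a b c d : int) (z : C) : a * d - b * c = 1 -> 0 < complex.Im z ->
  jfac c d z != 0.
Proof.
move=> det Iz; apply/eqP => h.
have := congr1 (@complex.Im RR) h; rewrite /jfac ImD ImM Im_int Re_int Im_int mul0r !addr0.
move/eqP; rewrite /= mulf_eq0 (gt_eqF Iz) orbF intr_eq0 => /eqP c0.
move: h; rewrite /jfac c0 mul0r add0r => /eqP; rewrite intr_eq0 => /eqP d0.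
by move: det; rewrite c0 d0 !mulr0 subrr.
Qed.

Lemma Im_mobius (a b c d : int) (z : C) : a * d - b * c = 1 -> 0 < complex.Im z ->
  complex.Im (mobius a b c d z) = complex.Im z / nm (jfac c d z) ^+ 2.
Proof.
move=> det Iz; rewrite /mobius ImM ReV ImV.
rewrite -/(jfac c d z) nm_sqr.
have hd : (a%:~R * d%:~R - b%:~R * c%:~R : RR) = 1 by rewrite -!intrM -intrB det.
rewrite /jfac !(ReD, ImD, ReM, ImM, Re_int, Im_int) !mul0r !addr0 !subr0 !mulrA -mulrDl.
congr (_ / _); move: hd; move: (a%:~R) (b%:~R) (c%:~R) (d%:~R) => A B A' B' hd.
rewrite -[RHS]mul1r -hd; ring.
Qed.

Lemma Im_mobius_gt0 (a b c d : int) (z : C) : a * d - b * c = 1 -> 0 < complex.Im z ->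
  0 < complex.Im (mobius a b c d z).
Proof.
move=> det Iz; rewrite Im_mobius // divr_gt0 // exprn_gt0 // nm_gt0.
exact: jfac_neq0 det Iz.
Qed.

Definition SL2_inv (k : nat) (F : C -> C) := forall a b c d : int, a * d - b * c = 1 ->
  forall z : C, 0 < complex.Im z -> F (mobius a b c d z) = jfac c d z ^+ k * F z.

Lemma T_int (F : C -> C) : (forall z, F (z + 1) = F z) -> forall (n : int) z, F (z + n%:~R) = F z.
Proof.
move=> T; have Tn (n : nat) z : F (z + n%:R) = F z.
  by elim: n => [|n IH]; rewrite ?addr0 // -natr1 addrA T.
case=> n z; first exact: Tn.
by rewrite NegzE mulrNz -[in RHS](subrK (n.+1%:R) z) Tn.
Qed.

(** Euclid's algorithm on the first column: with a = m c + r, translation by -m followed by z ->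
    -1/z leads to a matrix with lower left entry r, |r| < |c|. For c = 0 the matrix is a translation
    up to sign, and evenness of k absorbs all signs. *)
Lemma SL2_gen k (F : C -> C) : ~~ odd k -> (forall z, F (z + 1) = F z) ->
  (forall z : C, 0 < complex.Im z -> F (- z^-1) = z ^+ k * F z) -> SL2_inv k F.
Proof.
move=> ek T S a b c d; have Tn := T_int T.
have [n] := ubnP `|c|%N; elim: n a b c d => // n IH a b c d hc det z Iz.
have [c0|c0] := eqVneq c 0.
  have : (a == 1) && (d == 1) || (a == -1) && (d == -1).
    move: det; rewrite c0 mulr0 subr0 => det.
    have := congr1 absz det; rewrite abszM => /eqP; rewrite muln_eq1 => /andP[/eqP h _].
    have [a1|a1] : a = 1 \/ a = -1 by lia.
      by rewrite a1 mul1r in det; rewrite a1 det eqxx.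
    by rewrite a1 mulN1r in det; rewrite a1 -[d]opprK det eqxx orbT.
  case/orP=> /andP[/eqP -> /eqP ->].
    by rewrite /mobius /jfac c0 !mul0r !add0r divr1 mul1r Tn expr1n mul1r.
  rewrite /mobius /jfac c0 !mul0r !add0r mulrN1z invrN1 mulrN1 opprD mulN1r opprK.
  rewrite -mulrNz Tn -signr_odd (negbTE ek) expr0 mul1r //.
have [m [r [b' [ar hb hr]]]] : exists m r b', [/\ a = m * c + r, b = b' + m * d & (`|r| < n)%N].
  exists (a %/ c)%Z, (a %% c)%Z, (b - (a %/ c)%Z * d); split; first exact: divz_eq.
    by rewrite subrK.
  apply: leq_trans (_ : `|(a %% c)%Z| < `|c|)%N _; last by rewrite -ltnS.
  have := modz_ge0 a c0; have := ltz_mod a c0; lia.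
have det' : (- c) * b' - (- d) * r = 1 by rewrite -det ar hb; ring.
have H := IH _ _ _ _ hr det' z Iz.
have IN := Im_mobius_gt0 det' Iz.
have j0 := jfac_neq0 det' Iz; have j1 := jfac_neq0 det Iz.
have E : mobius a b c d z = - (mobius (- c) (- d) r b' z)^-1 + m%:~R.
  rewrite /mobius -/(jfac r b' z) -/(jfac c d z) !rmorphN /= mulNr -opprD -/(jfac c d z).
  rewrite mulNr invrN opprK invf_div; apply: (mulIf j1); rewrite divfK // mulrDl divfK //.
  by rewrite /jfac ar hb !(intrD, intrM); ring.
rewrite E Tn S // H mulrA; congr (_ * _); rewrite -exprMn /mobius -/(jfac r b' z) divfK //.
rewrite !rmorphN /= mulNr -opprD -/(jfac c d z) exprNn -signr_odd (negbTE ek) expr0 mul1r //.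
Qed.

(** Invariance and growth at the cusps without holomorphy: the non-holomorphic [E2star] qualifies,
    while holomorphy is automatic for [ev a]. *)
Definition wm (k : nat) (f : C -> C) :=
  (forall a b c d : int, a * d - b * c = 1 -> (5 %| c)%Z -> forall z : C, 0 < complex.Im z ->
     f (mobius a b c d z) = jfac c d z ^+ k * f z) /\
  (forall a b c d : int, a * d - b * c = 1 -> exists M Y : RR, forall z : C, Y < complex.Im z ->
     nm (f (mobius a b c d z)) <= M * nm (jfac c d z) ^+ k).

Lemma cusp_pos (f : C -> C) a b c d k : (exists M Y : RR, forall z : C, Y < complex.Im z ->
     nm (f (mobius a b c d z)) <= M * nm (jfac c d z) ^+ k) ->
  exists M Y : RR, [/\ 0 <= M, 0 <= Y & forall z : C, Y < complex.Im z ->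
     nm (f (mobius a b c d z)) <= M * nm (jfac c d z) ^+ k].
Proof.
move=> [M [Y H]]; exists `|M|, `|Y|; split => // z hz.
apply: (le_trans (H z (le_lt_trans (ler_norm _) hz))).
by rewrite ler_wpM2r ?ler_norm // exprn_ge0 // nm_ge0.
Qed.

Lemma wm_ext k f g : (forall z : C, 0 < complex.Im z -> f z = g z) -> wm k f -> wm k g.
Proof.
move=> fg [h1 h2]; split => a b c d det.
  move=> c5 z Iz; rewrite -!fg //; [exact: h1|exact: Im_mobius_gt0].
have [M [Y [M0 Y0 H]]] := cusp_pos (h2 a b c d det); exists M, Y => z Yz.
by rewrite -fg ?H //; apply: Im_mobius_gt0 => //; apply: le_lt_trans Yz.
Qed.

Lemma wmD k f g : wm k f -> wm k g -> wm k (fun z => f z + g z).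
Proof.
move=> [f1 f2] [g1 g2]; split => a b c d det.
  by move=> c5 z Iz; rewrite f1 // g1 // mulrDr.
have [M [Y [M0 Y0 H]]] := cusp_pos (f2 a b c d det).
have [M' [Y' [M'0 Y'0 H']]] := cusp_pos (g2 a b c d det).
exists (M + M'), (Num.max Y Y') => z; rewrite gt_max => /andP[h h'].
by apply: (le_trans (nmD _ _)); rewrite mulrDl lerD ?H ?H'.
Qed.

Lemma wmM k l f g : wm k f -> wm l g -> wm (k + l) (fun z => f z * g z).
Proof.
move=> [f1 f2] [g1 g2]; split => a b c d det.
  by move=> c5 z Iz; rewrite f1 // g1 // exprD; ring.
have [M [Y [M0 Y0 H]]] := cusp_pos (f2 a b c d det).
have [M' [Y' [M'0 Y'0 H']]] := cusp_pos (g2 a b c d det).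
exists (M * M'), (Num.max Y Y') => z; rewrite gt_max => /andP[h h'].
by rewrite nmM exprD mulrACA ler_pM ?nm_ge0 ?H ?H'.
Qed.

Lemma wm_cst (x : C) : wm 0 (fun=> x).
Proof.
split=> a b c d det; first by move=> c5 z Iz; rewrite expr0 mul1r.
by exists (nm x), 0 => z _; rewrite expr0 mulr1.
Qed.

Lemma wmZ k f x : wm k f -> wm k (fun z => x * f z).
Proof. by move=> h; have := wmM (wm_cst x) h. Qed.

Lemma dvd5_split (c : int) : (5 %| c)%Z -> exists c', c = 5 * c'.
Proof. by case/dvdzP => c' ->; exists c'; rewrite mulrC. Qed.

Lemma ndvd5_solve (c d : int) : ~~ (5 %| c)%Z -> exists j d', d - c * j = 5 * d'.
Proof.
move=> h; have cp : coprimez c 5.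
  by rewrite coprimez_sym coprimezE /= prime_coprime; move: h; rewrite dvdzE.
have [u [v uv]] := Bezoutz c 5; have g1 : gcdz c 5 = 1 by apply/eqP.
exists (d * u), (d * v); rewrite g1 in uv.
transitivity (d * (u * c + v * 5) - c * (d * u)); [by rewrite uv mulr1|ring].
Qed.

Lemma mobius5 (a b c' d : int) (z : C) : 5 * mobius a b (5 * c') d z = mobius a (5 * b) c' d (5 * z).
Proof.
rewrite /mobius !rmorphM /= mulrA; congr (_ / _); last by ring.
by rewrite mulrDr; ring.
Qed.

(** The matrix identity diag(5, 1) [a b; c d] = [5a, b - a j; c, d'] [1 j; 0 5]. For 5 not dividing
    c, [ndvd5_solve] supplies j and d'. *)
Lemma mobius5' (a b c d j d' : int) (z : C) : a * d - b * c = 1 -> d - c * j = 5 * d' ->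
  0 < complex.Im z ->
  5 * mobius a b c d z = mobius (5 * a) (b - a * j) c d' ((z + j%:~R) / 5).
Proof.
move=> det hj Iz; have j0 := jfac_neq0 det Iz.
have hd : d%:~R = c%:~R * j%:~R + 5 * d'%:~R :> C.
  by rewrite -[5](_ : 5%:~R = 5) // -!intrM -intrD -hj addrC subrK.
have E : c%:~R * ((z + j%:~R) / 5) + d'%:~R = jfac c d z / 5.
  by rewrite /jfac hd; field.
rewrite /mobius E -/(jfac c d z) rmorphB !rmorphM /= -[5%:~R]/(5%:R).
by field; exact: j0.
Qed.

Lemma Im_add_int (z : C) (j : int) : complex.Im (z + j%:~R) = complex.Im z.
Proof. by rewrite ImD Im_int addr0. Qed.

Lemma Im_div5 (z : C) : complex.Im (z / 5) = complex.Im z / 5.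
Proof.
have -> : (5^-1 : C) = (5^-1 : RR)%:C by rewrite fmorphV rmorph_nat.
by rewrite ImM /= mulr0 add0r.
Qed.

Lemma Im_mul5 (z : C) : complex.Im (5 * z) = 5 * complex.Im z.
Proof. by rewrite ImM Re_nat Im_nat mul0r addr0. Qed.

Section FromLevelOne.
Variables (k : nat) (F : C -> C).
Hypothesis invF : SL2_inv k F.
Hypothesis bdF : exists B : RR, forall z : C, 1 < complex.Im z -> nm (F z) <= B.

Lemma wm_level1 : wm k F.
Proof.
split=> a b c d det; first by move=> _ z Iz; exact: invF.
have [B hB] := bdF; exists B, 1 => z Iz; have Iz0 : 0 < complex.Im z by apply: lt_trans Iz.
by rewrite invF // nmM nmX mulrC ler_wpM2r ?hB // exprn_ge0 // nm_ge0.
Qed.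

Lemma wm_level1_5 : wm k (fun z => F (5 * z)).
Proof.
split=> a b c d det.
  move=> /dvd5_split[c' ec] z Iz; rewrite ec in det *.
  have I5 : 0 < complex.Im (5 * z) by rewrite Im_mul5 mulr_gt0.
  rewrite mobius5 invF //; last by rewrite -[RHS]det; ring.
  by congr (_ ^+ _ * _); rewrite /jfac rmorphM /=; ring.
have [B hB] := bdF; case: (boolP (5 %| c)%Z) => [/dvd5_split[c' ec]|h5].
  exists B, 1 => z Iz; have Iz0 : 0 < complex.Im z by apply: lt_trans Iz.
  have I5 : 1 < complex.Im (5 * z) by rewrite Im_mul5; lra.
  have I50 : 0 < complex.Im (5 * z) by apply: lt_trans I5.
  rewrite ec mobius5 invF //; last by rewrite -[RHS]det ec; ring.
  rewrite nmM nmX mulrC (_ : jfac c' d (5 * z) = jfac (5 * c') d z); last first.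
    by rewrite /jfac rmorphM /=; ring.
  by rewrite ler_wpM2r ?hB // exprn_ge0 // nm_ge0.
have [j [d' hj]] := ndvd5_solve d h5.
(* Height above 5 keeps (z + j)/5 in the region Im > 1 where F is bounded. *)
exists B, 5 => z Iz; have Iz0 : 0 < complex.Im z by apply: lt_trans Iz.
have I5 : 1 < complex.Im ((z + j%:~R) / 5).
  by rewrite Im_div5 Im_add_int ltr_pdivlMr // mul1r.
have I50 : 0 < complex.Im ((z + j%:~R) / 5) by apply: lt_trans I5.
have det' : (5 * a) * d' - (b - a * j) * c = 1.
  transitivity (a * (5 * d') - (b - a * j) * c); first by ring.
  by rewrite -hj -[RHS]det; ring.
rewrite (mobius5' det hj Iz0) invF // nmM nmX mulrC.
apply: ler_pM; rewrite ?nm_ge0 ?exprn_ge0 ?nm_ge0 ?hB //.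
have -> : jfac c d' ((z + j%:~R) / 5) = jfac c d z / 5.
  have hd : d%:~R = c%:~R * j%:~R + 5 * d'%:~R :> C.
    by rewrite -[5](_ : 5%:~R = 5) // -!intrM -intrD -hj addrC subrK.
  by rewrite /jfac hd; field.
apply: lerXn2r; rewrite ?nnegrE ?nm_ge0 // nm_div nm_nat ler_pdivrMr //.
by rewrite ler_peMr ?nm_ge0 // ler1n.
Qed.

End FromLevelOne.

Lemma pev_bounded c (r : RR) : tame c -> 0 <= r < 1 ->
  exists B : RR, forall q, nm q <= r -> nm (pev c q) <= B.
Proof.
move=> tc hr; have [S0 [B hB]] := tame_sumb tc hr; exists B => q hq.
have q1 : nm q < 1 by apply: le_lt_trans hq _; case/andP: hr.
apply: (hs_nm_le (pevP tc q1) (M := fun n => nm (c n) * r ^+ n)) => // n.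
rewrite nmM nmX ler_wpM2l ?nm_ge0 //; apply: lerXn2r => //; rewrite nnegrE ?nm_ge0 //.
by case/andP: hr.
Qed.

Lemma expR_2piN_lt1 (y : RR) : 0 < y -> 0 <= expR (- (2 * pi * y)) < 1.
Proof. by move=> y0; rewrite expR_ge0 expR_lt1 oppr_lt0 !mulr_gt0 // pi_gt0. Qed.

Lemma ev_bounded a (y : RR) : tm a -> 0 < y ->
  exists B : RR, forall z : C, y <= complex.Im z -> nm (ev a z) <= B.
Proof.
move=> ta y0; have [B hB] := pev_bounded ta (expR_2piN_lt1 y0).
by exists B => z hz; apply: hB; exact: Im_lt_nm_e.
Qed.

(** Forms are represented by their integral expansions; holomorphy of [ev a] is [has_d_ev]. *)
Definition MF k a := tm a /\ wm k (ev a).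

Lemma MF_D k a b : MF k a -> MF k b -> MF k (a + b).
Proof.
move=> [ta wa] [tb wb]; split; first exact: tmD.
by apply: wm_ext (wmD wa wb) => z Iz; rewrite evD.
Qed.

Lemma MF_N k a : MF k a -> MF k (- a).
Proof.
move=> [ta wa]; split; first exact: tmN.
by apply: wm_ext (wmZ (-1) wa) => z Iz; rewrite evN // mulN1r.
Qed.

Lemma MF_B k a b : MF k a -> MF k b -> MF k (a - b).
Proof. by move=> ha hb; apply: MF_D ha (MF_N hb). Qed.

Lemma MF_M k l a b : MF k a -> MF l b -> MF (k + l) (a * b).
Proof.
move=> [ta wa] [tb wb]; split; first exact: tmM.
by apply: wm_ext (wmM wa wb) => z Iz; rewrite evM.
Qed.

Lemma MF_nat n : MF 0 n%:R.
Proof.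
split; first exact: tm_nat.
by apply: wm_ext (wm_cst n%:R) => z Iz; rewrite ev_nat.
Qed.

Lemma MF_natM k n a : MF k a -> MF k (n%:R * a).
Proof. by move=> ha; exact: MF_M (MF_nat n) ha. Qed.

Lemma MF_X k n a : MF k a -> MF (k * n) (a ^+ n).
Proof.
move=> ha; elim: n => [|n IH]; first by rewrite muln0 expr0; exact: (MF_nat 1).
by rewrite mulnS exprS; exact: MF_M.
Qed.

(** Integrality of the quotient is carried by the type of a, so dividing a form by n amounts to
    exhibiting the quotient series. *)
Lemma MF_div k n a : (0 < n)%N -> MF k (n%:R * a) -> MF k a.
Proof.
move=> n0 [ta wa]; have ta' := tm_natM n0 ta; split => //.
apply: wm_ext (wmZ n%:R^-1 wa) => z Iz.
by rewrite ev_natM // mulKf // pnatr_eq0 -lt0n.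
Qed.

Lemma MF_sum k (I : Type) (r : seq I) (P : pred I) (A : I -> fps int) :
  MF k 0 -> (forall i, P i -> MF k (A i)) -> MF k (\sum_(i <- r | P i) A i).
Proof. by move=> h0 h; apply: big_ind => //; exact: MF_D. Qed.

Lemma MF_0 k : MF k 0.
Proof.
split; first exact: (tm_nat 0).
apply: (wm_ext (f := fun=> 0)); first by move=> z Iz; exact: esym (ev_nat Iz 0).
split=> a b c d det; first by move=> _ z _; rewrite mulr0.
by exists 0, 0 => z _; rewrite nm0 mul0r.
Qed.

Lemma MF_level1 k a : ~~ odd k -> tm a ->
  (forall z : C, 0 < complex.Im z -> ev a (- z^-1) = z ^+ k * ev a z) ->
  MF k a /\ MF k (dil 5 a).
Proof.
move=> ek ta S; have inv := SL2_gen ek (ev_T a) S.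
have bd : exists B : RR, forall z : C, 1 < complex.Im z -> nm (ev a z) <= B.
  by have [B hB] := ev_bounded ta (@ltr01 RR); exists B => z /ltW; exact: hB.
split; split => //; first exact: wm_level1 inv bd.
  exact: tm_dil.
by apply: wm_ext (wm_level1_5 inv bd) => z Iz; rewrite ev_dil.
Qed.

(** * The logarithm of the discriminant and reduction theory *)

(** sigma(n)/n is the sum of 1/d over d | n, the coefficient of x^n in minus the logarithm of the
    product of all 1 - x^n. At n = 0 the value is 0. *)
Definition lam (n : nat) : C := sgC n / n%:R.

Lemma tame_lam : tame lam.
Proof.
apply: (tame_le tame_sg) => -[|n].
  by rewrite /lam invr0 mulr0 nm0 nm_ge0.
by rewrite /lam /sgC nm_div !nm_nat ler_pdivrMr ?ltr0n // ler_peMr // ler1n.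
Qed.

(* [Re (Lam z) = log |Delta z|]: the logarithm of the product formula for [Delta]. *)
Definition Lam (z : C) : C := tpi * z - 24 * pev lam (e z).

Lemma sg0 : sg 0 = 0%N. Proof. by rewrite /sg big_ord0. Qed.

Lemma has_d_Lam z : 0 < complex.Im z -> has_d Lam z (tpi * E2 z).
Proof.
move=> Iz; have q1 := nm_e_lt1 Iz.
have h := has_d_comp (has_d_e z) (has_d_pev tame_lam q1).
have E : pev (dser lam) (e z) * e z = Gq (e z).
  rewrite /Gq (pev_shift tame_sg) // /sgC sg0 add0r mulrC; congr (_ * pev _ _).
  apply/funext => n; have n0 := natC_neq0 n.
  by rewrite /dser /lam mulrCA divff // mulr1.
have := has_dB (has_dZ tpi (has_d_id z)) (has_dZ 24 h).
rewrite mulr1 (_ : _ - _ = tpi * E2 z) // /E2 -E; ring.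
Qed.

(** Passes from derivatives with quadratic remainder to [is_derive], for which the mean value
    theorem is available. *)
Lemma quad_is_derive (f : RR -> RR) (x l : RR) :
  (exists K d : RR, 0 < d /\ forall h, `|h| <= d -> `|f (x + h) - f x - l * h| <= K * h ^+ 2) ->
  is_derive x 1 f l.
Proof.
move=> [K [d [d0 H]]].
have relE_Dr : 0 < `|K| + 1 by have := normr_ge0 K; lra.
have L : ((fun h => h^-1 *: (f (h *: (1 : RR) + x) - f x)) @ 0^' --> l)%classic.
  apply/cvgrPdist_lt => eps e0.
  have r0 : 0 < Num.min d (eps / (`|K| + 1)) by rewrite lt_min d0 divr_gt0.
  exists (Num.min d (eps / (`|K| + 1))) => // h; rewrite /= sub0r normrN => hr h0.
  rewrite /GRing.scale /= mulr1 [h + x]addrC -normrN opprB.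
  move: hr; rewrite lt_min => /andP[hd he].
  have hn : 0 < `|h| by rewrite normr_gt0.
  have -> : h^-1 * (f (x + h) - f x) - l = (f (x + h) - f x - l * h) / h by field.
  rewrite normrM normfV ltr_pdivrMr //; apply: (le_lt_trans (H h (ltW hd))).
  rewrite ltr_pdivlMr // in he; rewrite -(real_normK (num_real h)) expr2 mulrA ltr_pM2r //.
  apply: le_lt_trans he; rewrite mulrC ler_wpM2l //.
  by have := ler_norm K; lra.
apply: DeriveDef; first by apply/cvg_ex; exists l.
exact: cvg_lim L.
Qed.

Lemma is_derive_scaleR (f : RR -> RR) (k x l : RR) :
  is_derive x 1 f l -> is_derive x 1 (fun t => k * f t) (k * l).
Proof. by move=> h; have := @is_deriveZ _ _ _ f k x 1 l h. Qed.

Lemma is_derive_subR (f g : RR -> RR) (x l m : RR) :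
  is_derive x 1 f l -> is_derive x 1 g m -> is_derive x 1 (fun t => f t - g t) (l - m).
Proof. by move=> h h'; have := @is_deriveB _ _ _ f g x 1 l m h h'. Qed.

Lemma is_derive_unique_cst (f : RR -> RR) : (forall x : RR, 0 <= x <= 1 -> is_derive x 1 f 0) ->
  f 1 = f 0.
Proof.
move=> H; have D (x : RR) : x \in `]0, 1[%R -> is_derive x 1 f ((fun=> 0) x).
  by rewrite in_itv /= => /andP[h1 h2]; apply: H; rewrite !ltW.
have Cf : {within `[0, 1]%classic, continuous f}%classic.
  apply: derivable_within_continuous => x; rewrite in_itv /= => h.
  by have [] := H x h.
have [c _] := MVT ltr01 D Cf.
by rewrite mul0r => /eqP; rewrite subr_eq0 => /eqP.
Qed.

Section LamS.
Variable z : C.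
Hypothesis Iz : 0 < complex.Im z.

Let v := z - 'i%C.
Let p (s : RR) : C := 'i%C + s%:C * v.

Let Ip (s : RR) : 0 <= s <= 1 -> 0 < complex.Im (p s).
Proof.
move=> /andP[s0 s1]; rewrite /p /v ImD ImM ImD ImN /= mul0r addr0.
have [h|h] := ltP s 1; first by have := mulr_ge0 s0 (ltW Iz); lra.
have -> : s = 1 by lra.
by rewrite mul1r addrC subrK.
Qed.

Let g (w : C) := Lam (- w^-1) - Lam w.

Let has_d_g (w : C) : 0 < complex.Im w -> has_d g w (12 / w).
Proof.
move=> Iw; have w0 := z_neq0 Iw.
have h1 := has_d_comp (has_dN (has_d_inv w0)) (has_d_Lam (Im_Sz Iw)).
have := has_dB h1 (has_d_Lam Iw); rewrite (_ : _ - _ = 12 / w) // E2_S //.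
by have t0 := tpi_neq0; field; rewrite w0 t0.
Qed.

Let has_derive_g (s : RR) : 0 <= s <= 1 ->
  is_derive s 1 (fun s => complex.Re (g (p s))) (complex.Re (12 / p s * v)).
Proof.
move=> hs; apply: quad_is_derive.
have [K [d [d0 d1 K0 H]]] := has_dK (has_d_g (Ip hs)).
have v1 : 0 < nm v + 1 by have := nm_ge0 v; lra.
exists (K * nm v ^+ 2), (d / (nm v + 1)); split; first by rewrite divr_gt0.
move=> h; rewrite ler_pdivlMr // => hh.
have E : p (s + h) = p s + h%:C * v by rewrite /p rmorphD mulrDl addrA.
have hv : nm (h%:C * v) = `|h| * nm v by rewrite nmM nm_real.
have hd : nm (h%:C * v) <= d by rewrite hv; have := nm_ge0 v; have := normr_ge0 h; nra.
have := H _ hd; rewrite -E hv exprMn real_normK ?num_real // => H'.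
rewrite (_ : K * _ * _ = K * (h ^+ 2 * nm v ^+ 2)); last by ring.
apply: le_trans H'; apply: le_trans (nm_Re _).
have E2 : 12 / p s * (h%:C * v) = h%:C * (12 / p s * v) by ring.
rewrite E2; move: (12 / p s * v) (g (p (s + h))) (g (p s)) => X Y W.
have E3 : complex.Re (h%:C * X) = complex.Re X * h by rewrite ReM /= mul0r subr0 mulrC.
by rewrite !ReD !ReN E3 lexx.
Qed.

Let nm_line (u : C) (t : RR) :
  nm ('i%C + t%:C * u) ^+ 2 = 1 + 2 * complex.Im u * t + nm u ^+ 2 * t ^+ 2.
Proof. rewrite !nm_sqr !ReD !ImD !ReM !ImM /=; ring. Qed.

Let Re_line (u : C) (s : RR) : 0 < nm ('i%C + s%:C * u) ->
  6 * ((nm ('i%C + s%:C * u) ^+ 2)^-1 * (2 * complex.Im u + 2 * nm u ^+ 2 * s)) =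
  complex.Re (12 / ('i%C + s%:C * u) * u).
Proof.
move=> p0; have E1 : complex.Re ('i%C + s%:C * u) = s * complex.Re u.
  by rewrite ReD ReM /= add0r mul0r subr0.
have E2 : complex.Im ('i%C + s%:C * u) = 1 + s * complex.Im u.
  by rewrite ImD ImM /= mul0r addr0.
move: ('i%C + s%:C * u) p0 E1 E2 => w p0 E1 E2.
have -> : 12 / w * u = 12%:R * (w^-1 * u) by rewrite mulrA.
rewrite ReM Re_nat Im_nat mul0r subr0 ReM ReV ImV E1 E2 (nm_sqr u).
by field; rewrite gt_eqF.
Qed.

Let has_derive_ln (s : RR) : 0 <= s <= 1 ->
  is_derive s 1 (fun s => 6 * ln (nm (p s) ^+ 2)) (complex.Re (12 / p s * v)).
Proof.
move=> hs; have Is := Ip hs; have p0 := nmz_gt0 Is.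
have dq : is_derive s 1 (fun t => nm (p t) ^+ 2) (2 * complex.Im v + 2 * nm v ^+ 2 * s).
  apply: quad_is_derive; exists (nm v ^+ 2), 1; split => // h _.
  rewrite /p !nm_line; move: (complex.Im v) (nm v) => B D.
  rewrite (_ : _ - _ = D ^+ 2 * h ^+ 2); last by ring.
  by rewrite ger0_norm // mulr_ge0 // sqr_ge0.
have q0 : 0 < nm (p s) ^+ 2 by rewrite exprn_gt0.
have dl := @is_derive1_comp _ (@ln RR) (fun t => nm (p t) ^+ 2) s _ _ (is_derive1_ln q0) dq.
have R : 6 * ((nm (p s) ^+ 2)^-1 * (2 * complex.Im v + 2 * nm v ^+ 2 * s)) =
  complex.Re (12 / p s * v) := Re_line p0.
rewrite -R; exact: is_derive_scaleR dl.
Qed.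

(** Along the segment p from i to z both sides have derivative Re(12 (z - i)/p), by the law of E2,
    and both vanish at i, which z -> -1/z fixes. Taking real parts avoids a branch of the
    logarithm. *)
Lemma Lam_S : complex.Re (Lam (- z^-1)) - complex.Re (Lam z) = 6 * ln (nm z ^+ 2).
Proof.
pose u s := complex.Re (g (p s)) - 6 * ln (nm (p s) ^+ 2).
have H : u 1 = u 0.
  apply: is_derive_unique_cst => s hs.
  by have := is_derive_subR (has_derive_g hs) (has_derive_ln hs); rewrite subrr.
have p1 : p 1 = z by rewrite /p /v mul1r addrC subrK.
have p0 : p 0 = 'i%C by rewrite /p mul0r addr0.
have i0 : 'i%C != 0 :> C by rewrite -nm_gt0 nmi.
have ii : 'i%C * 'i%C = -1 :> C by apply: cplxP; rewrite ?ReM ?ImM /=; ring.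
have iV : - 'i%C^-1 = 'i%C :> C by apply: (mulIf i0); rewrite mulNr mulVf // ii.
have g0 : g 'i%C = 0 by rewrite /g iV subrr.
move: H; rewrite /u p1 p0 g0 nmi expr1n ln1 mulr0 subr0 => H.
have gz : complex.Re (g z) = complex.Re (Lam (- z^-1)) - complex.Re (Lam z).
  by rewrite /g ReD ReN.
by rewrite -gz; apply: subr0_eq.
Qed.

End LamS.

(* [log (|Delta z| y^6)], an SL_2(Z)-invariant function. *)
Definition V (z : C) : RR := complex.Re (Lam z) + 6 * ln (complex.Im z).

Lemma V_S (z : C) : 0 < complex.Im z -> V (- z^-1) = V z.
Proof.
move=> Iz; have z0 := nmz_gt0 Iz; have h := Lam_S Iz.
have n2 : 0 < nm z ^+ 2 by rewrite exprn_gt0.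
have e1 : ln (complex.Im (- z^-1)) = ln (complex.Im z) - ln (nm z ^+ 2).
  by rewrite ImN ImV mulNr opprK ln_div.
rewrite /V e1; move: h.
generalize (complex.Re (Lam (- z^-1))) (complex.Re (Lam z)) (ln (nm z ^+ 2)) (ln (complex.Im z)).
move=> A B c d h.
by rewrite mulrBr -h; ring.
Qed.

Lemma Lam_T z : complex.Re (Lam (z + 1)) = complex.Re (Lam z).
Proof.
have t1 : complex.Re tpi = 0 by rewrite /tpi ReM /= mulr0 mul0r subrr.
rewrite /Lam eD e1 mulr1; move: (24 * pev lam (e z)) => X.
by rewrite mulrDr mulr1 addrAC ReD t1 addr0.
Qed.

Lemma V_T z : V (z + 1) = V z.
Proof.
have i1 : complex.Im (z + 1) = complex.Im z by rewrite ImD /= addr0.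
exact (congr2 (fun a b => a + 6 * ln b) (Lam_T z) i1).
Qed.

Lemma V_inv (a b c d : int) (z : C) : a * d - b * c = 1 -> 0 < complex.Im z ->
  V (mobius a b c d z) = V z.
Proof.
move=> det Iz.
(* [V] is viewed as a complex function of weight 0, so that [SL2_gen] applies. *)
have H : SL2_inv 0 (fun z => (V z)%:C).
  apply: SL2_gen; first exact: isT.
    by move=> w; exact: (congr1 (fun t : RR => t%:C) (V_T w)).
  by move=> w Iw; rewrite expr0 mul1r; exact: (congr1 (fun t : RR => t%:C) (V_S Iw)).
have := H a b c d det z Iz; rewrite expr0 mul1r => /(congr1 (@complex.Re RR)).
exact.
Qed.

Lemma round_int (x : RR) : exists n : int, `|x - n%:~R| <= 2^-1.
Proof.
exists (Num.floor (x + 2^-1)); have h := @floor_le RR (x + 2^-1); have h' := @floorD1_gt RR (x + 2^-1).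
rewrite rmorphD /= in h'; rewrite ler_norml; lra.
Qed.

(** If Im z < 1/2, a translation to |Re w| <= 1/2 gives |w|^2 <= 1/2, so -1/w is at least twice as
    high; k bounds the number of doublings. *)
Lemma reduction_aux k (z : C) : 0 < complex.Im z -> 2^-1 <= 2 ^+ k * complex.Im z ->
  exists a b c d : int, a * d - b * c = 1 /\ 2^-1 <= complex.Im (mobius a b c d z).
Proof.
elim: k z => [|k IH] z Iz; first rewrite expr0 mul1r => h.
  exists 1, 0, 0, 1; split; first by rewrite mulr0 subr0 mulr1.
  by rewrite /mobius !mul0r mul1r addr0 add0r divr1.
move=> h; have [i2|i2] := leP (2^-1) (complex.Im z).
  exists 1, 0, 0, 1; split; first by rewrite mulr0 subr0 mulr1.
  by rewrite /mobius !mul0r mul1r addr0 add0r divr1.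
have [n hn] := round_int (complex.Re z).
pose w : C := z - n%:~R.
have Iw : complex.Im w = complex.Im z by rewrite /w ImD ImN Im_int oppr0 addr0.
have Iw0 : 0 < complex.Im w by rewrite Iw.
have w0 := z_neq0 Iw0; have wp := nmz_gt0 Iw0.
have w2 : nm w ^+ 2 <= 2^-1.
  rewrite nm_sqr Iw /w ReD ReN Re_int.
  have : (complex.Re z - n%:~R) ^+ 2 <= 4^-1.
    rewrite -real_normK ?num_real // (_ : 4^-1 = 2^-1 ^+ 2); last by field.
    by apply: lerXn2r; rewrite ?nnegrE // invr_ge0.
  nra.
have I2 : 2 * complex.Im z <= complex.Im (- w^-1).
  rewrite ImN ImV mulNr opprK Iw ler_pdivlMr ?exprn_gt0 //; nra.
have I3 : 2^-1 <= 2 ^+ k * complex.Im (- w^-1).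
  apply: (le_trans h); rewrite exprSr -mulrA; apply: ler_wpM2l => //; exact: exprn_ge0.
have [a [b [c [d [det H]]]]] := IH _ (Im_Sz Iw0) I3.
exists b, (- a - n * b), d, (- c - n * d); split; first by rewrite -[RHS]det; ring.
suff -> : mobius b (- a - n * b) d (- c - n * d) z = mobius a b c d (- w^-1) by [].
have j0 := jfac_neq0 det (Im_Sz Iw0); rewrite /jfac in j0.
have zE : z = w + n%:~R by rewrite /w subrK.
have nu : c%:~R * - w^-1 + d%:~R = (d%:~R * z + (- c - n * d)%:~R) / w.
  have -> : (- c - n * d)%:~R = - c%:~R - n%:~R * d%:~R :> C by rewrite rmorphB rmorphN rmorphM.
  rewrite zE; move: (w : C) w0 => u u0; field; exact: u0.
have nu2 : a%:~R * - w^-1 + b%:~R = (b%:~R * z + (- a - n * b)%:~R) / w.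
  have -> : (- a - n * b)%:~R = - a%:~R - n%:~R * b%:~R :> C by rewrite rmorphB rmorphN rmorphM.
  rewrite zE; move: (w : C) w0 => u u0; field; exact: u0.
by rewrite /mobius nu nu2 invf_div [RHS]mulrA divfK.
Qed.

Lemma reduction (z : C) : 0 < complex.Im z -> exists a b c d : int,
  a * d - b * c = 1 /\ 2^-1 <= complex.Im (mobius a b c d z).
Proof.
move=> Iz; pose k := (Num.Def.truncn (complex.Im z)^-1).+1.
apply: (@reduction_aux k) => //.
have h : (complex.Im z)^-1 < k%:R by exact: truncnS_gt.
have h2 : k%:R <= 2 ^+ k :> RR by rewrite -natrX ler_nat ltnW // ltn_expl.
have : 1 <= k%:R * complex.Im z by rewrite -ler_pdivrMr // div1r ltW.
have h3 : k%:R * complex.Im z <= 2 ^+ k * complex.Im z by rewrite ler_wpM2r // ltW.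
move=> h4; apply: le_trans (le_trans h4 h3).
by rewrite invf_le1 // ler1n.
Qed.

(** * The maximum principle *)

Lemma pev_tail c (r : RR) : tame c -> 0 <= r < 1 -> forall eps, 0 < eps -> exists K, forall N q,
  (K <= N)%N -> nm q <= r -> nm (pev c q - \sum_(j < N) c j * q ^+ j) <= eps.
Proof.
move=> tc r01 eps eps0; have [r0 r1] := andP r01.
have sM := tame_sumb tc r01; have [K hK] := sumb_tail sM eps0.
have M0 k : 0 <= nm (c k) * r ^+ k by rewrite mulr_ge0 ?nm_ge0 ?exprn_ge0.
exists K => N q KN qr; have q1 : nm q < 1 by apply: le_lt_trans r1.
apply: (@hs_tail _ _ (fun n => nm (c n) * r ^+ n) _ _ (pevP tc q1)) => n.
  by rewrite nmM nmX ler_wpM2l ?nm_ge0 // lerXn2r ?nnegrE ?nm_ge0.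
apply: le_trans (ltW (hK n)).
have [h|h] := leqP N n; last by rewrite big_geq ?sumr_ge0 // ltnW.
by rewrite (big_cat_nat KN h) /= lerDr sumr_ge0.
Qed.

(** Finite Fourier inversion, the discrete form of Cauchy's coefficient integral; it is exact on
    sums truncated at N. *)
Lemma dft (N j : nat) (c : nat -> C) (x : C) : (j < N)%N ->
  N%:R * (c j * x ^+ j) = \sum_(k < N) e N%:R^-1 ^+ k ^+ (N - j) *
    \sum_(l < N) c l * (e N%:R^-1 ^+ k * x) ^+ l.
Proof.
move=> jN; have N0 : (0 < N)%N by apply: leq_ltn_trans jN.
set z := e _.
have zn m : z ^+ m = z ^+ (m %% N).
  by rewrite {1}(divn_eq m N) exprD mulnC exprM zN // expr1n mul1r.
under eq_bigr do rewrite mulr_sumr; rewrite exchange_big /=.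
have E (l : 'I_N) : \sum_(k < N) z ^+ k ^+ (N - j) * (c l * (z ^+ k * x) ^+ l) =
    if l == j :> nat then N%:R * (c l * x ^+ l) else 0.
  have -> : \sum_(k < N) z ^+ k ^+ (N - j) * (c l * (z ^+ k * x) ^+ l) =
      (\sum_(k < N) (z ^+ k) ^+ ((l + (N - j)) %% N)) * (c l * x ^+ l).
    rewrite mulr_suml; apply: eq_bigr => k _.
    have -> : (z ^+ k) ^+ ((l + (N - j)) %% N) = z ^+ k ^+ l * z ^+ k ^+ (N - j).
      by rewrite -exprD -!exprM mulnC exprM -zn -exprM mulnC.
    by rewrite exprMn; ring.
  rewrite sum_zj ?ltn_pmod //.
  have -> : ((l + (N - j)) %% N == 0)%N = (l == j :> nat).
    have lN := ltn_ord l; apply/idP/eqP => [/dvdnP[m hm]|->]; last by rewrite subnKC ?modnn // ltnW.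
    by have : m = 1%N; nia.
  by case: eqP => // _; rewrite mul0r.
under [RHS]eq_bigr do rewrite E.
rewrite (bigD1 (Ordinal jN)) //= eqxx big1 ?addr0 // => l hl.
by rewrite (_ : (l == j :> nat) = false) //; apply/negbTE.
Qed.

Lemma nm_zk (N k : nat) : nm (e (N%:R^-1 : C) ^+ k) = 1.
Proof.
have I0 : complex.Im (N%:R^-1 : C) = 0 by rewrite ImV Im_nat oppr0 mul0r.
by rewrite nmX nm_e I0 mulr0 oppr0 expR0 expr1n.
Qed.

Lemma ler_eps (x y K : RR) : (forall eps, 0 < eps -> x <= y + K * eps) -> x <= y.
Proof.
move=> H; rewrite leNgt; apply/negP => yx.
have relE_Dr : 0 < `|K| + 1 by have := normr_ge0 K; lra.
have d0 : 0 < (x - y) / (2 * (`|K| + 1)) by rewrite divr_gt0 ?subr_gt0 ?mulr_gt0.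
have := H _ d0; have kk := ler_norm K.
have : K * ((x - y) / (2 * (`|K| + 1))) <= (`|K| + 1) * ((x - y) / (2 * (`|K| + 1))).
  by rewrite ler_wpM2r ?ltW //; lra.
have -> : (`|K| + 1) * ((x - y) / (2 * (`|K| + 1))) = (x - y) / 2 by field; rewrite gt_eqF.
move: (K * _) => t; lra.
Qed.

(** Cauchy's estimate: the tail beyond N is at most eps uniformly on the circle, and averaging the
    truncated sum over N points isolates the coefficient. *)
Lemma coef_bound c (r M : RR) : tame c -> 0 < r < 1 -> (forall q, nm q = r -> nm (pev c q) <= M) ->
  forall j, nm (c j) * r ^+ j <= M.
Proof.
move=> tc /andP[r0 r1] hM j; apply: (@ler_eps _ _ 1) => eps eps0; rewrite mul1r.
have [K hK] : exists K, forall N q,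
    (K <= N)%N -> nm q <= r -> nm (pev c q - \sum_(j < N) c j * q ^+ j) <= eps.
  by apply: pev_tail => //; rewrite ltW.
pose N := (K + j).+1; have jN : (j < N)%N by rewrite ltnS leq_addl.
have KN : (K <= N)%N by rewrite leqW // leq_addr.
have N0 : 0 < N%:R :> RR by rewrite ltr0n.
have nr : nm r%:C = r by rewrite nm_real gtr0_norm.
have H := dft c r%:C jN; have H2 := congr1 nm H.
have : N%:R * (nm (c j) * r ^+ j) <= N%:R * (M + eps).
  have <- : nm (N%:R * (c j * r%:C ^+ j)) = N%:R * (nm (c j) * r ^+ j).
    by rewrite !nmM nm_nat nmX nr.
  rewrite H2; apply: le_trans (nm_sum _ _ _) _.
  have -> : N%:R * (M + eps) = \sum_(k < N) (M + eps) by rewrite sumr_const card_ord mulr_natl.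
  apply: ler_sum => k _; rewrite nmM nmX nm_zk expr1n mul1r.
  have nz : nm (e N%:R^-1 ^+ k * r%:C) = r by rewrite nmM nm_zk mul1r.
  have nzr : nm (e N%:R^-1 ^+ k * r%:C) <= r by rewrite nz.
  have h1 := hM _ nz; have h2 := hK N _ KN nzr.
  rewrite nmBC in h2; have h3 := nmD (pev c (e N%:R^-1 ^+ k * r%:C))
    (\sum_(l < N) c l * (e N%:R^-1 ^+ k * r%:C) ^+ l - pev c (e N%:R^-1 ^+ k * r%:C)).
  by rewrite addrC subrK in h3; apply: (le_trans h3); apply: lerD.
by rewrite ler_pM2l.
Qed.

Lemma pow_bound (x M K : RR) : 0 <= x -> 0 <= M -> (forall n, x ^+ n.+1 <= M ^+ n.+1 * K) -> x <= M.
Proof.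
move=> x0 M0 H; rewrite leNgt; apply/negP => Mx.
have := M0; rewrite le0r => /orP[/eqP M00|Mp].
  by have := H 0%N; rewrite M00 !expr1 mul0r => h; lra.
pose t := x / M - 1; have t0 : 0 < t by rewrite subr_gt0 ltr_pdivlMr ?mul1r.
have xE : x = M * (1 + t) by rewrite /t; field; rewrite gt_eqF.
have [N hN] : exists N : nat, `|K| / t < N%:R.
  by exists (Num.Def.truncn (`|K| / t)).+1; exact: truncnS_gt.
have := H N; rewrite {1}xE exprMn ler_pM2l ?exprn_gt0 // => h.
have b := bernoulli_ineq N.+1 (ltW t0); move: hN; rewrite ltr_pdivrMr // => hN.
have kk := ler_norm K; rewrite -natr1 in b; nra.
Qed.

Definition one_ser (n : nat) : C := (n == 0%N)%:R.

Lemma tame_one_ser : tame one_ser.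
Proof.
apply: (tame_le tame_cst1) => n; rewrite /one_ser nm1.
by case: (n == 0%N); rewrite ?nm1 ?nm0.
Qed.

Lemma pev_one_ser q : nm q < 1 -> pev one_ser q = 1.
Proof.
move=> q1; apply: (pev_hs tame_one_ser q1).
have := @hs_finite (fun n => one_ser n * q ^+ n) 1.
rewrite big_ord1 /one_ser eqxx mul1r expr0; apply=> -[|n] // _.
by rewrite mul0r.
Qed.

Definition powc (c : nat -> C) (n : nat) : nat -> C := iter n (conv c) one_ser.

Lemma tame_powc c n : tame c -> tame (powc c n).
Proof. by move=> tc; elim: n => [|n IH]; [exact: tame_one_ser|exact: tame_conv]. Qed.

Lemma pev_powc c n q : tame c -> nm q < 1 -> pev (powc c n) q = pev c q ^+ n.
Proof.
move=> tc q1; elim: n => [|n IH]; first exact: pev_one_ser.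
have tp := tame_powc n tc.
by rewrite exprS -IH -pevM.
Qed.

(** Landau's argument: Cauchy's estimates for the n-th power of the series bound |f(q)|^n by M^n/(1
    - |q|/r), and letting n grow in [pow_bound] removes the last factor. *)
Lemma max_principle c (r M : RR) : tame c -> 0 < r < 1 -> 0 <= M ->
  (forall q, nm q = r -> nm (pev c q) <= M) ->
  forall q, nm q < r -> nm (pev c q) <= M.
Proof.
move=> tc r01 M0 H q qr; have [r0 r1] := andP r01.
have q1 := lt_trans qr r1.
have t01 : 0 <= nm q / r < 1.
  by rewrite divr_ge0 ?nm_ge0 ?(ltW r0) //= ltr_pdivrMr // mul1r.
apply: (@pow_bound _ _ (1 - nm q / r)^-1) => // [|n]; first exact: nm_ge0.
have tp := tame_powc n.+1 tc.
have cb : forall j, nm (powc c n.+1 j) * r ^+ j <= M ^+ n.+1.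
  apply: coef_bound => // w wr; rewrite pev_powc ?wr // nmX.
  by apply: lerXn2r; rewrite ?nnegrE ?nm_ge0 // H.
rewrite -nmX -pev_powc //.
apply: (hs_nm_le (M := fun j => M ^+ n.+1 * (nm q / r) ^+ j) (pevP tp q1)) => [j|N].
  rewrite nmM nmX expr_div_n mulrA ler_pdivlMr ?exprn_gt0 // mulrAC.
  by apply: ler_wpM2r; rewrite ?exprn_ge0 ?nm_ge0.
rewrite -mulr_sumr; apply: ler_wpM2l; first exact: exprn_ge0.
exact: geom_le.
Qed.

Lemma expRX (x : RR) n : expR x ^+ n = expR (n%:R * x).
Proof. by rewrite -expRM_natl. Qed.

Lemma nm1D_sqr (w : C) : nm (1 + w) ^+ 2 = 1 + 2 * complex.Re w + nm w ^+ 2.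
Proof. rewrite !nm_sqr !ReD !ImD /=; ring. Qed.

Lemma sqr_le (x y : RR) : 0 <= y -> x ^+ 2 <= y ^+ 2 -> x <= y.
Proof. move=> y0 h; rewrite leNgt; apply/negP => yx; nra. Qed.

(** Together with [nm1D_ge] this says log |1 + w| = Re w + O(|w|^2), the form needed to compare |1 +
    S/n|^n with exp(Re S). *)
Lemma nm1D_le (w : C) : nm (1 + w) <= expR (complex.Re w + nm w ^+ 2 / 2).
Proof.
apply: sqr_le; first exact: expR_ge0.
rewrite nm1D_sqr expRX -addrA; apply: le_trans (expR_ge1Dx _) _.
by rewrite ler_expR; move: (complex.Re w) (nm w) => x y; lra.
Qed.

Lemma nm1D_ge (w : C) : nm w <= 4^-1 -> expR (complex.Re w - 4 * nm w ^+ 2) <= nm (1 + w).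
Proof.
move=> hw; apply: sqr_le; first exact: nm_ge0.
rewrite nm1D_sqr expRX.
have hr : `|complex.Re w| <= 4^-1 := le_trans (nm_Re w) hw.
have hr2 : complex.Re w ^+ 2 <= nm w ^+ 2 by rewrite nm_sqr lerDl sqr_ge0.
move: hr hr2; rewrite ler_norml; generalize (complex.Re w) (nm w) => x y /andP[x1 x2] xy.
apply: (@le_trans _ _ (1 + 2 * x)); last by rewrite lerDl sqr_ge0.
apply: (@le_trans _ _ (expR (2 * x - 8 * x ^+ 2))); first by rewrite ler_expR; lra.
have E := expRxMexpNx_1 (2 * x - 8 * x ^+ 2).
have h := expR_ge1Dx (- (2 * x - 8 * x ^+ 2)).
have p := expR_gt0 (2 * x - 8 * x ^+ 2).
move: (expR (2 * x - _)) (expR (- _)) E h p => A B E h p.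
have h2 : A * (1 + - (2 * x - 8 * x ^+ 2)) <= 1 by rewrite -[leRHS]E ler_wpM2l // ltW.
have h3 : 1 <= (1 + 2 * x) * (1 + - (2 * x - 8 * x ^+ 2)).
  have -> : (1 + 2 * x) * (1 + - (2 * x - 8 * x ^+ 2)) = 1 + 4 * (x ^+ 2 * (1 + 4 * x)) by ring.
  have : 0 <= x ^+ 2 * (1 + 4 * x) by rewrite mulr_ge0 ?sqr_ge0 //; lra.
  by lra.
have h4 : 0 < 1 + - (2 * x - 8 * x ^+ 2) by nra.
by rewrite -(ler_pM2r h4); apply: le_trans h3.
Qed.

Lemma nm1D_powE (S : C) n : nm (1 + (n.+1%:R^-1)%:C * S) ^+ n.+1 <=
  expR (complex.Re S + nm S ^+ 2 * n.+1%:R^-1).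
Proof.
have n0 : 0 < n.+1%:R :> RR by rewrite ltr0n.
apply: (@le_trans _ _ (expR (complex.Re ((n.+1%:R^-1)%:C * S) +
   nm ((n.+1%:R^-1)%:C * S) ^+ 2 / 2) ^+ n.+1)).
  by apply: lerXn2r; rewrite ?nnegrE ?nm_ge0 ?expR_ge0 ?nm1D_le.
rewrite expRX ler_expR ReM /= mul0r subr0 nmM nm_real ger0_norm ?invr_ge0 ?(ltW n0) //.
move: (n.+1%:R : RR) (complex.Re S) (nm S) n0 => N x y n0.
have -> : N * (N^-1 * x + (N^-1 * y) ^+ 2 / 2) = x + y ^+ 2 * N^-1 / 2 by field; rewrite gt_eqF.
have : 0 <= y ^+ 2 * N^-1 by rewrite mulr_ge0 ?sqr_ge0 // invr_ge0 ltW.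
lra.
Qed.

Lemma nm1D_powG (S : C) n : 4 * nm S <= n.+1%:R ->
  expR (complex.Re S - 4 * nm S ^+ 2 * n.+1%:R^-1) <= nm (1 + (n.+1%:R^-1)%:C * S) ^+ n.+1.
Proof.
have n0 : 0 < n.+1%:R :> RR by rewrite ltr0n.
move=> hS; have nS : nm ((n.+1%:R^-1)%:C * S) = n.+1%:R^-1 * nm S.
  by rewrite nmM nm_real ger0_norm ?invr_ge0 ?(ltW n0).
apply: (@le_trans _ _ (expR (complex.Re ((n.+1%:R^-1)%:C * S) -
   4 * nm ((n.+1%:R^-1)%:C * S) ^+ 2) ^+ n.+1)).
  rewrite expRX ler_expR nS ReM /= mul0r subr0.
  move: (n.+1%:R : RR) (complex.Re S) (nm S) n0 => N x y n0.
  by rewrite le_eqVlt; apply/orP; left; apply/eqP; field; rewrite gt_eqF.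
apply: lerXn2r; rewrite ?nnegrE ?nm_ge0 ?expR_ge0 ?nm1D_ge // nS.
by rewrite mulrC ler_pdivrMr //; lra.
Qed.

(** exp(s) is replaced by (1 + s/n)^n, which is built from s by finitely many products of series.
    [max_principle] applies for each n; the upper comparison with exp(Re s) is used on the circle,
    the lower one at q, and both errors vanish as n grows. *)
Lemma max_principle_exp f s (r M : RR) : tame f -> tame s -> 0 < r < 1 -> 0 <= M ->
  (forall q, nm q = r -> nm (pev f q) * expR (complex.Re (pev s q)) <= M) ->
  forall q, nm q < r -> nm (pev f q) * expR (complex.Re (pev s q)) <= M.
Proof.
move=> tf ts r01 M0 H q qr; have [r0 r1] := andP r01; have q1 := lt_trans qr r1.
have [B0 hB0] : exists B : RR, forall q, nm q <= r -> nm (pev s q) <= B.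
  by apply: pev_bounded => //; rewrite (ltW r0).
set X := nm _ * _; set S := pev s q.
pose g n := conv f (powc (fun j => (n.+1%:R^-1 : RR)%:C * s j + one_ser j) n.+1).
have tu n : tame (fun j => (n.+1%:R^-1 : RR)%:C * s j + one_ser j).
  exact: tameD (tameZ _ ts) tame_one_ser.
have tp n := tame_powc n.+1 (tu n).
have gE n w : nm w < 1 -> pev (g n) w = pev f w * (1 + (n.+1%:R^-1)%:C * pev s w) ^+ n.+1.
  move=> w1; rewrite /g (pevM tf (tp n) w1) (pev_powc _ (tu n) w1); congr (_ * _ ^+ _).
  by rewrite (pevD (tameZ _ ts) tame_one_ser w1) (pevZ _ ts w1) pev_one_ser // addrC.
have gb n w : nm w = r -> nm (pev (g n) w) <= M * expR (B0 ^+ 2 * n.+1%:R^-1).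
  move=> wr; have w1 : nm w < 1 by rewrite wr.
  have hw : nm (pev s w) <= B0 by apply: hB0; rewrite wr.
  have sw0 := nm_ge0 (pev s w).
  rewrite gE // nmM nmX.
  apply: (@le_trans _ _ (nm (pev f w) * expR (complex.Re (pev s w) + nm (pev s w) ^+ 2 * n.+1%:R^-1))).
    by apply: ler_wpM2l; [exact: nm_ge0|exact: nm1D_powE].
  rewrite expRD mulrA; apply: ler_pM.
  - by apply: mulr_ge0; rewrite ?nm_ge0 ?expR_ge0.
  - exact: expR_ge0.
  - exact: H.
  - rewrite ler_expR; apply: ler_wpM2r; first by rewrite invr_ge0.
    by apply: lerXn2r; rewrite ?nnegrE // (le_trans sw0).
have X0 : 0 <= X by rewrite mulr_ge0 ?nm_ge0 ?expR_ge0.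
apply: (@ler_eps _ _ (X * (B0 ^+ 2 + 4 * nm S ^+ 2))) => eps eps0.
have [n [n1 n2]] : exists n : nat, 4 * nm S <= n.+1%:R /\ n.+1%:R^-1 <= eps.
  exists (Num.Def.truncn (4 * nm S + eps^-1)).
  have h : 4 * nm S + eps^-1 < (Num.Def.truncn (4 * nm S + eps^-1)).+1%:R by exact: truncnS_gt.
  have s0 := nm_ge0 S; have e0 : 0 < eps^-1 by rewrite invr_gt0.
  split; first by apply: ltW; apply: le_lt_trans h; rewrite lerDl ltW.
  rewrite -[leRHS]invrK lef_pV2 ?posrE ?ltr0n //.
  by apply: ltW; apply: le_lt_trans h; rewrite lerDr mulr_ge0.
have n0 : 0 < n.+1%:R^-1 :> RR by rewrite invr_gt0 ltr0n.
have b : nm (pev (g n) q) <= M * expR (B0 ^+ 2 * n.+1%:R^-1).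
  apply: (@max_principle _ r) => //; first exact: tame_conv.
    by rewrite mulr_ge0 ?expR_ge0.
  exact: gb.
rewrite gE // nmM nmX in b.
have b2 : nm (pev f q) * expR (complex.Re S - 4 * nm S ^+ 2 * n.+1%:R^-1) <=
    M * expR (B0 ^+ 2 * n.+1%:R^-1).
  by apply: le_trans b; apply: ler_wpM2l; [exact: nm_ge0|exact: nm1D_powG].
rewrite expRD mulrA -/X in b2.
have b3 : X * expR (- ((B0 ^+ 2 + 4 * nm S ^+ 2) * n.+1%:R^-1)) <= M.
  rewrite -(ler_pM2r (expR_gt0 (B0 ^+ 2 * n.+1%:R^-1))) -mulrA -expRD.
  apply: le_trans b2; apply: ler_wpM2l => //; rewrite ler_expR.
  by rewrite le_eqVlt; apply/orP; left; apply/eqP; ring.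
have b4 := expR_ge1Dx (- ((B0 ^+ 2 + 4 * nm S ^+ 2) * n.+1%:R^-1)).
have L0 : 0 <= B0 ^+ 2 + 4 * nm S ^+ 2 by apply: addr_ge0; [exact: sqr_ge0|apply: mulr_ge0; rewrite ?sqr_ge0].
have b5 : X * (1 + - ((B0 ^+ 2 + 4 * nm S ^+ 2) * n.+1%:R^-1)) <= M.
  by apply: le_trans b3; exact: ler_wpM2l.
have b6 : X * (B0 ^+ 2 + 4 * nm S ^+ 2) * n.+1%:R^-1 <= X * (B0 ^+ 2 + 4 * nm S ^+ 2) * eps.
  by apply: ler_wpM2l; [exact: mulr_ge0|exact: n2].
rewrite mulrDr mulr1 mulrN mulrA in b5.
by rewrite -lerBlDr; apply: le_trans b5; rewrite lerD2l lerN2.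
Qed.

(** * The Sturm bound *)

Lemma V_E (z : C) : V z = - (2 * (pi * complex.Im z)) - 24 * complex.Re (pev lam (e z))
  + 6 * ln (complex.Im z).
Proof.
have t1 : complex.Re (tpi * z) = - (2 * (pi * complex.Im z)).
  by rewrite /tpi !ReM !ImM /=; ring.
have t2 : complex.Re (Lam z) = - (2 * (pi * complex.Im z)) - 24 * complex.Re (pev lam (e z)).
  rewrite /Lam; move: (pev lam (e z)) => X.
  by rewrite ReD ReN t1 ReM Re_nat Im_nat mul0r subr0.
exact (congr1 (fun t => t + 6 * ln (complex.Im z)) t2).
Qed.

Lemma V5_inv (a b c d : int) (z : C) : a * d - b * c = 1 -> (5 %| c)%Z -> 0 < complex.Im z ->
  V (5 * mobius a b c d z) = V (5 * z).
Proof.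
move=> det /dvd5_split[c' cE] Iz; rewrite cE in det *; rewrite mobius5; apply: V_inv.
  by rewrite -[RHS]det; ring.
by rewrite Im_mul5 mulr_gt0.
Qed.

(* Conversion must not compare the arguments of [V] by unfolding it. *)
Opaque V Lam.

Lemma pev_shiftn c k q : tame c -> nm q < 1 -> (forall n, (n < k)%N -> c n = 0) ->
  tame (fun n => c (n + k)%N) /\ pev c q = q ^+ k * pev (fun n => c (n + k)%N) q.
Proof.
move=> tc q1; elim: k => [|k IH] c0.
  by under [fun n => c (n + 0)%N]funext do rewrite addn0; rewrite expr0 mul1r.
have [n nk|t ->] := IH; first by rewrite c0 // ltnW.
have E : (fun n => c (n.+1 + k)%N) = (fun n => c (n + k.+1)%N).
  by apply/funext => n; rewrite addSnnS.
rewrite -E; split; first exact: tame_shift t.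
by rewrite (pev_shift t q1) add0n c0 // add0r mulrA exprSr.
Qed.

Section Sturm.
Variables (m : nat) (a : fps int).
Hypotheses (ha : MF (4 * m) a) (a0 : forall n, (n < (2 * m).+1)%N -> a n = 0).

(* With these exponents [h] below equals [|q| ^ (1/2)] at infinity and [|q| ^ (1/10)] at 0, up to
   bounded factors. *)
Let al : RR := (10 * m%:R + 3) / 24.
Let be : RR := (2 * m%:R + 3) / 24.

Let al0 : 0 <= al. Proof. by rewrite divr_ge0 // addr_ge0 // mulr_ge0. Qed.
Let be0 : 0 <= be. Proof. by rewrite divr_ge0 // addr_ge0 // mulr_ge0. Qed.

Let h (z : C) : RR :=
  nm (ev a z) * complex.Im z ^+ (2 * m) * expR (be * V z - al * V (5 * z)).

Let h_ge0 z : 0 < complex.Im z -> 0 <= h z.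
Proof. by move=> Iz; rewrite !mulr_ge0 ?nm_ge0 ?expR_ge0 ?exprn_ge0 // ltW. Qed.

Let h_inv (p q r s : int) (z : C) : p * s - q * r = 1 -> (5 %| r)%Z -> 0 < complex.Im z ->
  h (mobius p q r s z) = h z.
Proof.
move=> det r5 Iz; have [_ [inv _]] := ha.
have j0 := jfac_neq0 det Iz; have jp : 0 < nm (jfac r s z) by rewrite nm_gt0.
rewrite /h (V_inv det Iz) (V5_inv det r5 Iz); congr (_ * _).
rewrite (inv _ _ _ _ det r5 _ Iz) (Im_mobius det Iz) nmM nmX expr_div_n -exprM.
have -> : (2 * (2 * m) = 4 * m)%N by lia.
have jn : nm (jfac r s z) ^+ (4 * m) != 0 by rewrite expf_neq0 // gt_eqF.
move: (nm (jfac r s z) ^+ (4 * m)) (nm (ev a z)) (complex.Im z ^+ (2 * m)) jn => x y t x0.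
by field.
Qed.

(** Let g in SL_2(Z) raise z to height at least 1/2. Either g lies in Gamma_0(5), or S T^j g does
    for a suitable j. As j matters only modulo 5, a multiple of 5 brings the real part of w = g z +
    j into [-5/2, 5/2]. *)
Let coset_reps (z : C) : 0 < complex.Im z ->
  (exists z' : C, 2^-1 <= complex.Im z' /\ h z = h z') \/
  (exists w : C, [/\ 2^-1 <= complex.Im w, `|complex.Re w| <= 5 / 2 & h z = h (- w^-1)]).
Proof.
move=> Iz; have [p [q [r [s [det H]]]]] := reduction Iz.
have [r5|r5] := boolP (5 %| r)%Z.
  by left; exists (mobius p q r s z); split; rewrite ?h_inv.
have [j0 [d' hj0]] := ndvd5_solve (- p) r5.
have [n hn] := round_int ((complex.Re (mobius p q r s z) + j0%:~R) / 5).
pose j := j0 - 5 * n; right; exists (mobius p q r s z + j%:~R); split.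
- by rewrite Im_add_int.
- rewrite ReD Re_int /j rmorphB rmorphM /=.
  move: (complex.Re _) (j0%:~R : RR) (n%:~R : RR) hn => x y t.
  by rewrite !ler_norml; lra.
have det' : - r * (q + s * j) - - s * (p + r * j) = 1 by rewrite -[RHS]det; ring.
have dv : (5 %| p + r * j)%Z.
  apply/dvdzP; exists (- d' - r * n).
  have -> : p + r * j = - (- p - r * j0) - 5 * n * r by rewrite /j; ring.
  by rewrite hj0; ring.
rewrite -(h_inv det' dv Iz); congr (h _); clear det' dv; clearbody j.
have D0 := jfac_neq0 det Iz; rewrite /jfac in D0.
have E : mobius p q r s z + j%:~R = ((p + r * j)%:~R * z + (q + s * j)%:~R) / (r%:~R * z + s%:~R).
  rewrite /mobius !intrD !intrM.
  by move: (p%:~R : C) (q%:~R : C) (r%:~R : C) (s%:~R : C) (j%:~R : C) D0 => P Q R S J D0; field.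
rewrite E invf_div /mobius !rmorphN /= -mulNr; congr (_ / _); ring.
Qed.

Let f1 (n : nat) : C := toC a (n + (2 * m).+1)%N.
Let psi (n : nat) : C := (24 * al)%:C * dil 5 lam n + (- (24 * be))%:C * lam n.
(** The factor of [h] that makes sense on the whole disc, q = 0 included (see [h_eq]); it has the
    shape treated by [max_principle_exp]. *)
Let K (q : C) : RR := nm (pev f1 q) * expR (complex.Re (pev psi q)).
Let c0 : RR := expR (- (6 * al * ln 5)).

Let tame_psi : tame psi.
Proof. exact: tameD (tameZ _ (tame_dil (isT : (0 < 5)%N) tame_lam)) (tameZ _ tame_lam). Qed.

Let f1P q : nm q < 1 -> tame f1 /\ pev (toC a) q = q ^+ (2 * m).+1 * pev f1 q.
Proof.
move=> q1; have [ta _] := ha.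
by apply: (pev_shiftn (c := toC a) ta q1) => n hn; rewrite /toC a0.
Qed.

Let tame_f1 : tame f1. Proof. by have [] := f1P (_ : nm 0 < 1); rewrite ?nm0. Qed.

(** The powers of y cancel because al - be = m/3. Under this constraint the exponents of |q| are m/3
    + 1 - 4 be at infinity and 4 be/5 - m/15 at 0. Both are positive for be strictly between m/12
    and m/12 + 1/4, and [be] is the midpoint. With vanishing order 2m only, this interval would be
    empty. *)
Let h_eq_aux (F X X5 y v v5 : RR) : 0 < y -> v = - (2 * (pi * y)) - 24 * X + 6 * ln y ->
  v5 = - (2 * (pi * (5 * y))) - 24 * X5 + 6 * ln (5 * y) ->
  expR (- (2 * pi * y)) ^+ (2 * m).+1 * F * y ^+ (2 * m) * expR (be * v - al * v5) =
  c0 * expR (- (pi * y)) * (F * expR (24 * al * X5 - 24 * be * X)).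
Proof.
move=> y0 -> ->; rewrite lnM ?posrE //.
have -> : y ^+ (2 * m) = expR ((2 * m)%:R * ln y) by rewrite expRM_natl lnK // posrE.
rewrite expRX; move: (ln y) => L; rewrite /c0.
set A := expR _; set B := expR _; set D := expR _; set A' := expR _; set B' := expR _; set D' := expR _.
suff E : A * B * D = A' * B' * D'.
  move: E; clearbody A B D A' B' D' => E; transitivity (A * B * D * F); first by ring.
  by rewrite E; ring.
rewrite /A /B /D /A' /B' /D' -!expRD; congr expR; rewrite /al /be.
have -> : ((2 * m).+1%:R : RR) = 2 * m%:R + 1 by rewrite -natr1 natrM.
by rewrite natrM; move: (pi : RR) (ln 5 : RR) (m%:R : RR) => p l M; field.
Qed.

Let h_eq (z : C) : 0 < complex.Im z ->
  h z = c0 * expR (- (pi * complex.Im z)) * K (e z).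
Proof.
move=> Iz; have q1 := nm_e_lt1 Iz; have [tf fE] := f1P q1.
have e5 : e (5 * z) = e z ^+ 5 by rewrite -e_mulrn mulr_natl.
have rp : complex.Re (pev psi (e z)) =
    24 * al * complex.Re (pev lam (e (5 * z))) - 24 * be * complex.Re (pev lam (e z)).
  have ts := tame_dil (isT : (0 < 5)%N) tame_lam.
  rewrite /psi (pevD (tameZ _ ts) (tameZ _ tame_lam) q1) (pevZ _ ts q1) (pevZ _ tame_lam q1).
  rewrite (pev_dil (isT : (0 < 5)%N) tame_lam q1) -e5.
  move: (pev lam _) (pev lam _) => X Y.
  by rewrite ReD !ReM /= !mul0r !subr0 mulNr.
have V5 := V_E (5 * z); rewrite Im_mul5 in V5.
rewrite /h /K /ev fE rp nmM nmX nm_e.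
exact: h_eq_aux Iz (V_E z) V5.
Qed.

Let h_cusp_aux (X X5 y B v v5 : RR) : 0 < y -> v = - (2 * (pi * y)) - 24 * X + 6 * ln y ->
  v5 = - (2 * (pi * (y / 5))) - 24 * X5 + 6 * ln (y / 5) -> `|X| <= B -> `|X5| <= B ->
  y ^+ (2 * m) * expR (be * v - al * v5) <=
  expR (6 * al * ln 5 + 24 * (al + be) * B) * expR (- (pi * y / 5)).
Proof.
move=> y0 -> -> ; rewrite !ler_norml => /andP[x1 x2] /andP[x3 x4].
rewrite ln_div ?posrE //.
have -> : y ^+ (2 * m) = expR ((2 * m)%:R * ln y) by rewrite expRM_natl lnK // posrE.
rewrite -!expRD ler_expR natrM.
have g1 : 0 <= al * (B - X5) by apply: mulr_ge0 => //; lra.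
have g2 : 0 <= be * (B + X) by apply: mulr_ge0 => //; lra.
have E : 6 * al * ln 5 + 24 * (al + be) * B + - (pi * y / 5) =
    (2%:R * m%:R * ln y + (be * (- (2 * (pi * y)) - 24 * X + 6 * ln y) -
    al * (- (2 * (pi * (y / 5))) - 24 * X5 + 6 * (ln y - ln 5)))) +
    (24 * (al * (B - X5)) + 24 * (be * (B + X))).
  rewrite /al /be.
  by move: (ln y) (pi : RR) (ln 5 : RR) (m%:R : RR) => L p l M; field.
by rewrite E lerDl addr_ge0 // mulr_ge0.
Qed.

(** The growth condition for the matrix of w -> -1/w bounds f(-1/w) by M |w|^(4m), and 5 (-1/w) =
    -1/(w/5) turns [V] at 5 (-1/w) into [V] at w/5. *)
Let h_cusp : exists M Y : RR, [/\ 0 <= M, 1 <= Y & forall w : C, Y < complex.Im w ->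
  h (- w^-1) <= M * expR (- (pi * complex.Im w / 5))].
Proof.
have [_ [_ cu]] := ha.
have [M [Y [M0 Y0 H]]] := cusp_pos (cu 0 (-1) 1 0 erefl).
have p5 : 0 < 5^-1 :> RR by rewrite invr_gt0.
have [B hB] := pev_bounded tame_lam (expR_2piN_lt1 p5).
exists (M * expR (6 * al * ln 5 + 24 * (al + be) * B)), (Num.max 1 Y); split.
- by rewrite mulr_ge0 ?expR_ge0.
- by rewrite le_max lexx.
move=> w; rewrite gt_max => /andP[w1 wY].
have Iw : 0 < complex.Im w by apply: lt_trans w1.
have Iw5 : 0 < complex.Im (w / 5) by rewrite Im_div5 divr_gt0.
have w0 := z_neq0 Iw; have wp := nmz_gt0 Iw.
have mS : mobius 0 (-1) 1 0 w = - w^-1.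
  by rewrite /mobius mul0r add0r mul1r addr0 mulN1r.
have jS : jfac 1 0 w = w by rewrite /jfac mul1r addr0.
have := H w wY; rewrite mS jS => Hf.
have S5 : 5 * - w^-1 = - (w / 5)^-1 by field.
have i5 : 5^-1 <= complex.Im (w / 5) by rewrite Im_div5 -[leLHS]mul1r ler_pM2r // ltW.
have i1 : 5^-1 <= complex.Im w by apply: ltW; apply: le_lt_trans w1; rewrite invf_le1 ?ler1n.
have hB1 : nm (pev lam (e w)) <= B := hB _ (Im_lt_nm_e i1).
have hB2 : nm (pev lam (e (w / 5))) <= B := hB _ (Im_lt_nm_e i5).
have hE : h (- w^-1) = nm (ev a (- w^-1)) * complex.Im (- w^-1) ^+ (2 * m) *
    expR (be * V w - al * V (w / 5)).
  exact (congr2 (fun s t => nm (ev a (- w^-1)) * complex.Im (- w^-1) ^+ (2 * m) *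
    expR (be * s - al * t)) (V_S Iw) (etrans (congr1 V S5) (V_S Iw5))).
have V5 := V_E (w / 5); rewrite Im_div5 in V5.
have b2 := h_cusp_aux Iw (V_E w) V5 (le_trans (nm_Re _) hB1) (le_trans (nm_Re _) hB2).
have Iy : complex.Im (- w^-1) ^+ (2 * m) = complex.Im w ^+ (2 * m) / nm w ^+ (4 * m).
  have e4 : (2 * (2 * m) = 4 * m)%N by rewrite mulnA.
  rewrite ImN ImV mulNr opprK; move: (complex.Im w) (nm w) => x u.
  by rewrite expr_div_n -exprM e4.
have np : 0 < nm w ^+ (4 * m) by rewrite exprn_gt0.
rewrite hE Iy; have t0 := expR_ge0 (be * V w - al * V (w / 5)).
move: (expR (be * V w - al * V (w / 5))) t0 b2 => t t0 b2.
have b1 : nm (ev a (- w^-1)) / nm w ^+ (4 * m) <= M by rewrite ler_pdivrMr.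
have nn : 0 <= complex.Im w ^+ (2 * m) * t by rewrite mulr_ge0 // exprn_ge0 // ltW.
rewrite -[leRHS]mulrA; apply: le_trans (ler_wpM2l M0 b2).
have -> : nm (ev a (- w^-1)) * (complex.Im w ^+ (2 * m) / nm w ^+ (4 * m)) * t =
   nm (ev a (- w^-1)) / nm w ^+ (4 * m) * (complex.Im w ^+ (2 * m) * t).
  by move: (nm _) (complex.Im w ^+ _) (nm w ^+ _)^-1 => x y u; ring.
exact: ler_wpM2r.
Qed.

Let K_ge0 q : 0 <= K q. Proof. by rewrite /K mulr_ge0 ?nm_ge0 ?expR_ge0. Qed.

Let c0_gt0 : 0 < c0. Proof. exact: expR_gt0. Qed.

Let K_bounded (r : RR) : 0 <= r < 1 -> exists2 B : RR, 0 <= B & forall q, nm q <= r -> K q <= B.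
Proof.
move=> r01; have [B1 h1] := pev_bounded tame_f1 r01; have [B2 h2] := pev_bounded tame_psi r01.
have B10 : 0 <= B1 by apply: le_trans (nm_ge0 _) (h1 0 _); rewrite nm0; have /andP[] := r01.
exists (B1 * expR B2) => [|q qr]; first by rewrite mulr_ge0 ?expR_ge0.
apply: ler_pM; [exact: nm_ge0|exact: expR_ge0|exact: h1|rewrite ler_expR].
apply: le_trans (h2 q qr); apply: le_trans (nm_Re _); exact: ler_norm.
Qed.

Let h_low_bounded (eps : RR) : 0 < eps ->
  exists2 B : RR, 0 <= B & forall z : C, eps <= complex.Im z -> h z <= B.
Proof.
move=> eps0; have [B B0 hB] := K_bounded (expR_2piN_lt1 eps0).
exists (c0 * B) => [|z hz]; first by rewrite mulr_ge0 // ltW.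
have Iz : 0 < complex.Im z by apply: lt_le_trans hz.
rewrite (h_eq Iz) -mulrA; apply: ler_wpM2l; first exact: ltW.
rewrite -[B]mul1r; apply: ler_pM; [exact: expR_ge0|exact: K_ge0| |exact: hB (Im_lt_nm_e hz)].
by rewrite -expR0 ler_expR oppr_le0 mulr_ge0 ?pi_ge0 // ltW.
Qed.

Let h_split (Y : RR) : 1 <= Y -> exists2 eps : RR, 0 < eps & forall z : C, 0 < complex.Im z ->
  (exists z' : C, eps <= complex.Im z' /\ h z = h z') \/
  (exists w : C, Y < complex.Im w /\ h z = h (- w^-1)).
Proof.
move=> Y1; pose D : RR := 25 / 4 + Y ^+ 2.
have D1 : 1 <= D by rewrite /D; nra.
have D0 : 0 < D by apply: lt_le_trans D1.
(* Im(-1/w) = Im w/|w|^2 with Im w >= 1/2 and |w|^2 <= (5/2)^2 + Y^2 = D. *)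
exists (2^-1 / D) => [|z Iz]; first by rewrite divr_gt0.
have [[z' [h1 h2]]|[w [h1 h2 h3]]] := coset_reps Iz.
  left; exists z'; split => //; apply: le_trans h1.
  by rewrite ler_pdivrMr // ler_peMr.
have [wY|wY] := ltP Y (complex.Im w); [right; exists w; split => //|left; exists (- w^-1); split => //].
have Iw : 0 < complex.Im w by apply: lt_le_trans h1; rewrite invr_gt0.
have nw : 0 < nm w ^+ 2 by rewrite exprn_gt0 // nmz_gt0.
have nD : nm w ^+ 2 <= D.
  rewrite nm_sqr /D; apply: lerD.
    rewrite -real_normK ?num_real // (_ : 25 / 4 = (5 / 2) ^+ 2); last by field.
    by apply: lerXn2r; rewrite ?nnegrE ?normr_ge0.
  by apply: lerXn2r => //; rewrite nnegrE ltW // (lt_le_trans Iw).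
rewrite ImN ImV mulNr opprK; apply: ler_pM => //; rewrite ?invr_ge0 ?(ltW D0) //.
by rewrite lef_pV2 ?posrE.
Qed.

Let h_bounded : exists2 B : RR, 0 <= B & forall z : C, 0 < complex.Im z -> h z <= B.
Proof.
have [M [Y [M0 Y1 hc]]] := h_cusp; have [eps eps0 hs] := h_split Y1.
have [B B0 hB] := h_low_bounded eps0; exists (B + M) => [|z Iz]; first exact: addr_ge0.
have [[z' [h1 ->]]|[w [h1 ->]]] := hs z Iz.
  by apply: le_trans (hB _ h1) _; rewrite lerDl.
apply: le_trans (hc _ h1) _; apply: ler_wpDl => //.
rewrite -[leRHS]mulr1; apply: ler_wpM2l => //; rewrite -expR0 ler_expR oppr_le0.
by rewrite divr_ge0 // mulr_ge0 ?pi_ge0 // ltW // (lt_trans _ h1) // (lt_le_trans _ Y1).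
Qed.

(** At height eps/2 the factor |q|^(1/2) of [h] equals u, so [K] is at most S/(c0 u) on that circle
    and, by the maximum principle, inside it. At height eps or more |q|^(1/2) is at most u^2, which
    leaves a gain of u. *)
Let h_contract (S eps : RR) : 0 <= S -> 0 < eps -> (forall z : C, 0 < complex.Im z -> h z <= S) ->
  forall z : C, eps <= complex.Im z -> h z <= expR (- (pi * (eps / 2))) * S.
Proof.
move=> S0 eps0 hS z hz; have Iz : 0 < complex.Im z by apply: lt_le_trans hz.
have d0 : 0 < eps / 2 by rewrite divr_gt0.
set r := expR (- (2 * pi * (eps / 2))).
have r01 : 0 < r < 1 by rewrite expR_gt0; have /andP[] := expR_2piN_lt1 d0.
set u := expR (- (pi * (eps / 2))); have u0 : 0 < u := expR_gt0 _.
have cu : 0 < c0 * u := mulr_gt0 c0_gt0 u0.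
have M0 : 0 <= S / (c0 * u) by rewrite divr_ge0 // ltW.
have circ q : nm q = r -> K q <= S / (c0 * u).
  move=> qr; have q0 : q != 0 by rewrite -nm_gt0 qr; have /andP[] := r01.
  have [z' ze] := e_surj q0.
  have Iz' : complex.Im z' = eps / 2.
    move: qr; rewrite -ze nm_e => /expR_inj /oppr_inj /mulfI; apply.
    by rewrite gt_eqF // mulr_gt0 ?pi_gt0.
  have Ip : 0 < complex.Im z' by rewrite Iz'.
  rewrite ler_pdivlMr // mulrC -ze; apply: le_trans (hS z' Ip).
  by rewrite (h_eq Ip) Iz'.
have qr : nm (e z) < r.
  apply: le_lt_trans (Im_lt_nm_e hz) _; rewrite ltr_expR ltrN2 ltr_pM2l; first by lra.
  by rewrite mulr_gt0 ?pi_gt0.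
have := max_principle_exp tame_f1 tame_psi r01 M0 circ qr; rewrite -/(K (e z)) => Kz.
rewrite (h_eq Iz); have v0 := expR_ge0 (- (pi * complex.Im z)).
apply: (@le_trans _ _ (c0 * (u * u) * (S / (c0 * u)))).
  apply: ler_pM => //; first by rewrite mulr_ge0 // ltW.
  apply: ler_wpM2l; first exact: ltW.
  rewrite /u -expRD ler_expR -opprD lerN2 -mulrDr -splitr.
  by apply: ler_wpM2l; rewrite ?pi_ge0.
rewrite le_eqVlt; apply/orP; left; apply/eqP.
by clearbody u; field; rewrite !gt_eqF.
Qed.

(** On both regions of [h_split] the bound sup h improves by a factor th < 1. Hence sup h <= th sup
    h, which forces the supremum to be 0 without locating a maximum. *)
Let h_eq0 (z : C) : 0 < complex.Im z -> h z = 0.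
Proof.
have [B B0 hB] := h_bounded; pose E := [set h z | z in [set z : C | 0 < complex.Im z]]%classic.
have iE : E (h 'i%C) by exists 'i%C => //=; exact: ltr01.
have supE : has_sup E.
  by split; [exists (h 'i%C)|exists B => _ [w Iw <-]; exact: hB].
have hS (w : C) : 0 < complex.Im w -> h w <= sup E.
  by move=> Iw; apply: ub_le_sup; [exact: supE.2|exists w].
have Ii : 0 < complex.Im ('i%C : C) := @ltr01 RR.
have S0 : 0 <= sup E := le_trans (h_ge0 Ii) (hS _ Ii).
suff S00 : sup E <= 0.
  by move=> Iz; apply: le_anti; rewrite h_ge0 // andbT (le_trans (hS _ Iz)).
rewrite leNgt; apply/negP => Sp.
have [M [Y [M0 Y1 hc]]] := h_cusp.
(* Above height Y + 5 M/sup E the cusp bound M exp(-pi y/5) is at most half of sup E, by pi >= 2 and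
   exp x >= 1 + x. *)
have Y1' : 1 <= Y + 5 * M / sup E by rewrite ler_wpDr // divr_ge0 // mulr_ge0.
have [eps eps0 hs] := h_split Y1'.
pose th := Num.max (expR (- (pi * (eps / 2)))) 2^-1.
have th1 : th < 1.
  rewrite gt_max; apply/andP; split.
    by rewrite -[ltRHS]expR0 ltr_expR oppr_lt0 mulr_gt0 ?pi_gt0 ?divr_gt0.
  by rewrite invf_lt1 ?ltr1n.
have : sup E <= th * sup E.
  apply: ge_sup; first by exists (h 'i%C).
  move=> _ [w Iw <-]; have [[w' [h1 ->]]|[w' [h1 ->]]] := hs w Iw.
    apply: le_trans (h_contract S0 eps0 hS h1) _.
    by apply: ler_wpM2r => //; rewrite le_max lexx.
  apply: (@le_trans _ _ (2^-1 * sup E)); last by apply: ler_wpM2r; rewrite // le_max lexx orbT.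
  have t0 : 0 <= 5 * M / sup E by rewrite divr_ge0 // mulr_ge0.
  have hY : Y < complex.Im w' by apply: le_lt_trans h1; rewrite lerDl.
  apply: le_trans (hc _ hY) _.
  have x1 : 2 * M / sup E <= pi * complex.Im w' / 5.
    have p2 := @pi_ge2 RR; rewrite ler_pdivlMr // .
    have h2 : 5 * M / sup E <= complex.Im w'.
      by apply: le_trans (ltW h1); rewrite lerDr (le_trans _ Y1).
    rewrite (_ : 2 * M / sup E * 5 = 2 * (5 * M / sup E)); last by ring.
    by apply: ler_pM.
  set x := pi * _ / 5; rewrite -/x in x1.
  have e1 := expR_ge1Dx x; have e2 := expRxMexpNx_1 x; have e3 := expR_gt0 (- x).
  have x2 : 2 * M <= x * sup E by rewrite -ler_pdivrMr.
  have x3 : M <= 2^-1 * sup E * (1 + x) by lra.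
  rewrite -(ler_pM2r (expR_gt0 x)) -mulrA [expR (- x) * _]mulrC e2 mulr1.
  apply: le_trans x3 _; apply: ler_wpM2l => //.
  by rewrite mulr_ge0 // invr_ge0.
rewrite -[leLHS]mul1r ler_pM2r // => h1.
by have := le_lt_trans h1 th1; rewrite ltxx.
Qed.

Theorem sturm : a = 0.
Proof.
have f1q q : q != 0 -> nm q < 1 -> nm (pev f1 q) <= 0.
  move=> q0 q1; have [z ze] := e_surj q0.
  have Iz : 0 < complex.Im z.
    move: q1; rewrite -ze nm_e -expR0 ltr_expR oppr_lt0 pmulr_rgt0 // mulr_gt0 ?pi_gt0 //.
  have := h_eq0 Iz; rewrite (h_eq Iz) => /eqP; rewrite !mulf_eq0 !(gt_eqF (expR_gt0 _)) ze /=.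
  by rewrite orbF => /eqP ->.
have f10 j : f1 j = 0.
  have r01 : 0 < (2^-1 : RR) < 1 by rewrite invr_gt0 ltr0n invf_lt1 ?ltr1n.
  (* Cauchy's estimate with M = 0; the circle of radius 1/2 avoids q = 0, which is not a value of
     [e]. *)
  have := coef_bound tame_f1 r01 (M := 0) _ j.
  move=> /(_ _)/wrap[q qr|].
    by apply: f1q; [rewrite -nm_gt0 qr; have /andP[] := r01|rewrite qr; have /andP[] := r01].
  rewrite pmulr_lle0 ?exprn_gt0 ?invr_gt0 // => h0.
  by apply: nm_eq0; apply: le_anti; rewrite h0 nm_ge0.
apply: fps_ext => n; rewrite fps0.
have [nm1|nm1] := ltnP n (2 * m).+1; first exact: a0.
have := f10 (n - (2 * m).+1)%N; rewrite /f1 subnK // /toC => /eqP.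
by rewrite intr_eq0 => /eqP.
Qed.

End Sturm.

(** * Forms with integral expansions in weights 2, 4 and 12 *)

(** z minus its complex conjugate, so that z - [zbd z] is the conjugate of z. *)
Definition zbd (z : C) : C := (2 * complex.Im z)%:C * 'i.

Lemma zbd_mul z : (nm z ^+ 2)%:C = z * (z - zbd z).
Proof.
rewrite nm_sqr; case: z => a b; apply: cplxP; rewrite /zbd /=; ring.
Qed.

Lemma zbd_neq0 (z : C) : 0 < complex.Im z -> zbd z != 0.
Proof.
move=> Iz; rewrite -nm_gt0 nmM nmi mulr1 nm_real normr_gt0 gt_eqF // mulr_gt0 //.
Qed.

Lemma zbd_S (z : C) : z != 0 -> zbd (- z^-1) = zbd z / (z * (z - zbd z)).
Proof.
move=> z0; rewrite -zbd_mul /zbd ImN ImV mulNr opprK -fmorphV mulrAC -rmorphM.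
by rewrite mulrA.
Qed.

(** Hecke's non-holomorphic form E2 - 3/(pi y). *)
Definition E2star (z : C) : C := E2 z + 12 / (tpi * zbd z).

Lemma E2_T z : E2 (z + 1) = E2 z.
Proof. by rewrite /E2 eD e1 mulr1. Qed.

Lemma E2star_T z : E2star (z + 1) = E2star z.
Proof.
rewrite /E2star E2_T /zbd ImD (_ : complex.Im 1 = 0) ?addr0 //.
Qed.

Lemma E2star_S (z : C) : 0 < complex.Im z -> E2star (- z^-1) = z ^+ 2 * E2star z.
Proof.
move=> Iz; have z0 := z_neq0 Iz; have t0 := tpi_neq0; have d0 := zbd_neq0 Iz.
have n0 : z * (z - zbd z) != 0.
  rewrite -zbd_mul -nm_gt0 nm_real normr_gt0 expf_neq0 // gt_eqF // nm_gt0 //.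
have zd0 : z - zbd z != 0 by move: n0; rewrite mulf_eq0 negb_or => /andP[].
rewrite /E2star E2_S // zbd_S //; move: (zbd z) d0 n0 zd0 => D d0 n0 zd0.
by field; rewrite z0 t0 d0 zd0.
Qed.

Lemma E2star_inv : SL2_inv 2 E2star.
Proof. exact: (SL2_gen (k := 2) isT E2star_T E2star_S). Qed.

Lemma E2star_bounded : exists B : RR, forall z : C, 1 < complex.Im z -> nm (E2star z) <= B.
Proof.
have [B hB] := ev_bounded tm_E2s (@ltr01 RR).
exists (B + 12) => z Iz; apply: (le_trans (nmD _ _)); apply: lerD.
  by rewrite -ev_E2s ?hB // ?(ltW Iz) //; apply: lt_trans Iz.
rewrite nm_div nm_nat ler_pdivrMr; last first.
  by rewrite nm_gt0 mulf_neq0 ?tpi_neq0 // zbd_neq0 //; apply: lt_trans Iz.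
rewrite ler_peMr // nmM nm_tpi /zbd nmM nmi mulr1 nm_real.
rewrite gtr0_norm; last by rewrite mulr_gt0 //; apply: lt_trans Iz.
have := pi_ge2 RR; nra.
Qed.

(** The weight 2 form (5 E2(5z) - E2(z))/4. Its non-holomorphic parts cancel, because [zbd] at 5z is
    5 times [zbd] at z. *)
Definition Es : fps int := 1 + 6 * sgs - 30 * dil 5 sgs.

Lemma tm_S5 : tm (dil 5 sgs). Proof. exact: tm_dil tm_sgs. Qed.

Lemma tm_Es : tm Es.
Proof. exact: tmB (tmD tm1 (tmM (tm_nat 6) tm_sgs)) (tmM (tm_nat 30) tm_S5). Qed.

Lemma Es4 : 4 * Es = 5 * dil 5 E2s - E2s.
Proof. by rewrite /Es /E2s dilD dilN dilM // dil1 dil_nat; ring. Qed.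

Lemma MF_Es : MF 2 Es.
Proof.
split; first exact: tm_Es.
have w1 := wm_level1 E2star_inv E2star_bounded.
have w5 := wm_level1_5 E2star_inv E2star_bounded.
apply: wm_ext (wmZ 4^-1 (wmD (wmZ 5 w5) (wmZ (-1) w1))) => z Iz.
have I5 : 0 < complex.Im (5 * z) by rewrite Im_mul5 mulr_gt0.
have four0 : (4 : C) != 0 by rewrite pnatr_eq0.
have -> : ev Es z = 4^-1 * ev (4 * Es) z by rewrite (ev_natM Iz 4 tm_Es) mulKf.
have t5 := tm_dil (isT : (0 < 5)%N) tm_E2s.
rewrite Es4 evB ?ev_natM ?ev_dil ?ev_E2s //; try exact: tm_E2s; last exact: tmM (tm_nat 5) t5.
rewrite /E2star; have -> : zbd (5 * z) = 5 * zbd z.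
  by rewrite /zbd Im_mul5 mulrCA rmorphM rmorph_nat mulrA.
have d0 := zbd_neq0 Iz; have t0 := tpi_neq0.
by move: (zbd z) (E2 _) (E2 _) d0 => D X Y d0; field; rewrite d0 t0.
Qed.

(** Chosen so that E4 = 1 + 48 us; likewise E6 = 1 + 72 vs and Es = 1 + 6 As. Written out in S and
    its derivatives, they make the divisions by 48, 12 and 1728 below exact identities of integral
    series. *)
Definition us : fps int := - sgs + 12 * sgs ^+ 2 + 6 * theta sgs.
Definition vs : fps int :=
  - sgs + 6 * theta sgs - 12 * theta (theta sgs) + 24 * sgs ^+ 2 - 144 * (sgs * theta sgs) - 192 * sgs ^+ 3.
Definition As : fps int := sgs - 5 * dil 5 sgs.
Definition B1s : fps int := us - dil 5 us.
Definition C1s : fps int := As + 3 * As ^+ 2 + 4 * sgs - 48 * sgs ^+ 2 - 24 * theta sgs.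
(** C1s = (Es^2 - E4)/12 starts with -19 x and B1s = (E4 - E4(5z))/48 with 5 x, so this combination
    starts at x^2. *)
Definition B2s : fps int := 5 * C1s + 19 * B1s.
Definition Dels : fps int :=
  theta (theta sgs) - sgs ^+ 2 + 12 * (sgs * theta sgs) + 16 * sgs ^+ 3 + 4 * us ^+ 2 + 64 * us ^+ 3 - 3 * vs ^+ 2.

Lemma theta_natM (k : nat) (f : fps int) : theta (k%:R * f) = k%:R * theta f.
Proof. by rewrite thetaM theta_nat mul0r add0r. Qed.

Lemma theta_X2 (f : fps int) : theta (f ^+ 2) = 2 * (f * theta f).
Proof. by rewrite expr2 thetaM; ring. Qed.

Lemma theta_E2s : theta E2s = - (24 * theta sgs).
Proof. by rewrite /E2s thetaD thetaN theta_natM (theta_nat _ 1) add0r. Qed.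

Lemma E4s_us : E4s = 1 + 48 * us.
Proof. by rewrite /E4s theta_E2s /E2s /us; ring. Qed.

Lemma theta_us : theta us = - theta sgs + 24 * (sgs * theta sgs) + 6 * theta (theta sgs).
Proof. by rewrite /us !thetaD thetaN !theta_natM theta_X2; ring. Qed.

Lemma E6s_vs : E6s = 1 + 72 * vs.
Proof.
rewrite /E6s E4s_us thetaD (theta_nat _ 1) theta_natM theta_us /E2s /us /vs; ring.
Qed.

Lemma Dels_eq : 1728 * Dels = E4s ^+ 3 - E6s ^+ 2.
Proof. rewrite E4s_us E6s_vs /Dels /us /vs; ring. Qed.

Lemma MF_E4s : MF 4 E4s /\ MF 4 (dil 5 E4s).
Proof. exact: (MF_level1 (k := 4) isT tm_E4s E4_S). Qed.

Lemma MF_E6s : MF 6 E6s /\ MF 6 (dil 5 E6s).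
Proof. exact: (MF_level1 (k := 6) isT tm_E6s E6_S). Qed.

Lemma MF_B1s : MF 4 B1s.
Proof.
have [h h5] := MF_E4s; apply: (@MF_div 4 48) => //.
rewrite (_ : _ * _ = E4s - dil 5 E4s); first exact: MF_B.
by rewrite E4s_us dilD dil1 dilM // dil_nat /B1s; ring.
Qed.

Lemma MF_C1s : MF 4 C1s.
Proof.
have [h h5] := MF_E4s; apply: (@MF_div 4 12) => //.
rewrite (_ : _ * _ = Es ^+ 2 - E4s); first exact: MF_B (MF_X 2 MF_Es) h.
by rewrite E4s_us /Es /C1s /As /us; ring.
Qed.

Lemma MF_B2s : MF 4 B2s.
Proof. exact: MF_D (MF_natM 5 MF_C1s) (MF_natM 19 MF_B1s). Qed.

Lemma MF_Dels : MF 12 Dels /\ MF 12 (dil 5 Dels).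
Proof.
have [h4 h45] := MF_E4s; have [h6 h65] := MF_E6s.
split; apply: (@MF_div 12 1728); rewrite ?ltn0Sn //.
  by rewrite Dels_eq; exact: MF_B (MF_X 3 h4) (MF_X 2 h6).
have -> : 1728%:R * dil 5 Dels = dil 5 (1728%:R * Dels) by rewrite dilM // dil_nat.
rewrite Dels_eq dilD dilN !dilX //; exact: MF_B (MF_X 3 h45) (MF_X 2 h65).
Qed.

(** * Reduction modulo 2 *)

Notation F2 := 'F_2.

Definition red (a : fps int) : fps F2 := @fmap int F2 (intmul 1) a.

Lemma red_coef a n : red a n = (a n)%:~R. Proof. by []. Qed.

Lemma redD a b : red (a + b) = red a + red b. Proof. exact: rmorphD. Qed.
Lemma redM a b : red (a * b) = red a * red b. Proof. exact: rmorphM. Qed.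
Lemma redN a : red (- a) = - red a. Proof. exact: rmorphN. Qed.
Lemma redX a k : red (a ^+ k) = red a ^+ k. Proof. exact: rmorphXn. Qed.
Lemma red_nat k : red k%:R = k%:R. Proof. exact: rmorph_nat. Qed.
Lemma red_theta a : red (theta a) = theta (red a). Proof. exact: fmap_theta. Qed.
Lemma red_dil m a : red (dil m a) = dil m (red a). Proof. exact: fmap_dil. Qed.

Lemma F2_case (x : F2) : x = 0 \/ x = 1.
Proof. by case: x => -[|[|//]] h; [left|right]; apply: val_inj. Qed.

Lemma F2_addxx (x : F2) : x + x = 0.
Proof. by case: (F2_case x) => ->; apply: val_inj. Qed.

Lemma F2_nat (k : nat) : k%:R = (odd k)%:R :> F2.
Proof.
rewrite -{1}(odd_double_half k) natrD -mul2n natrM.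
have -> : (2%:R : F2) = 0 by apply: val_inj.
by rewrite mul0r addr0.
Qed.

Lemma fps2_addxx (f : fps F2) : f + f = 0.
Proof. by apply: fps_ext => n; rewrite fpsD F2_addxx. Qed.

Lemma fps2_opp (f : fps F2) : - f = f.
Proof. by apply/eqP; rewrite eq_sym -addr_eq0 fps2_addxx. Qed.

Lemma fps2_nat (k : nat) : k%:R = (odd k)%:R :> fps F2.
Proof.
rewrite -{1}(odd_double_half k) natrD -mul2n natrM.
have -> : (2%:R : fps F2) = 0 by rewrite mulr2n fps2_addxx.
by rewrite mul0r addr0.
Qed.

Lemma sqr_lt_codivisor (x y n : nat) : (0 < x)%N -> (0 < y)%N -> (x * y)%N = n ->
  (y * y < n)%N = ~~ (x * x <= n)%N.
Proof. by move=> x0 y0 <-; rewrite -ltnNge ltn_pmul2r // ltn_pmul2l. Qed.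

(* Pairing [d] with [n / d] leaves only [d * d = n]. *)
Lemma odd_divisors (n : nat) : (0 < n)%N ->
  \sum_(m < n | (m.+1 %| n)%N) (1 : F2) = \sum_(m < n | (m.+1 * m.+1 == n)%N) 1.
Proof.
move=> n0; pose h (m : 'I_n) := (m.+1 %| n)%N.
rewrite (bigID (fun m : 'I_n => (m.+1 * m.+1 < n)%N)) /=.
rewrite [X in _ + X](bigID (fun m : 'I_n => (m.+1 * m.+1 == n)%N)) /=.
have inv_lt (m : 'I_n) : ((n %/ m.+1).-1 < n)%N.
  case: (posnP (n %/ m.+1)) => [->|p] //.
  by rewrite prednK // leq_div.
pose s (m : 'I_n) := Ordinal (inv_lt m).
have dv (m : 'I_n) : (m.+1 %| n)%N -> ((s m).+1 * m.+1)%N = n.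
  move=> d; rewrite /= prednK ?divnK // divn_gt0 //; exact: dvdn_leq.
have sP (m : 'I_n) : (m.+1 %| n)%N -> ((s m).+1 %| n)%N.
  by move=> d; rewrite -{2}(dv m d) dvdn_mulr.
have ss (m : 'I_n) : (m.+1 %| n)%N -> s (s m) = m.
  move=> d; apply: val_inj => /=; have := dv _ (sP m d); rewrite -{3}(dv m d).
  by rewrite mulnC => /eqP; rewrite eqn_mul2l /= => /eqP [].
have lt_s (m : 'I_n) : (m.+1 %| n)%N -> (m.+1 * m.+1 < n)%N = ~~ ((s m).+1 * (s m).+1 <= n)%N.
  by move=> d; apply: sqr_lt_codivisor (dv m d).
have -> : \sum_(m < n | (m.+1 %| n)%N && (m.+1 * m.+1 < n)%N) (1 : F2) =
  \sum_(m < n | ((m.+1 %| n)%N && ~~ (m.+1 * m.+1 < n)%N) && ~~ (m.+1 * m.+1 == n)%N) 1.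
  rewrite (reindex_onto s s) /=.
    apply: eq_bigl => m; case: (boolP (m.+1 %| n)%N) => d /=; last first.
      apply/negbTE; apply: contra d => /andP[/andP[a _] /eqP c].
      by rewrite -c; exact: sP.
    rewrite (sP m d) ss // eqxx andbT /=.
    have := lt_s _ (sP m d); rewrite ss // => ->.
    by rewrite leq_eqVlt negb_or andbC.
  by move=> m /andP[d _]; exact: ss.
rewrite addrC -addrA F2_addxx addr0; apply: eq_bigl => m.
case: eqP => [e|]; last by rewrite andbF.
have d : (m.+1 %| n)%N by apply/dvdnP; exists m.+1; rewrite e.
have l : (m.+1 * m.+1 < n)%N = false by rewrite e ltnn.
by rewrite d l.
Qed.

Lemma sg_odd n : odd n -> (sg n)%:R = ([exists i : 'I_n.+1, odd i && (i * i == n)%N] : bool)%:R :> F2.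
Proof.
move=> on; have n0 : (0 < n)%N by case: n on.
have -> : (sg n)%:R = \sum_(m < n | (m.+1 %| n)%N) (1 : F2).
  rewrite /sg natr_sum; apply: eq_bigr => m d; rewrite F2_nat.
  suff -> : odd (n %/ m.+1) by [].
  by move: on; rewrite -{1}(divnK d) oddM => /andP[].
rewrite odd_divisors //; case: existsP => [[i /andP[oi /eqP ii]]|H].
  have i0 : (0 < i)%N by case: (nat_of_ord i) oi.
  have ilt : (i.-1 < n)%N.
    rewrite prednK //; apply: leq_trans (leq_pmulr i i0) _; by rewrite ii.
  rewrite (bigD1 (Ordinal ilt)) /= ?prednK ?ii // big1 ?addr0 // => j /andP[/eqP jj].
  rewrite -val_eqE /= => /eqP; case; apply: succn_inj; rewrite prednK //.
  by apply/eqP; rewrite -eqn_sqr -!mulnn jj ii.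
rewrite big1 // => m /eqP mm; case: H.
have ml : (m.+1 < n.+1)%N by rewrite ltnS.
have := congr1 odd mm; rewrite oddM on => /andP[om _].
by exists (Ordinal ml); rewrite om /=; apply/eqP.
Qed.

(** Modulo 2 only theta (theta S) survives: vs reduces to S, so the two squares of S cancel. What is
    left is the odd part of S, and for odd n the sum sigma(n) has the parity of the number of
    divisors, odd exactly for squares. *)
Lemma red_Dels : red Dels = Fser.
Proof.
have -> : red Dels = theta (theta (red sgs)).
  have v1 : red vs = red sgs.
    rewrite /vs !(redD, redN, redM, redX, red_nat) !(fps2_nat 6, fps2_nat 12, fps2_nat 24, fps2_nat 144, fps2_nat 192) /=.
    by rewrite !mul0r !fps2_opp !addr0.
  rewrite /Dels; move: v1; move: vs us sgs => V U T v1.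
  rewrite !(redD, redN, redM, redX, red_nat) v1 !red_theta.
  rewrite (fps2_nat 12) (fps2_nat 16) (fps2_nat 4) (fps2_nat 64) (fps2_nat 3) /=.
  by rewrite !mul0r !addr0 mul1r !fps2_opp -addrA fps2_addxx addr0.
apply: fps_ext => n; rewrite /theta red_coef /sgs mulrA -natrM F2_nat oddM andbb /Fser.
case: (boolP (odd n)) => on; first by rewrite mul1r -sg_odd.
rewrite mul0r; case: existsP => // -[i /andP[oi /eqP ii]].
by move: on; rewrite -ii oddM oi.
Qed.

Lemma red_Dels5 : red (dil 5 Dels) = Gser.
Proof. by rewrite red_dil red_Dels. Qed.

Lemma red_E4s : red E4s = 1.
Proof. by rewrite E4s_us redD redM red_nat (fps2_nat 48) /= mul0r addr0 (red_nat 1). Qed.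

(* [red B1s], the generator of the algebra of mod 2 forms. *)
Definition rr : fps F2 := red sgs + dil 5 (red sgs).

Lemma red_B1s : red B1s = rr.
Proof.
have u1 : red us = red sgs.
  rewrite /us !(redD, redN, redM, redX, red_nat) (fps2_nat 12) (fps2_nat 6) /=.
  by rewrite !mul0r !addr0 fps2_opp.
by rewrite /B1s; move: u1; move: us => u u1; rewrite redD redN red_dil u1 fps2_opp.
Qed.

Lemma red_B2s : red B2s = rr ^+ 2.
Proof.
have a1 : red As = rr.
  by rewrite /As redD redN redM red_nat red_dil (fps2_nat 5) mul1r fps2_opp.
have c1 : red C1s = rr + rr ^+ 2.
  rewrite /C1s; move: a1; move: As => A a1.
  rewrite !(redD, redN, redM, redX, red_nat) a1.
  rewrite (fps2_nat 3) (fps2_nat 4) (fps2_nat 48) (fps2_nat 24) /=.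
  by rewrite !mul0r !mul1r oppr0 !addr0.
rewrite /B2s; move: c1 red_B1s; move: C1s B1s => c b c1 b1.
rewrite redD !redM !red_nat c1 b1 (fps2_nat 5) (fps2_nat 19) /= !mul1r.
by rewrite addrAC fps2_addxx add0r.
Qed.

(** * From [Mk] to integral expansions *)

Lemma normC_le (x y : C) (M : RR) k : (`|x| <= M%:C * `|y| ^+ k) = (nm x <= M * nm y ^+ k).
Proof. by rewrite !normE -rmorphXn -rmorphM lecR. Qed.

Lemma lim_to_cvg (u : nat -> C) (l : C) : lim_to u l -> ((u : nat -> CC) @ \oo --> (l : CC))%classic.
Proof.
move=> h; apply/cvgrPdist_lt => eps.
rewrite ltcE /= => /andP[/eqP e0 e1].
have [N HN] := h _ e1; exists N => // n /= /HN hn.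
rewrite normE ltcE /= e0 eqxx /= nmBC //.
Qed.

Lemma cvg_lim_to (u : nat -> C) (l : C) : ((u : nat -> CC) @ \oo --> (l : CC))%classic -> lim_to u l.
Proof.
move=> /cvgrPdist_lt h eps e0.
have e1 : 0 < eps%:C :> CC by rewrite ltcR.
have [N _ HN] := h _ e1; exists N => n nN.
by have := HN n nN; rewrite normE ltcR nmBC.
Qed.

Lemma has_d_derivable (f : C -> C) (z l : C) : has_d f z l -> derivable (f : CC -> CC) z 1.
Proof.
move=> [K [d [d0 H]]]; apply/cvg_ex; exists (l : CC); apply/cvgrPdist_lt => eps.
rewrite ltcE /= => /andP[/eqP ei e0].
have relE_Dr : 0 < `|K| + 1 by have := normr_ge0 K; lra.
pose r : RR := Num.min d (complex.Re eps / (`|K| + 1)).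
have r0 : 0 < r by rewrite lt_min d0 divr_gt0.
have rC : 0 < r%:C :> CC by rewrite ltcR.
exists (r%:C : CC) => // h; rewrite /= sub0r normrN normE ltcR => hr h0.
have hn : 0 < nm h by rewrite nm_gt0.
rewrite /GRing.scale /= mulr1 [h + z]addrC -normrN opprB.
move: hr; rewrite lt_min => /andP[hd he].
have -> : h^-1 * (f (z + h) - f z) - l = (f (z + h) - f z - l * h) / h by field.
rewrite normE nm_div ltcE /= ei eqxx /= ltr_pdivrMr //.
apply: (le_lt_trans (H h (ltW hd))).
rewrite ltr_pdivlMr // in he; rewrite expr2 mulrA ltr_pM2r //.
apply: le_lt_trans he; rewrite mulrC ler_wpM2l ?nm_ge0 //.
by have := ler_norm K; lra.
Qed.

Lemma ev_qexp a : tm a -> has_qexp (ev a) a.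
Proof. by move=> ta z Iz; apply: lim_to_cvg; exact: pevP ta (nm_e_lt1 Iz). Qed.

(** The function is recovered from its expansion: convergence at every radius r < 1, reached through
    [e_surj], makes the coefficients tame, and then phi equals [ev a] on the half plane. Conversely
    [ev a] is holomorphic by [has_d_ev]. *)
Lemma MkP k (f : ps) : Mk k f <-> exists a : fps int, MF k a /\ f = red a.
Proof.
split=> [[phi [a [[d1 d2 d3] qe fa]]]|[a [[ta [w1 w2]] ->]]]; last first.
  exists (ev a), a; split => //; last exact: ev_qexp.
  split=> //; first by move=> z Iz; exact: has_d_derivable (has_d_ev Iz ta).
  move=> a0 b c d det; have [M [Y H]] := w2 a0 b c d det; exists M, Y => z Yz.
  by rewrite normC_le; exact: H.
have ta : tm a.
  apply: tame_of_hs => r /andP[r0 r1].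
  have rC : r%:C != 0 :> C by rewrite -nm_gt0 nm_real gtr0_norm.
  have [z ez] := e_surj rC; exists (phi z).
  have Iz : 0 < complex.Im z.
    rewrite -(pmulr_rgt0 _ (mulr_gt0 (ltr0Sn RR 1) (pi_gt0 RR))) -oppr_lt0 -expR_lt1 -nm_e ez.
    by rewrite nm_real gtr0_norm.
  by rewrite -ez; exact: cvg_lim_to (qe z Iz).
have E (z : C) : 0 < complex.Im z -> phi z = ev a z.
  move=> Iz; apply: esym; apply: pev_hs => //; first exact: nm_e_lt1.
  exact: cvg_lim_to (qe z Iz).
exists a; split; last by apply: fps_ext.
split=> //; apply: (wm_ext E); split=> a0 b c d det; first exact: d2.
have [M [Y H]] := d3 a0 b c d det; exists M, Y => z Yz.
by rewrite -normC_le; exact: H.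
Qed.

(** * Mod 2 forms as polynomials in one series *)

Lemma fpsX_low (R : idomainType) (f : fps R) a k n : (forall i, (i < a)%N -> f i = 0) ->
  (n < a * k)%N -> (f ^+ k) n = 0.
Proof.
move=> fa; elim: k n => [|k IH] n; first by rewrite muln0.
by rewrite exprS mulnS; exact: fpsM_low.
Qed.

Lemma fpsC_int (c : int) : fpsC c = c%:~R.
Proof. by rewrite -{1}[c]intz rmorph_int. Qed.

Lemma MF_C k (c : int) a : MF k a -> MF k (fpsC c * a).
Proof.
rewrite fpsC_int => ha; case: c => n; first by rewrite -pmulrn; exact: MF_natM.
by rewrite NegzE rmorphN /= mulNr -pmulrn; exact: MF_N (MF_natM _ ha).
Qed.

Lemma red_C c : red (fpsC c) = fpsC c%:~R.
Proof. by apply: fps_ext => -[|n]. Qed.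

Lemma sgs_val : [/\ sgs 0%N = 0, sgs 1%N = 1, red sgs 2%N = 1 & red sgs 3%N = 0] /\
  [/\ red sgs 4%N = 1, red sgs 5%N = 0 & red sgs 6%N = 0].
Proof.
rewrite !red_coef /sgs /sg.
by split; split; rewrite ?big_mkcond !(big_ord_recl, big_ord0) /=; apply/eqP.
Qed.

Lemma rr_val : [/\ rr 0%N = 0, rr 1%N = 1, rr 2%N = 1 & rr 3%N = 0] /\
  [/\ rr 4%N = 1, rr 5%N = 1 & rr 6%N = 0].
Proof.
have [[s0 s1 s2 s3] [s4 s5 s6]] := sgs_val.
have r0 : red sgs 0%N = 0 by rewrite red_coef s0.
have r1 : red sgs 1%N = 1 by rewrite red_coef s1.
by rewrite /rr !fpsD /dil /= r0 r1 s2 s3 s4 s5 s6 !addr0 add0r.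
Qed.

Lemma rr_ord : ord_at rr 1.
Proof. by have [[r0 r1 _ _] _] := rr_val; split; [case|rewrite r1]. Qed.

Lemma B1s_low i : (i < 1)%N -> B1s i = 0.
Proof.
have [[s0 _ _ _] _] := sgs_val; case: i => // _.
rewrite /B1s /us; move: s0; move: sgs => T s0.
rewrite !(fpsD, fpsN, fps_natM, fpsX0, dilD, dilN, fpsM0) /theta /dil /=.
by rewrite !(fpsD, fpsN, fps_natM, fpsX0) s0; apply/eqP.
Qed.

Lemma B2s_low i : (i < 2)%N -> B2s i = 0.
Proof.
have [[s0 s1 _ _] _] := sgs_val.
have sq (f : fps int) : f 0%N = 0 -> (f ^+ 2) 1%N = 0 by move=> f0; rewrite expr2 fpsM !big_ord_recl big_ord0 /= f0 !(mul0r, mulr0, addr0).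
case: i => [|[|//]] _.
  rewrite /B2s fpsD !fps_natM B1s_low // /C1s /As; move: s0; move: sgs => T s0.
  rewrite !(fpsD, fpsN, fps_natM, fpsX0) /theta /dil /= s0; by apply/eqP.
have a0 : As 0%N = 0 by rewrite /As fpsD fpsN fps_natM /dil /= s0.
have a1 : As 1%N = 1 by rewrite /As fpsD fpsN fps_natM /dil /= s1.
have u1 : us 1%N = 5.
  by rewrite /us !(fpsD, fpsN, fps_natM) sq // /theta s1; apply/eqP.
rewrite /B2s fpsD !fps_natM /C1s /B1s; move: As us a0 a1 u1 => A U a0 a1 u1.
move: s0 s1; move: sgs => T s0 s1.
rewrite !(fpsD, fpsN, fps_natM) !sq // /theta /dil /= a1 u1 s1; by apply/eqP.
Qed.

(* Weight [4 * m] forms whose expansions start at [x ^ j], [j <= 2 * m], with odd leading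
   coefficient: they form a basis up to finite odd index. *)
Definition bas (m j : nat) : fps int :=
  E4s ^+ (m - (j./2 + odd j)) * (B1s ^+ odd j * B2s ^+ j./2).

Lemma MF_bas m j : (j <= 2 * m)%N -> MF (4 * m) (bas m j).
Proof.
move=> jm; have h : (j./2 + odd j <= m)%N.
  by have := odd_double_half j; have := leq_b1 (odd j); lia.
have -> : (4 * m = 4 * (m - (j./2 + odd j)) + (4 * odd j + 4 * j./2))%N.
  by rewrite -!mulnDr [(odd j + _)%N]addnC subnK.
exact: MF_M (MF_X _ MF_E4s.1) (MF_M (MF_X _ MF_B1s) (MF_X _ MF_B2s)).
Qed.

Lemma red_bas m j : red (bas m j) = rr ^+ j.
Proof.
rewrite /bas; move: red_E4s red_B1s red_B2s; move: E4s B1s B2s => E B D hE hB hD.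
rewrite !redM !redX hE hB hD expr1n mul1r -exprM -exprD.
by rewrite mul2n odd_double_half.
Qed.

Lemma bas_low m j i : (i < j)%N -> (bas m j) i = 0.
Proof.
move=> ij; have ij0 : (i < 0 + j)%N by []; apply: (@fpsM_low _ _ _ 0 j) => // l lj.
apply: (@fpsM_low _ _ _ (1 * odd j) (2 * j./2)) => [n|n|].
- exact: fpsX_low B1s_low.
- exact: fpsX_low B2s_low.
- by rewrite mul1n mul2n odd_double_half.
Qed.

(** Horner evaluation in the ring of series; [psevalE] identifies it with [pseval]. *)
Definition pol (P : {poly F2}) (g : fps F2) : fps F2 := (map_poly (@fpsC F2) P).[g].

Lemma polD P Q g : pol (P + Q) g = pol P g + pol Q g.
Proof. by rewrite /pol rmorphD hornerD. Qed.
Lemma polM P Q g : pol (P * Q) g = pol P g * pol Q g.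
Proof. by rewrite /pol rmorphM hornerM. Qed.
Lemma polX g : pol 'X g = g.
Proof. by rewrite /pol map_polyX hornerX. Qed.
Lemma polC c g : pol c%:P g = fpsC c.
Proof. by rewrite /pol map_polyC hornerC. Qed.
Lemma polXn n g : pol 'X^n g = g ^+ n.
Proof. by rewrite /pol map_polyXn hornerXn. Qed.

Lemma polE P g : pol P g = \sum_(i < size P) fpsC P`_i * g ^+ i.
Proof.
rewrite /pol horner_coef size_map_poly; apply: eq_bigr => i _.
by rewrite coef_map.
Qed.

(** Induction on the number t of vanishing coefficients: A is replaced by b A - A_t [bas m t], with
    b the leading coefficient of [bas m t]. As b is odd, modulo 2 this only adds a multiple of rr^t.
    Once 2m + 1 coefficients vanish, [sturm] gives A = 0. *)
Lemma MF_pol m a : MF (4 * m) a -> exists2 P : {poly F2}, (size P <= (2 * m).+1)%N & red a = pol P rr.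
Proof.
move=> ha; suff H t : (t <= (2 * m).+1)%N -> exists A, [/\ MF (4 * m) A,
    forall n, (n < t)%N -> A n = 0 & exists2 P : {poly F2}, (size P <= (2 * m).+1)%N & red A = red a + pol P rr].
  have [A [hA A0 [P sP rA]]] := H _ (leqnn _); exists P => //.
  have A00 := sturm hA A0.
  by apply/eqP; rewrite -subr_eq0 fps2_opp -rA A00; apply/eqP; exact: (red_nat 0).
elim: t => [|t IH] ht.
  by exists a; split => //; exists 0; rewrite ?size_poly0 // (polC 0) rmorph0 addr0.
have [A [hA A0 [P sP rA]]] := IH (ltnW ht).
exists (fpsC (bas m t t) * A - fpsC (A t) * bas m t); split.
- exact: MF_B (MF_C _ hA) (MF_C _ (MF_bas ht)).
- move=> n; rewrite ltnS leq_eqVlt fpsD fpsN !fpsCM => /orP[/eqP->|nt].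
    by rewrite mulrC subrr.
  by rewrite (A0 n nt) (bas_low m nt) !mulr0 subrr.
have rt : ((bas m t t)%:~R : F2) = 1.
  have [_] := ord_atX t rr_ord; rewrite mul1n -(red_bas m) red_coef.
  by case: (F2_case (bas m t t)%:~R) => ->; rewrite ?eqxx.
exists (P + ((A t)%:~R)%:P * 'X^t).
  rewrite (leq_trans (size_polyD _ _)) // geq_max sP /=.
  by apply: leq_trans (size_polyMleq _ _) _; rewrite size_polyXn addnS /= size_polyC; case: eqP => //= _; lia.
move: (red_bas m t) rt; move: (bas m t) => b rb rt.
rewrite redD redN !redM !red_C rt rmorph1 mul1r fps2_opp rA rb polD polM polC polXn.
by rewrite addrA.
Qed.

Lemma pol_MF m (P : {poly F2}) : (size P <= (2 * m).+1)%N -> exists2 a, MF (4 * m) a & red a = pol P rr.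
Proof.
move=> sP; exists (\sum_(i < size P) fpsC ((P`_i)%R : nat)%:Z * bas m i).
  apply: MF_sum => [|i _]; first exact: MF_0.
  by apply/MF_C/MF_bas; have := ltn_ord i; lia.
have redS (I : Type) (r : seq I) (A : I -> fps int) : red (\sum_(i <- r) A i) = \sum_(i <- r) red (A i).
  exact: rmorph_sum.
rewrite redS polE; apply: eq_bigr => i _; move: (red_bas m i); move: (bas m i) => b rb.
by rewrite redM rb red_C -pmulrn natr_Zp.
Qed.

Lemma Modd_pol (f : ps) : (exists m, Mk (4 * m) f) <-> exists P, f = pol P rr.
Proof.
split=> [[m /MkP[a [ha ->]]]|[P ->]]; first by have [P _ ->] := MF_pol ha; exists P.
have sP : (size P <= (2 * size P).+1)%N by lia.
by have [a ha <-] := pol_MF sP; exists (size P); apply/MkP; exists a.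
Qed.

(** rr^j starts at x^j with coefficient 1, so the coefficients of P are read off one after the
    other. *)
Lemma pol_low P k : (forall i, (i < k)%N -> pol P rr i = 0) -> forall i, (i < k)%N -> P`_i = 0.
Proof.
move=> H i; elim/ltn_ind: i => i IH ik.
have := H i ik; rewrite /pol horner_coef fps_sum.
have [si|si] := leqP (size P) i; first by rewrite nth_default.
rewrite size_map_poly (bigD1 (Ordinal si)) //= coef_map fpsCM big1 ?addr0.
  have [_] := ord_atX i rr_ord; rewrite mul1n.
  by case: (F2_case ((rr ^+ i) i)) => ->; rewrite ?eqxx // mulr1.
move=> j; rewrite -val_eqE /= coef_map fpsCM => ji.
have [h|h] := ltnP j i; first by rewrite IH ?mul0r // (ltn_trans h).
have [lo _] := ord_atX j rr_ord; rewrite lo ?mulr0 // mul1n ltn_neqAle h andbT eq_sym //.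
Qed.

Lemma pol_inj P Q : pol P rr = pol Q rr -> P = Q.
Proof.
move=> e; apply/eqP; rewrite -subr_eq0; apply/eqP/polyP => i; rewrite coef0.
apply: (@pol_low (P - Q) i.+1) => // j _.
by rewrite /pol rmorphB hornerD hornerN -/(pol P rr) -/(pol Q rr) e subrr.
Qed.

(** In the square the terms i and n - i cancel in pairs; the middle one is c^2 = c for c in F_2. *)
Lemma frob (f : fps F2) : f ^+ 2 = dil 2 f.
Proof.
apply: fps_ext => n; rewrite expr2 fpsM.
rewrite (bigID (fun i : 'I_n.+1 => (i < n - i)%N)) /=.
rewrite [X in _ + X](bigID (fun i : 'I_n.+1 => (i == n - i :> nat)%N)) /=.
have -> : \sum_(i < n.+1 | (i < n - i)%N) f i * f (n - i)%N =
    \sum_(i < n.+1 | ~~ (i < n - i)%N && ~~ (i == n - i :> nat)%N) f i * f (n - i)%N.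
  rewrite (reindex_inj rev_ord_inj) /=; apply: eq_big => [i|i _].
    by have := ltn_ord i; lia.
  have := ltn_ord i; rewrite ltnS => h; rewrite subSS mulrC; congr (f _ * f _); lia.
rewrite addrC -addrA F2_addxx addr0 /dil.
have sq (x : F2) : x * x = x by case: (F2_case x) => ->; apply: val_inj.
case: (boolP (2 %| n)%N) => [/dvdnP[k nk]|nd].
  have kn : (k < n.+1)%N by lia.
  rewrite (bigD1 (Ordinal kn)) /=; last by lia.
  rewrite big1 ?addr0 => [|i]; last by rewrite -val_eqE /=; have := ltn_ord i; lia.
  have -> : (n - k = k)%N by lia.
  by rewrite sq nk mulnK.
rewrite big1 // => i /andP[_ /eqP h]; case/negP: nd; apply/dvdnP; exists i; have := ltn_ord i; lia.
Qed.

Lemma frob4 (f : fps F2) : f ^+ 4 = dil 4 f.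
Proof. by rewrite (exprM f 2 2) !frob dil_dil. Qed.

Lemma Gser_dil : Gser = dil 5 Fser. Proof. by []. Qed.

Lemma Fser_sg n : Fser n = n%:R * red sgs n.
Proof.
rewrite red_coef /sgs /Fser; case: (boolP (odd n)) => on.
  by rewrite (F2_nat n) on mul1r -pmulrn sg_odd.
rewrite (F2_nat n) (negbTE on) mul0r; case: existsP => // -[i /andP[oi /eqP ii]].
by move: on; rewrite -ii oddM oi.
Qed.

Lemma rrX_val : (forall i, (i < 7)%N -> (rr ^+ 5) i = (i == 5%N)%:R + (i == 6%N)%:R) /\
  (forall i, (i < 7)%N -> (rr ^+ 6) i = (i == 6%N)%:R).
Proof.
have [[r0 r1 r2 _] _] := rr_val; have rl := rr_ord.1; have r0' := rl 0%N isT.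
split=> i i7.
  have [h|h] := ltnP i 5.
    have [-> ->] : (i == 5)%N = false /\ (i == 6)%N = false by lia.
    by rewrite (fpsX_low (a := 1) rl) ?mul1n // addr0.
  have {h i7} : i = 5%N \/ i = 6%N by lia.
  by rewrite (exprS rr 4) frob4 fpsM /dil => -[] ->; rewrite !big_ord_recl big_ord0 /= r0 r1 r2
     !(mul0r, mulr0, addr0, add0r, mul1r, mulr1).
have [h|h] := ltnP i 6.
  by rewrite (fpsX_low (a := 1) rl) ?mul1n // (ltn_eqF h).
have -> : i = 6%N by lia.
rewrite (exprD rr 2 4) frob4 frob fpsM /dil !big_ord_recl big_ord0 /= r0 r1 r2.
by rewrite !(mul0r, mulr0, addr0, add0r, mul1r, mulr1).
Qed.

(** In weight 12 a reduction is a polynomial of degree at most 6 in rr, and rr has order 1, so the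
    coefficients 0 to 6 decide. *)
Lemma pol_eq7 (a : fps int) (Q : {poly F2}) : MF 12 a -> (size Q <= 7)%N ->
  (forall i, (i < 7)%N -> red a i = pol Q rr i) -> red a = pol Q rr.
Proof.
move=> ha sQ H; have [P sP rP] := @MF_pol 3 a ha.
suff -> : Q = P by [].
have pB : pol (Q - P) rr = pol Q rr - pol P rr.
  by rewrite /pol rmorphB hornerD hornerN.
apply/eqP; rewrite -subr_eq0; apply/eqP/polyP => i; rewrite coef0.
have [h|h] := ltnP i 7; last first.
  rewrite nth_default // (leq_trans (size_polyD _ _)) // size_polyN geq_max.
  by rewrite !(leq_trans _ h).
apply: (@pol_low (Q - P) 7) => // j j7.
by rewrite pB fpsD fpsN -H // -rP subrr.
Qed.

Lemma Gser_rr : Gser = rr ^+ 5 + rr ^+ 6.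
Proof.
have [v5 v6] := rrX_val; have [[s0 s1 _ _] _] := sgs_val.
rewrite -red_Dels5 -!(polXn _ rr) -polD; apply: pol_eq7 MF_Dels.2 _ _.
  by rewrite (leq_trans (size_polyD _ _)) // !size_polyXn.
move=> i i7; rewrite red_Dels5 polD !polXn fpsD v5 // v6 // -addrA F2_addxx addr0.
rewrite Gser_dil /dil; case: i i7 => [|[|[|[|[|[|[|i]]]]]]] //= _; rewrite Fser_sg red_coef ?s0 ?s1 ?mulr0 ?mul1r //.
Qed.

Lemma Fser_rr : Fser = rr + rr ^+ 2 + rr ^+ 5 + rr ^+ 6.
Proof.
have [v5 v6] := rrX_val; have [[r0 r1 r2 r3] [r4 r5 r6]] := rr_val.
have [[s0 s1 s2 s3] [s4 s5 s6]] := sgs_val.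
rewrite -red_Dels -!(polXn _ rr) -{1}(polX rr) -!polD; apply: pol_eq7 MF_Dels.1 _ _.
  by do 3!(rewrite (leq_trans (size_polyD _ _)) // geq_max size_polyXn andbT); rewrite size_polyX.
move=> i i7; rewrite red_Dels !polD !polXn polX !fpsD v5 // v6 // frob /dil.
rewrite Fser_sg; case: i i7 => [|[|[|[|[|[|[|i]]]]]]] //= _;
 rewrite ?red_coef ?s0 ?s1 -?red_coef ?s2 ?s3 ?s4 ?s5 ?s6 ?r0 ?r1 ?r2 ?r3 ?r4 ?r5 ?r6; by apply/eqP.
Qed.

(** * Supports and residue classes *)

Implicit Types (f g h : fps F2) (S T U : nat -> bool) (P Q : {poly F2}).

Definition on S f := forall n, ~~ S n -> f n = 0.

Definition prj S f : fps F2 := fun n => if S n then f n else 0.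

Lemma on_sub S T f : (forall n, S n -> T n) -> on S f -> on T f.
Proof. by move=> st h n tn; apply: h; apply: contra tn; exact: st. Qed.

Lemma onD S f g : on S f -> on S g -> on S (f + g).
Proof. by move=> hf hg n sn; rewrite fpsD hf ?hg ?addr0. Qed.

Lemma onM S T U f g : (forall i j, S i -> T j -> U (i + j)%N) -> on S f -> on T g -> on U (f * g).
Proof.
move=> st hf hg n un; rewrite fpsM big1 // => i _.
have [si|si] := boolP (S i); last by rewrite hf ?mul0r.
have [tj|tj] := boolP (T (n - i)%N); last by rewrite hg ?mulr0.
by case/negP: un; have := st _ _ si tj; rewrite subnKC // leq_ord.
Qed.

Lemma on_dil S T (m : nat) f : (0 < m)%N -> (forall n, S n -> T (m * n)%N) -> on S f -> on T (dil m f).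
Proof.
move=> m0 st hf n; apply: contraNeq; rewrite /dil; case: ifP => [/dvdnP[k ->]|]; last by rewrite eqxx.
rewrite mulnK // => fk; rewrite mulnC; apply: st; apply: contraNT fk => sk.
by apply/eqP; exact: hf.
Qed.

Lemma prjD S f g : prj S (f + g) = prj S f + prj S g.
Proof. by apply: fps_ext => n; rewrite fpsD /prj fpsD; case: (S n); rewrite ?addr0. Qed.

Lemma prj_disj S T f : on T f -> (forall n, S n -> ~~ T n) -> prj S f = 0.
Proof. by move=> hf st; apply: fps_ext => n; rewrite fps0 /prj; case: ifPn => // /st /hf. Qed.

Local Notation on5 := (on (fun n => 5 %| n)%N).

(** The exponents of a are multiples of 5 and S depends only on the class modulo 5, so multiplying
    by a does not move terms in or out of S. *)
Lemma prjM5 S a f : on5 a -> (forall n, S (n + 5)%N = S n) -> prj S (a * f) = a * prj S f.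
Proof.
move=> ha s5; apply: fps_ext => n; rewrite /prj !fpsM.
have s5n i k : S (i + 5 * k)%N = S i.
  elim: k => [|k IH]; first by rewrite muln0 addn0.
  by rewrite mulnS [(5 + _)%N]addnC addnA s5.
have sE (i : 'I_n.+1) : (5 %| i)%N -> S (n - i)%N = S n.
  case/dvdnP => k ik; have := subnK (leq_ord i); rewrite ik mulnC => nE.
  by rewrite -[in RHS]nE s5n.
have -> : \sum_(i < n.+1) a i * (if S (n - i)%N then f (n - i)%N else 0) =
    \sum_(i < n.+1) a i * (if S n then f (n - i)%N else 0).
  apply: eq_bigr => i _; have [h|h] := boolP (5 %| i)%N; first by rewrite sE.
  by rewrite ha ?mul0r.
by case: ifP => // _; rewrite big1 // => i _; rewrite mulr0.
Qed.

Lemma on5D a b : on5 a -> on5 b -> on5 (a + b). Proof. exact: onD. Qed.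

Lemma on5M a b : on5 a -> on5 b -> on5 (a * b).
Proof. by apply: onM => i j; exact: dvdn_add. Qed.

Lemma on5_C c : on5 (fpsC c).
Proof. by case=> // n _; rewrite /fpsC. Qed.

Lemma on5_1 : on5 1. Proof. by have := on5_C 1; rewrite rmorph1. Qed.

Lemma on5X a k : on5 a -> on5 (a ^+ k).
Proof. by move=> ha; elim: k => [|k IH]; [exact: on5_1|rewrite exprS; exact: on5M]. Qed.

Lemma on5_pol P g : on5 g -> on5 (pol P g).
Proof.
move=> hg; rewrite polE; elim/big_ind: _ => //; first exact: on5D.
by move=> i _; exact: on5M (on5_C _) (on5X _ hg).
Qed.

Lemma on5_ord a d : on5 a -> ord_at a d -> (5 %| d)%N.
Proof. by move=> ha [_]; apply: contraR => /ha ->. Qed.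

(** Nonzero a and b have orders divisible by 5, so a u and b v have orders in different classes
    modulo 5 and cannot cancel. *)
Lemma indep5 u v i j a b : ord_at u i -> ord_at v j -> (i %% 5 != j %% 5)%N ->
  on5 a -> on5 b -> a * u + b * v = 0 -> a = 0 /\ b = 0.
Proof.
move=> hu hv ij ha hb E.
have u0 := ord_at_neq0 hu; have v0 := ord_at_neq0 hv.
have E2 : a * u = b * v by apply/eqP; rewrite -[b * v]fps2_opp -addr_eq0 E.
have [a0|a0] := eqVneq a 0.
  by move: E2; rewrite a0 mul0r => /esym/fps_mulf_eq0[//|v00]; rewrite v00 eqxx in v0.
have [b0|b0] := eqVneq b 0.
  by move: E2; rewrite b0 mul0r => /fps_mulf_eq0[a00|u00]; [rewrite a00 eqxx in a0|rewrite u00 eqxx in u0].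
have [d hd] := ord_ex a0; have [d' hd'] := ord_ex b0.
have [lo1 n1] := ord_atM hd hu; have [lo2 n2] := ord_atM hd' hv.
have dd := on5_ord ha hd; have dd' := on5_ord hb hd'.
rewrite E2 in lo1 n1; have [h|h|h] := ltngtP (d + i) (d' + j).
- by move: n1; rewrite lo2 // eqxx.
- by move: n2; rewrite lo1 // eqxx.
- case/negP: ij; apply/eqP; lia.
Qed.

(** The nonzero squares modulo 5; [Nc] holds the non-squares. *)
Definition Qc n := ((n %% 5 == 1) || (n %% 5 == 4))%N.
Definition Nc n := ((n %% 5 == 2) || (n %% 5 == 3))%N.

Lemma Qc5 n : Qc (n + 5)%N = Qc n. Proof. by rewrite /Qc modnDr. Qed.
Lemma Nc5 n : Nc (n + 5)%N = Nc n. Proof. by rewrite /Nc modnDr. Qed.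

Lemma Fser_on20 n : Fser n != 0 -> (n %% 20)%N \in [:: 1; 5; 9]%N.
Proof.
rewrite /Fser; case: existsP => [[i /andP[oi /eqP <-]] _|]; last by rewrite eqxx.
have [k [q [k20 ik]]] : exists k q, (k < 20)%N /\ (nat_of_ord i = 20 * q + k)%N.
  by exists (i %% 20)%N, (i %/ 20)%N; split; [exact: ltn_pmod|rewrite mulnC -divn_eq].
have -> : ((i * i) %% 20 = (k * k) %% 20)%N by rewrite -modnMm ik mulnC modnMDl modnMm.
have ok : odd k by move: oi; rewrite ik oddD oddM.
by clear ik oi; move: ok; do 20!(case: k k20 => [|k] k20 //).
Qed.

Lemma F_on4 : on (fun n => n %% 4 == 1)%N Fser.
Proof.
move=> n; apply: contraNeq => /Fser_on20; rewrite !inE; lia.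
Qed.

Lemma F_on5 : on (fun n => ~~ Nc n) Fser.
Proof.
move=> n; apply: contraNeq => /Fser_on20; rewrite !inE /Nc; lia.
Qed.

Lemma G_on4 : on (fun n => n %% 4 == 1)%N Gser.
Proof. rewrite Gser_dil; apply: (on_dil (S := fun n => n %% 4 == 1)%N) F_on4 => // n; lia. Qed.

Lemma G_on5 : on5 Gser.
Proof. by rewrite Gser_dil; apply: (on_dil (S := predT)) => // n _; rewrite dvdn_mulr. Qed.

Lemma frob8 f : f ^+ 8 = dil 8 f.
Proof. by rewrite (exprM f 2 4) frob frob4 dil_dil. Qed.

Lemma F_ord : ord_at Fser 1.
Proof.
have [[s0 s1 _ _] _] := sgs_val.
by split=> [[]//|]; rewrite Fser_sg red_coef ?s0 ?s1 // ?mul0r.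
Qed.

Lemma F_dil_ord S k : (0 < k)%N -> S k -> ord_at (prj S (dil k Fser)) k.
Proof.
move=> k0 sk; have [F0 F1] := F_ord; split=> [i ik|].
  rewrite /prj /dil; case: ifP => // _; case: ifP => // /dvdnP[j ji].
  by rewrite ji mulnK // F0 //; case: j ji => // j ji; move: ik; rewrite ji mulSn; lia.
by rewrite /prj sk /dil dvdnn divnn k0.
Qed.

(** * The modular equation modulo 2 *)

Definition Dr : fps F2 := rr + rr ^+ 2.
Definition Rr : fps F2 := rr ^+ 4.
(* [Wr] is [w ^ 4] for [w = 1 + rr (x ^ 5)]. *)
Definition Wr : fps F2 := 1 + dil 20 rr.

(* Under the type [ps] the ring operations would be the pointwise ones. *)
Definition Ff : fps F2 := Fser.
Definition Gf : fps F2 := Gser.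
Definition J3f : fps F2 := J3.

Lemma Ff_rr : Ff = rr + rr ^+ 2 + rr ^+ 5 + rr ^+ 6. Proof. exact: Fser_rr. Qed.
Lemma Gf_rr : Gf = rr ^+ 5 + rr ^+ 6. Proof. exact: Gser_rr. Qed.
Lemma Gf_dil : Gf = dil 5 Ff. Proof. by []. Qed.

Lemma fps2_dbl (f : fps F2) : 2 * f = 0.
Proof. by rewrite mulr_natl mulr2n fps2_addxx. Qed.

(** Lets [ring], which ignores the characteristic, close identities modulo 2: h collects half of the
    discrepancy. *)
Lemma char2_eq (f g h : fps F2) : f = g + 2 * h -> f = g.
Proof. by move=> ->; rewrite fps2_dbl addr0. Qed.

Lemma fps2_sqrD (f g : fps F2) : (f + g) ^+ 2 = f ^+ 2 + g ^+ 2.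
Proof. by apply: (@char2_eq _ _ (f * g)); ring. Qed.

Lemma fps2_exp4D (f g : fps F2) : (f + g) ^+ 4 = f ^+ 4 + g ^+ 4.
Proof. by rewrite !(exprM _ 2 2) !fps2_sqrD. Qed.

Lemma fps2_exp8D (f g : fps F2) : (f + g) ^+ 8 = f ^+ 8 + g ^+ 8.
Proof. by rewrite !(exprM _ 2 4) fps2_sqrD fps2_exp4D. Qed.

Lemma Ff_DG : Ff = Dr + Gf.
Proof. by rewrite Ff_rr Gf_rr addrA. Qed.

Lemma Dr_FG : Dr = Ff + Gf.
Proof. by rewrite Ff_DG -addrA fps2_addxx addr0. Qed.

Lemma Dr_Rr : Dr * Rr = Gf.
Proof. by rewrite Gf_rr /Dr /Rr; ring. Qed.

Lemma Dr4 : Dr ^+ 4 = Rr + Rr ^+ 2.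
Proof. by rewrite /Dr fps2_exp4D /Rr -!exprM. Qed.

Lemma G4_Rr : Gf ^+ 4 = Rr ^+ 5 + Rr ^+ 6.
Proof. by rewrite Gf_rr fps2_exp4D /Rr -!exprM. Qed.

(** G^4 = F(x^20). With t = rr(x^20) this is t + t^2 + t^5 + t^6 = t (1 + t)^5, and W = 1 + t. *)
Lemma G4_Wr : Gf ^+ 4 = Wr ^+ 5 + Wr ^+ 6.
Proof.
rewrite frob4 Gf_dil dil_dil // -[(4 * 5)%N]/20%N Ff_rr /Wr; move: rr => r; rewrite !dilD !dilX //.
move: (dil _ r) => t; apply: (@char2_eq _ _ (- (1 + 5 * t + 12 * t ^+ 2 + 15 * t ^+ 3 + 10 * t ^+ 4 + 3 * t ^+ 5))); ring.
Qed.

Lemma rr0 : rr 0%N = 0. Proof. by have [[]] := rr_val. Qed.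

Lemma Rr0 : Rr 0%N = 0. Proof. by rewrite /Rr fpsX0 rr0 expr0n. Qed.

Lemma Wr0 : Wr 0%N = 1. Proof. by rewrite /Wr fpsD /dil /= rr0 addr0. Qed.

Lemma Wr_on5 : on5 Wr.
Proof.
apply: onD on5_1 _; apply: (on_dil (S := predT)) => // n _.
by rewrite (_ : (20 * n = 5 * (4 * n))%N) ?dvdn_mulr //; lia.
Qed.

Lemma Wr_neq0 : Wr != 0.
Proof. by apply/eqP => /(congr1 (fun f : fps F2 => f 0%N)) /eqP; rewrite Wr0 fps0. Qed.

Lemma G_neq0 : Gf != 0.
Proof.
have o := ord_atX 5 rr_ord; have o6 := ord_atX 6 rr_ord.
apply/eqP => /(congr1 (fun f : fps F2 => f 5%N)) /eqP; rewrite Gf_rr fpsD fps0 o6.1 // addr0.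
by apply/negP; exact: o.2.
Qed.

(* The factor left after dividing [R^5 + R^6 = W^5 + W^6] by [R - W]. *)
Lemma Rr5 : Rr ^+ 5 = (1 + Wr) * (Rr ^+ 4 + Wr * Rr ^+ 3 + Wr ^+ 2 * Rr ^+ 2 + Wr ^+ 3 * Rr + Wr ^+ 4).
Proof.
have RW : Rr - Wr != 0.
  apply/eqP => /(congr1 (fun f : fps F2 => f 0%N)) /eqP.
  by rewrite fpsD fpsN Rr0 Wr0 fps0 add0r.
apply: (fps_mulI RW); have E := etrans (esym G4_Rr) G4_Wr.
set S := (1 + _) * _; apply: (@char2_eq _ _ (- ((Rr - Wr) * S))).
rewrite -[_ * S in RHS]addr0 -(subrr (Wr ^+ 5 + Wr ^+ 6)) -{1}E /S; ring.
Qed.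

(** [Rr5] on the generators that [Dr_E3], [Dr_E4] and [Dr_E5] evaluate after multiplication by D.
    The powers R^5 thus introduced add up to (1 + W)(1 + W + W^2) = 1 + W^3, whence the factor W^3.
    [relEps] is the version for multiplication by D^3. *)
Lemma relE : Wr ^+ 3 * Rr ^+ 5 = (1 + Wr) * ((Rr ^+ 4 + Rr ^+ 5) + (Wr + Wr ^+ 2) * (Rr ^+ 3 + Rr ^+ 5)
  + Wr ^+ 2 * (Rr ^+ 2 + Rr ^+ 3) + Wr ^+ 3 * Rr + Wr ^+ 4).
Proof.
move: Rr5; move: Wr Rr => w r E; set S := (1 + w) * _ in E.
apply: (@char2_eq _ _ (- ((1 + w) * w ^+ 2 * r ^+ 3 + (1 + w) * w * r ^+ 5 + r ^+ 5))).
transitivity (w ^+ 3 * r ^+ 5 + (S - r ^+ 5)); first by rewrite E subrr addr0.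
by rewrite /S; ring.
Qed.

Lemma relEps : Wr * Rr ^+ 5 = (1 + Wr) * ((Rr ^+ 4 + Rr ^+ 5) + Wr * Rr ^+ 3
  + Wr ^+ 2 * Rr ^+ 2 + Wr ^+ 3 * Rr + Wr ^+ 4).
Proof.
move: Rr5; move: Wr Rr => w r E; set S := (1 + w) * _ in E.
apply: (@char2_eq _ _ (- r ^+ 5)).
transitivity (w * r ^+ 5 + (S - r ^+ 5)); first by rewrite E subrr addr0.
by rewrite /S; ring.
Qed.

(** A factor D R = G is split off and R + R^2 = D^4 = F^4 + G^4 evaluates the rest; the identities
    that follow are of the same kind. *)
Lemma Dr_E3 : Dr * (Rr ^+ 2 + Rr ^+ 3) = Gf * Ff ^+ 4 + Gf ^+ 5.
Proof.
transitivity (Dr * Rr * (Rr + Rr ^+ 2)); first by ring.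
by rewrite Dr_Rr -Dr4 Dr_FG fps2_exp4D mulrDr -exprS.
Qed.

Lemma Dr_E4 : Dr * (Rr ^+ 3 + Rr ^+ 5) = Gf * Ff ^+ 8 + Gf ^+ 9.
Proof.
transitivity (Dr * Rr * (Rr ^+ 2 + (Rr ^+ 2) ^+ 2)); first by ring.
by rewrite Dr_Rr -exprM -[(2 * 2)%N]/(2 * 2)%N exprM -fps2_sqrD -Dr4 -exprM Dr_FG fps2_exp8D mulrDr -exprS.
Qed.

Lemma Dr_E5 : Dr * (Rr ^+ 4 + Rr ^+ 5) = Gf ^+ 3 * Ff ^+ 2 + Gf ^+ 5.
Proof.
transitivity (Dr * Rr * Rr ^+ 2 * (Rr + Rr ^+ 2)); first by ring.
rewrite -Dr4; transitivity ((Dr * Rr) ^+ 3 * Dr ^+ 2); first by ring.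
by rewrite Dr_Rr Dr_FG fps2_sqrD mulrDr -exprD.
Qed.

Lemma Dr3_R : Dr ^+ 3 * Rr = Gf * Ff ^+ 2 + Gf ^+ 3.
Proof.
transitivity ((Dr * Rr) * Dr ^+ 2); first by ring.
by rewrite Dr_Rr Dr_FG fps2_sqrD mulrDr -exprS.
Qed.

Lemma Dr3_R2 : Dr ^+ 3 * Rr ^+ 2 = Gf ^+ 2 * Ff + Gf ^+ 3.
Proof.
transitivity ((Dr * Rr) ^+ 2 * Dr); first by ring.
by rewrite Dr_Rr Dr_FG mulrDr -exprSr.
Qed.

Lemma Dr3_R3 : Dr ^+ 3 * Rr ^+ 3 = Gf ^+ 3.
Proof. by rewrite -exprMn Dr_Rr. Qed.

Lemma Dr3_eps : Dr ^+ 3 * (Rr ^+ 4 + Rr ^+ 5) = Gf ^+ 3 * Ff ^+ 4 + Gf ^+ 7.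
Proof.
transitivity ((Dr * Rr) ^+ 3 * (Rr + Rr ^+ 2)); first by ring.
by rewrite Dr_Rr -Dr4 Dr_FG fps2_exp4D mulrDr -exprD.
Qed.

Lemma psmulE (f g : ps) : psmul f g = (f : fps F2) * g.
Proof. by []. Qed.

Lemma psaddE (f g : ps) : psadd f g = (f : fps F2) + g.
Proof. by []. Qed.

Lemma pspowE (f : ps) k : pspow f k = (f : fps F2) ^+ k.
Proof.
elim: k => [|k IH]; first by apply: fps_ext.
by rewrite exprS -IH.
Qed.

Lemma psevalE P (g : ps) : pseval P g = pol P g.
Proof.
rewrite polE; apply: fps_ext => n; rewrite fps_sum /pseval.
by apply: eq_bigr => i _; rewrite fpsCM pspowE.
Qed.

Lemma size_inv_seq (u : ps) n : size (inv_seq u n) = n.+1.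
Proof. by elim: n => //= n IH; rewrite size_rcons IH. Qed.

Lemma nth_inv_seq (u : ps) n k : (k <= n)%N -> nth 0 (inv_seq u n) k = psinv u k.
Proof.
elim: n => [|n IH]; first by rewrite leqn0 => /eqP ->.
rewrite leq_eqVlt => /orP[/eqP -> //|kn].
by rewrite /= nth_rcons size_inv_seq kn IH.
Qed.

Lemma psinvP (u : ps) : u 0%N != 0 -> (u : fps F2) * psinv u = 1.
Proof.
move=> u0; apply: fps_ext => -[|n]; first by rewrite fpsM0 /psinv /= mulfV.
rewrite fpsM big_ord_recl subn0 fps1 /= {1}/psinv /= nth_rcons size_inv_seq ltnn eqxx.
rewrite mulNr mulrN mulrA divff // mul1r addrC; apply/eqP; rewrite subr_eq0; apply/eqP.
by apply: eq_bigr => i _; rewrite /bump /= add1n subSS nth_inv_seq ?leq_subr.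
Qed.

Definition xpow (k : nat) : fps F2 := fun n => (n == k)%:R.

Lemma xpowM k (f : fps F2) n : (xpow k * f) n = if (n < k)%N then 0 else f (n - k)%N.
Proof.
rewrite fpsM /xpow; case: ltnP => h.
  by rewrite big1 // => i _; rewrite ltn_eqF ?mul0r //; apply: leq_ltn_trans h; exact: leq_ord.
have hk : (k < n.+1)%N by [].
rewrite (bigD1 (Ordinal hk)) //= eqxx mul1r big1 ?addr0 // => i; rewrite -val_eqE /= => /negbTE ->.
by rewrite mul0r.
Qed.

Lemma psdivxE k (f : ps) : (forall i, (i < k)%N -> f i = 0) -> (f : fps F2) = xpow k * psdivx k f.
Proof.
move=> f0; apply: fps_ext => n; rewrite xpowM /psdivx; case: ltnP => h; first exact: f0.
by rewrite subnK.
Qed.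

(** Restores the factor x^5 that the definition of [J3] strips from F^8, of order 8, and from G, of
    order 5. *)
Lemma G_J3 : Gf * J3f = Ff ^+ 8.
Proof.
have o5 := ord_atX 5 rr_ord; have o6 := ord_atX 6 rr_ord.
have G0 i : (i < 5)%N -> Gf i = 0.
  by move=> h; rewrite Gf_rr fpsD o5.1 // o6.1 ?addr0 //; lia.
have F0 i : (i < 5)%N -> (Ff ^+ 8) i = 0.
  by move=> h; have [lo _] := ord_atX 8 F_ord; rewrite lo //; lia.
have G5 : psdivx 5 Gf 0%N != 0.
  by rewrite /psdivx add0n Gf_rr fpsD o6.1 // addr0; exact: o5.2.
have EJ : J3f = (psdivx 5 (Ff ^+ 8) : fps F2) * psinv (psdivx 5 Gf).
  by rewrite /J3f /J3 psmulE pspowE.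
have aux (x g g' f : fps F2) : g * g' = 1 -> x * g * (f * g') = x * f.
  by move=> E; transitivity (x * f * (g * g')); [ring|rewrite E mulr1].
rewrite EJ [RHS](psdivxE F0) [LHS](congr1 (fun h => h * _) (psdivxE G0)).
exact: aux (psinvP G5).
Qed.

(** Multiply by G = D R. The right side becomes F^8 + G^8 + G^2 (F^2 + G^2) = D^8 + G^2 D^2, where
    D^8 = (R + R^2) D^4 and G^2 D^2 = R^2 D^4; the sum is R D^4, the left side. *)
Lemma Dr3_J3 : Dr ^+ 3 = J3f + Gf * Ff ^+ 2 + Gf ^+ 3 + Gf ^+ 7.
Proof.
apply: (fps_mulI G_neq0); rewrite !mulrDr G_J3.
transitivity ((Ff ^+ 8 + Gf ^+ 8) + Gf ^+ 2 * (Ff ^+ 2 + Gf ^+ 2)); last by ring.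
rewrite -fps2_exp8D -fps2_sqrD -Dr_FG -!Dr_Rr.
have -> : Dr ^+ 8 = (Rr + Rr ^+ 2) * Dr ^+ 4 by rewrite -Dr4 -exprD.
apply: (@char2_eq _ _ (- (Rr ^+ 2 * Dr ^+ 4))); ring.
Qed.

(** * Bases over the polynomials in G^4 *)

Implicit Types (a b : fps F2).

Lemma pol0 g : pol 0 g = 0.
Proof. by rewrite /pol rmorph0 horner0. Qed.

Lemma pol_comp P Q g : pol (P \Po Q) g = pol P (pol Q g).
Proof. by rewrite /pol map_comp_poly horner_comp. Qed.

Lemma pol_dil m P g : (0 < m)%N -> pol P (dil m g) = dil m (pol P g).
Proof.
move=> m0; have dC c : dil m (fpsC c) = fpsC c :> fps F2.
  by case: (F2_case c) => ->; rewrite ?rmorph0 ?rmorph1 ?dil1 // (@dil_nat F2 m 0).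
elim/poly_ind: P => [|P c IH]; first by rewrite !pol0 (@dil_nat F2 m 0).
by rewrite !polD !polM !polX !polC dilD dilM // IH dC.
Qed.

Lemma dil_eq0 m f : (0 < m)%N -> dil m f = 0 -> f = 0.
Proof.
move=> m0 h; apply: fps_ext => n; have := congr1 (fun g : fps F2 => g (n * m)%N) h.
by rewrite /dil dvdn_mull // mulnK.
Qed.

Lemma size_1X : size (1 + 'X : {poly F2}) = 2%N.
Proof. by have := size_XaddC (1 : F2); rewrite polyC1 addrC. Qed.

(** W is rr(x^20) shifted by 1. Both the substitution and the shift are injective, so the
    transcendence of rr in [pol_inj] carries over. *)
Lemma pol_Wr_eq0 P : pol P Wr = 0 -> P = 0.
Proof.
have -> : Wr = pol (1 + 'X) (dil 20 rr) by rewrite polD polX -polyC1 polC rmorph1.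
rewrite -pol_comp pol_dil // => /dil_eq0 h.
have /eqP : P \Po (1 + 'X) = 0 by apply: pol_inj; rewrite pol0 h.
rewrite comp_poly_eq0 => [/eqP //|].
by rewrite size_1X.
Qed.

Lemma pol_G4 P : pol P (Gf ^+ 4) = pol (P \Po ('X^5 + 'X^6)) Wr.
Proof. by rewrite pol_comp polD !polXn G4_Wr. Qed.

Lemma size_q : size ('X^5 + 'X^6 : {poly F2}) = 7%N.
Proof. by rewrite addrC size_polyDl !size_polyXn. Qed.

(** As polynomials in W, by [G4_Wr], elements of F_2[G^4] have degree divisible by 6. The two
    summands thus have degrees i and j + 1 modulo 6 and cannot cancel unless both vanish. *)
Lemma pol_G4_indep P Q i j : pol P (Gf ^+ 4) * Wr ^+ i + pol Q (Gf ^+ 4) * ((1 + Wr) * Wr ^+ j) = 0 ->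
  (i %% 6 != j.+1 %% 6)%N -> P = 0 /\ Q = 0.
Proof.
move=> h ij; have q1 : (1 < size ('X^5 + 'X^6 : {poly F2})%R)%N by rewrite size_q.
have E : (P \Po ('X^5 + 'X^6)) * 'X^i + (Q \Po ('X^5 + 'X^6)) * ((1 + 'X) * 'X^j) = 0.
  apply: pol_Wr_eq0; rewrite -h !pol_G4.
  by rewrite !(polD, polM, polXn, polX) -polyC1 polC rmorph1.
have X1 : (1 + 'X : {poly F2}) != 0 by rewrite -size_poly_eq0 size_1X.
have Y0 : (1 + 'X) * 'X^j != 0 :> {poly F2} by rewrite mulf_neq0 // -size_poly_eq0 size_polyXn.
have Xj : 'X^j != 0 :> {poly F2} by rewrite -size_poly_eq0 size_polyXn.
have Z0 : 'X^i != 0 :> {poly F2} by rewrite -size_poly_eq0 size_polyXn.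
have [P0|P0] := eqVneq P 0.
  split=> //; move: E; rewrite P0 comp_poly0 mul0r add0r => /eqP.
  by rewrite mulf_eq0 (negbTE Y0) orbF comp_poly_eq0 // => /eqP.
have [Q0|Q0] := eqVneq Q 0.
  by move: E; rewrite Q0 comp_poly0 mul0r addr0 => /eqP; rewrite mulf_eq0 (negbTE Z0) orbF comp_poly_eq0 // (negbTE P0).
have P0' : P \Po ('X^5 + 'X^6) != 0 by rewrite comp_poly_eq0.
have Q0' : Q \Po ('X^5 + 'X^6) != 0 by rewrite comp_poly_eq0.
have : size ((P \Po ('X^5 + 'X^6)) * 'X^i) = size ((Q \Po ('X^5 + 'X^6)) * ((1 + 'X) * 'X^j)).
  by rewrite -[RHS]size_polyN; congr (size (polyseq _)); apply/eqP; rewrite -addr_eq0 E.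
rewrite (size_mul P0' Z0) (size_mul Q0' Y0) (size_mul X1 Xj) !size_polyXn size_1X.
have := size_comp_poly P ('X^5 + 'X^6); have := size_comp_poly Q ('X^5 + 'X^6); rewrite size_q /=.
move: P0' Q0'; rewrite -!size_poly_gt0; move: (size _) (size (P \Po _)) => s t s0 t0.
move/eqP: ij; move: (size Q).-1 (size P).-1 => u v; lia.
Qed.

Lemma Rr6 : Rr ^+ 6 = Gf ^+ 4 + Rr ^+ 5.
Proof. by rewrite G4_Rr addrC addrA fps2_addxx add0r. Qed.

(** R^6 = G^4 + R^5 reduces every higher power of R. *)
Lemma pol_Rr_basis P : exists c0 c1 c2 c3 c4 c5, pol P Rr = pol c0 (Gf ^+ 4) + pol c1 (Gf ^+ 4) * Rr +
  pol c2 (Gf ^+ 4) * Rr ^+ 2 + pol c3 (Gf ^+ 4) * Rr ^+ 3 + pol c4 (Gf ^+ 4) * Rr ^+ 4 +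
  pol c5 (Gf ^+ 4) * Rr ^+ 5.
Proof.
elim/poly_ind: P => [|P c [c0 [c1 [c2 [c3 [c4 [c5 IH]]]]]]].
  by exists 0, 0, 0, 0, 0, 0; rewrite !pol0 !mul0r !addr0.
exists (c5 * 'X + c%:P), c0, c1, c2, c3, (c4 + c5).
rewrite !polD !polM !polX !polC IH; move: Rr6; move: (Gf ^+ 4) Rr => G R R6.
move: (pol c0 G) (pol c1 G) (pol c2 G) (pol c3 G) (pol c4 G) (pol c5 G) => C0 C1 C2 C3 C4 C5.
transitivity (C5 * R ^+ 6 + fpsC c + C0 * R + C1 * R ^+ 2 + C2 * R ^+ 3 + C3 * R ^+ 4 + C4 * R ^+ 5).
  by ring.
by rewrite R6; ring.
Qed.

Lemma pol_Rr_basisE P : exists c0 c1 c2 c3 c4 c5, pol P Rr = pol c0 (Gf ^+ 4) + pol c1 (Gf ^+ 4) * Rr +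
  pol c2 (Gf ^+ 4) * (Rr ^+ 2 + Rr ^+ 3) + pol c3 (Gf ^+ 4) * (Rr ^+ 3 + Rr ^+ 5) +
  pol c4 (Gf ^+ 4) * (Rr ^+ 4 + Rr ^+ 5) + pol c5 (Gf ^+ 4) * Rr ^+ 5.
Proof.
have [c0 [c1 [c2 [c3 [c4 [c5 ->]]]]]] := pol_Rr_basis P.
exists c0, c1, c2, (c2 + c3), c4, (c2 + c3 + c4 + c5); rewrite !polD.
move: (Gf ^+ 4) Rr => G R.
move: (pol c0 G) (pol c1 G) (pol c2 G) (pol c3 G) (pol c4 G) (pol c5 G) => C0 C1 C2 C3 C4 C5.
by apply: (@char2_eq _ _ (- (C2 * R ^+ 3 + (C2 + C3 + C4) * R ^+ 5))); ring.
Qed.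

Lemma pol_Rr_basis_eps P : exists c0 c1 c2 c3 c4 c5, pol P Rr = pol c0 (Gf ^+ 4) + pol c1 (Gf ^+ 4) * Rr +
  pol c2 (Gf ^+ 4) * Rr ^+ 2 + pol c3 (Gf ^+ 4) * Rr ^+ 3 +
  pol c4 (Gf ^+ 4) * (Rr ^+ 4 + Rr ^+ 5) + pol c5 (Gf ^+ 4) * Rr ^+ 5.
Proof.
have [c0 [c1 [c2 [c3 [c4 [c5 ->]]]]]] := pol_Rr_basis P.
exists c0, c1, c2, c3, c4, (c4 + c5); rewrite !polD.
move: (Gf ^+ 4) Rr => G R.
move: (pol c0 G) (pol c1 G) (pol c2 G) (pol c3 G) (pol c4 G) (pol c5 G) => C0 C1 C2 C3 C4 C5.
by apply: (@char2_eq _ _ (- (C4 * R ^+ 5))); ring.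
Qed.

Definition per5 S := forall n, S (n + 5)%N = S n.

Lemma Gf_on5 k : on5 (Gf ^+ k). Proof. exact: on5X G_on5. Qed.

Lemma polG_on5 P : on5 (pol P (Gf ^+ 4)). Proof. exact: on5_pol (Gf_on5 4). Qed.

Lemma prj_polG S P f : per5 S -> prj S (pol P (Gf ^+ 4) * f) = pol P (Gf ^+ 4) * prj S f.
Proof. by move=> s5; rewrite (prjM5 _ (polG_on5 P)). Qed.

Lemma prj_Gf S k f : per5 S -> prj S (Gf ^+ k * f) = Gf ^+ k * prj S f.
Proof. by move=> s5; rewrite (prjM5 _ (Gf_on5 k)). Qed.

Lemma prj_G1 S f : per5 S -> prj S (Gf * f) = Gf * prj S f.
Proof. by move=> s5; rewrite (prjM5 _ G_on5). Qed.

Lemma prj_Wr S k f : per5 S -> prj S (Wr ^+ k * f) = Wr ^+ k * prj S f.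
Proof. by move=> s5; rewrite (prjM5 _ (on5X k Wr_on5)). Qed.

Lemma prj_W1 S f : per5 S -> prj S ((1 + Wr) * f) = (1 + Wr) * prj S f.
Proof. by move=> s5; rewrite (prjM5 _ (on5D on5_1 Wr_on5)). Qed.

Lemma prjN_on5 a : on5 a -> prj Nc a = 0.
Proof. by move=> ha; apply: (prj_disj ha) => n; rewrite /Nc; lia. Qed.

Lemma prjQ_on5 a : on5 a -> prj Qc a = 0.
Proof. by move=> ha; apply: (prj_disj ha) => n; rewrite /Qc; lia. Qed.

(** F has square exponents, so F and F^4 avoid the non-squares modulo 5, while F^2 and F^8, with
    exponents 2 and 8 times squares, avoid the nonzero squares. *)
Lemma prjN_F : prj Nc Ff = 0.
Proof. by apply: (prj_disj F_on5) => n; rewrite negbK. Qed.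

Lemma prjN_F4 : prj Nc (Ff ^+ 4) = 0.
Proof.
rewrite frob4; apply: (prj_disj (T := fun n => ~~ Nc n)); last by move=> n; rewrite negbK.
by apply: on_dil F_on5 => // n; rewrite /Nc; lia.
Qed.

Lemma prjQ_F2 : prj Qc (Ff ^+ 2) = 0.
Proof.
rewrite frob; apply: (prj_disj (T := fun n => ~~ Qc n)); last by move=> n; rewrite negbK.
by apply: on_dil F_on5 => // n; rewrite /Qc /Nc; lia.
Qed.

Lemma prjQ_F8 : prj Qc (Ff ^+ 8) = 0.
Proof.
rewrite frob8; apply: (prj_disj (T := fun n => ~~ Qc n)); last by move=> n; rewrite negbK.
by apply: on_dil F_on5 => // n; rewrite /Qc /Nc; lia.
Qed.

Lemma prjQ_J3 : prj Qc J3f = 0.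
Proof.
apply: (fps_mulI G_neq0); rewrite mulr0 -(prj_G1 _ Qc5) G_J3.
exact: prjQ_F8.
Qed.

Lemma prjN_J3 : Gf * prj Nc J3f = prj Nc (Ff ^+ 8).
Proof. by rewrite -(prj_G1 _ Nc5) G_J3. Qed.

(** The orders 8 and 2 lie in the two different non-square classes modulo 5; in [indepQ] the orders
    4 and 1 lie in the two square classes. *)
Lemma indepN a b : on5 a -> on5 b -> a * prj Nc (Ff ^+ 8) + b * prj Nc (Ff ^+ 2) = 0 -> a = 0 /\ b = 0.
Proof.
by rewrite frob8 frob; apply: (@indep5 _ _ 8 2) => //; exact: F_dil_ord.
Qed.

Lemma indepQ a b : on5 a -> on5 b -> a * prj Qc (Ff ^+ 4) + b * prj Qc Ff = 0 -> a = 0 /\ b = 0.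
Proof.
rewrite frob4; apply: (@indep5 _ _ 4 1) => //; first exact: F_dil_ord.
have -> : Ff = dil 1 Fser by apply: fps_ext => n; rewrite /dil dvd1n divn1.
exact: F_dil_ord.
Qed.

(** * The four kernels *)

Local Notation "p `G" := (pol p (Gf ^+ 4)) (at level 2, format "p `G").

Ltac on5_tac := repeat (first [exact: polG_on5|exact: Gf_on5|exact: Wr_on5|exact: on5_1|
  exact: G_on5|apply: on5X|apply: on5D|apply: on5M]).

Opaque Dr Wr Rr Gf Ff J3f.

Lemma mulG_eq0 k a : Gf ^+ k * a = 0 -> a = 0.
Proof.
elim: k => [|k IH]; first by rewrite mul1r.
by rewrite exprS -mulrA => /fps_mulf_eq0[/eqP|//]; rewrite (negbTE G_neq0).
Qed.

Lemma mulW_eq0 k a : a * Wr ^+ k = 0 -> a = 0.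
Proof.
elim: k => [|k IH]; first by rewrite mulr1.
by rewrite exprSr mulrA => /fps_mulf_eq0[//|/eqP]; rewrite (negbTE Wr_neq0).
Qed.

Lemma prjN_GD k l f : prj Nc (Gf ^+ k * f + Gf ^+ l) = Gf ^+ k * prj Nc f.
Proof. by rewrite prjD (prj_Gf _ _ Nc5) (prjN_on5 (Gf_on5 l)) addr0. Qed.

Lemma prjQ_GD k l f : prj Qc (Gf ^+ k * f + Gf ^+ l) = Gf ^+ k * prj Qc f.
Proof. by rewrite prjD (prj_Gf _ _ Qc5) (prjQ_on5 (Gf_on5 l)) addr0. Qed.

Lemma prjN_D : prj Nc Dr = 0.
Proof. by rewrite Dr_FG prjD prjN_F (prjN_on5 G_on5) addr0. Qed.

Lemma prjQ_D : prj Qc Dr = prj Qc Ff.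
Proof. by rewrite Dr_FG prjD (prjQ_on5 G_on5) addr0. Qed.

Lemma prjN_D3 : prj Nc (Dr ^+ 3) = prj Nc J3f + Gf * prj Nc (Ff ^+ 2).
Proof.
rewrite Dr3_J3 !prjD (prjN_on5 (Gf_on5 3)) (prjN_on5 (Gf_on5 7)) !addr0.
by rewrite (prj_G1 _ Nc5).
Qed.

Lemma prjQ_D3 : prj Qc (Dr ^+ 3) = 0.
Proof.
rewrite Dr3_J3 !prjD (prjQ_on5 (Gf_on5 3)) (prjQ_on5 (Gf_on5 7)) !addr0 prjQ_J3 add0r.
by rewrite (prj_G1 _ Qc5) prjQ_F2 mulr0.
Qed.

(** [relE] times D. The exponents 1 are kept so that every summand has the shape rewritten by
    [prj_Wr], [prjN_GD] and [prjQ_GD]. *)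
Lemma relE_Dr : Wr ^+ 3 * (Dr * Rr ^+ 5) = (1 + Wr) * ((Gf ^+ 3 * Ff ^+ 2 + Gf ^+ 5) +
  (Wr ^+ 1 * (Gf ^+ 1 * Ff ^+ 8 + Gf ^+ 9) + Wr ^+ 2 * (Gf ^+ 1 * Ff ^+ 8 + Gf ^+ 9)) +
  Wr ^+ 2 * (Gf ^+ 1 * Ff ^+ 4 + Gf ^+ 5) + Wr ^+ 3 * Gf ^+ 1 + Wr ^+ 4 * Dr).
Proof.
rewrite !expr1 -Dr_E5 -Dr_E4 -Dr_E3 -Dr_Rr.
transitivity (Dr * (Wr ^+ 3 * Rr ^+ 5)); first by ring.
by rewrite relE; ring.
Qed.

Lemma relEps_Dr3 : Wr ^+ 1 * (Dr ^+ 3 * Rr ^+ 5) = (1 + Wr) * ((Gf ^+ 3 * Ff ^+ 4 + Gf ^+ 7) +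
  Wr ^+ 1 * Gf ^+ 3 + Wr ^+ 2 * (Gf ^+ 2 * Ff + Gf ^+ 3) +
  Wr ^+ 3 * (Gf ^+ 1 * Ff ^+ 2 + Gf ^+ 3) + Wr ^+ 4 * Dr ^+ 3).
Proof.
rewrite !expr1 -Dr3_eps -Dr3_R2 -Dr3_R -Dr3_R3.
transitivity (Dr ^+ 3 * (Wr * Rr ^+ 5)); first by ring.
by rewrite relEps; ring.
Qed.

Lemma prjN_relE : Wr ^+ 3 * prj Nc (Dr * Rr ^+ 5) = (1 + Wr) * (Gf ^+ 3 * prj Nc (Ff ^+ 2) +
  (Wr ^+ 1 * (Gf ^+ 1 * prj Nc (Ff ^+ 8)) + Wr ^+ 2 * (Gf ^+ 1 * prj Nc (Ff ^+ 8)))).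
Proof.
rewrite -(prj_Wr _ _ Nc5) relE_Dr (prj_W1 _ Nc5) !prjD !(prj_Wr _ _ Nc5) -!prjD !prjN_GD prjN_F4 prjN_D.
by rewrite (prjN_on5 (Gf_on5 1)) !mulr0 !addr0.
Qed.

Lemma prjQ_relE : Wr ^+ 3 * prj Qc (Dr * Rr ^+ 5) = (1 + Wr) * (Wr ^+ 2 * (Gf ^+ 1 * prj Qc (Ff ^+ 4))
  + Wr ^+ 4 * prj Qc Ff).
Proof.
rewrite -(prj_Wr _ _ Qc5) relE_Dr (prj_W1 _ Qc5) !prjD !(prj_Wr _ _ Qc5) -!prjD !prjQ_GD prjQ_F8 prjQ_F2 prjQ_D.
by rewrite (prjQ_on5 (Gf_on5 1)) !mulr0 !addr0 !add0r.
Qed.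

Lemma prjN_relEps : Wr ^+ 1 * prj Nc (Dr ^+ 3 * Rr ^+ 5) = (1 + Wr) * (Wr ^+ 3 * (Gf ^+ 1 * prj Nc (Ff ^+ 2))
  + Wr ^+ 4 * (prj Nc J3f + Gf * prj Nc (Ff ^+ 2))).
Proof.
rewrite -(prj_Wr _ _ Nc5) relEps_Dr3 (prj_W1 _ Nc5) !prjD !(prj_Wr _ _ Nc5) -!prjD !prjN_GD prjN_F4 prjN_F prjN_D3.
by rewrite (prjN_on5 (Gf_on5 3)) !mulr0 !add0r.
Qed.

Lemma prjQ_relEps : Wr ^+ 1 * prj Qc (Dr ^+ 3 * Rr ^+ 5) = (1 + Wr) * (Gf ^+ 3 * prj Qc (Ff ^+ 4)
  + Wr ^+ 2 * (Gf ^+ 2 * prj Qc Ff)).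
Proof.
rewrite -(prj_Wr _ _ Qc5) relEps_Dr3 (prj_W1 _ Qc5) !prjD !(prj_Wr _ _ Qc5) -!prjD !prjQ_GD prjQ_F2 prjQ_D3.
by rewrite (prjQ_on5 (Gf_on5 3)) !mulr0 !addr0.
Qed.

Lemma Dr_pol_basis P : exists c0 c1 c2 c3 c4 c5, Dr * pol P Rr = c0`G * Dr + c1`G * Gf ^+ 1 +
  c2`G * (Gf ^+ 1 * Ff ^+ 4 + Gf ^+ 5) + c3`G * (Gf ^+ 1 * Ff ^+ 8 + Gf ^+ 9) +
  c4`G * (Gf ^+ 3 * Ff ^+ 2 + Gf ^+ 5) + c5`G * (Dr * Rr ^+ 5).
Proof.
have [c0 [c1 [c2 [c3 [c4 [c5 ->]]]]]] := pol_Rr_basisE P; exists c0, c1, c2, c3, c4, c5.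
rewrite !expr1 -Dr_E5 -Dr_E4 -Dr_E3.
move: (c0`G) (c1`G) (c2`G) (c3`G) (c4`G) (c5`G) => C0 C1 C2 C3 C4 C5.
by rewrite -Dr_Rr; ring.
Qed.

Lemma Dr3_pol_basis P : exists c0 c1 c2 c3 c4 c5, Dr ^+ 3 * pol P Rr = c0`G * Dr ^+ 3 +
  c1`G * (Gf ^+ 1 * Ff ^+ 2 + Gf ^+ 3) + c2`G * (Gf ^+ 2 * Ff + Gf ^+ 3) + c3`G * Gf ^+ 3 +
  c4`G * (Gf ^+ 3 * Ff ^+ 4 + Gf ^+ 7) + c5`G * (Dr ^+ 3 * Rr ^+ 5).
Proof.
have [c0 [c1 [c2 [c3 [c4 [c5 ->]]]]]] := pol_Rr_basis_eps P; exists c0, c1, c2, c3, c4, c5.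
rewrite !expr1 -Dr3_eps -Dr3_R2 -Dr3_R.
move: (c0`G) (c1`G) (c2`G) (c3`G) (c4`G) (c5`G) => C0 C1 C2 C3 C4 C5.
by rewrite -Dr3_R3; ring.
Qed.

(** Only the terms in F^8, F^2 and D R^5 survive the projection. After multiplication by W^3 the
    last becomes a combination of the first two, which [indepN] separates. In the coefficient of F^2
    the degrees in W are 3 and 1 modulo 6, so c4 and c5 vanish, and then c3. *)
Lemma prjN_Dr_eq0 P : prj Nc (Dr * pol P Rr) = 0 -> exists c0 c1 c2,
  Dr * pol P Rr = c0`G * Dr + c1`G * Gf + c2`G * (Gf * Ff ^+ 4 + Gf ^+ 5).
Proof.
have [c0 [c1 [c2 [c3 [c4 [c5 E]]]]]] := Dr_pol_basis P; rewrite E.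
rewrite !prjD !(prj_polG _ _ Nc5) !prjN_GD prjN_D prjN_F4 (prjN_on5 (Gf_on5 1)).
rewrite !mulr0 !add0r => H; have K := prjN_relE.
have [|||a0 b0] := @indepN (Wr ^+ 3 * c3`G * Gf ^+ 1 + c5`G * ((1 + Wr) * ((Wr ^+ 1 + Wr ^+ 2) * Gf ^+ 1)))
    (Gf ^+ 3 * (c4`G * Wr ^+ 3 + c5`G * ((1 + Wr) * Wr ^+ 0))).
- by on5_tac.
- by on5_tac.
- move: (prj Nc (Dr * _)) (prj Nc (Ff ^+ 8)) (prj Nc (Ff ^+ 2)) H K => k f8 f2 H K.
  rewrite -[RHS](mulr0 (Wr ^+ 3)) -{}H.
  transitivity (Wr ^+ 3 * (c3`G * (Gf ^+ 1 * f8) + c4`G * (Gf ^+ 3 * f2)) + c5`G * (Wr ^+ 3 * k)).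
    by rewrite K; ring.
  by ring.
have [c40 c50] := pol_G4_indep (mulG_eq0 b0) isT.
have c30 : c3`G = 0.
  apply: (@mulW_eq0 3); apply: (@mulG_eq0 1); move: a0.
  by rewrite c50 pol0 mul0r addr0 => <-; ring.
by exists c0, c1, c2; rewrite c30 c40 c50 !pol0 !mul0r !addr0 !expr1.
Qed.

(** Here F^4 and F survive. The coefficient of F has degrees 3 and 5 modulo 6 in W, which kills c0
    and c5, then c2. *)
Lemma prjQ_Dr_eq0 P : prj Qc (Dr * pol P Rr) = 0 -> exists c1 c3 c4,
  Dr * pol P Rr = c1`G * Gf + c3`G * (Gf * Ff ^+ 8 + Gf ^+ 9) + c4`G * (Gf ^+ 3 * Ff ^+ 2 + Gf ^+ 5).
Proof.
have [c0 [c1 [c2 [c3 [c4 [c5 E]]]]]] := Dr_pol_basis P; rewrite E.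
rewrite !prjD !(prj_polG _ _ Qc5) !prjQ_GD prjQ_D prjQ_F2 prjQ_F8 (prjQ_on5 (Gf_on5 1)).
rewrite !mulr0 !addr0 => H; have K := prjQ_relE.
have [|||a0 b0] := @indepQ (Gf ^+ 1 * (c2`G * Wr ^+ 3 + c5`G * ((1 + Wr) * Wr ^+ 2)))
    (c0`G * Wr ^+ 3 + c5`G * ((1 + Wr) * Wr ^+ 4)).
- by on5_tac.
- by on5_tac.
- move: (prj Qc (Dr * _)) (prj Qc (Ff ^+ 4)) (prj Qc Ff) H K => k f4 f1 H K.
  rewrite -[RHS](mulr0 (Wr ^+ 3)) -{}H.
  transitivity (Wr ^+ 3 * (c0`G * f1 + c2`G * (Gf ^+ 1 * f4)) + c5`G * (Wr ^+ 3 * k)).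
    by rewrite K; ring.
  by ring.
have [c00 c50] := pol_G4_indep b0 isT.
have c20 : c2`G = 0.
  apply: (@mulW_eq0 3); apply: (@mulG_eq0 1); move: a0.
  by rewrite c50 pol0 mul0r addr0.
by exists c1, c3, c4; rewrite c00 c20 c50 !pol0 !mul0r !addr0 !add0r !expr1.
Qed.

(** D^3 has no exponents in the square classes, so c0 stays free. The coefficient of F has degrees 1
    and 3 modulo 6 in W, which kills c2 and c5, then c4. *)
Lemma prjQ_Dr3_eq0 P : prj Qc (Dr ^+ 3 * pol P Rr) = 0 -> exists c0 c1 c3,
  Dr ^+ 3 * pol P Rr = c0`G * Dr ^+ 3 + c1`G * (Gf * Ff ^+ 2 + Gf ^+ 3) + c3`G * Gf ^+ 3.
Proof.
have [c0 [c1 [c2 [c3 [c4 [c5 E]]]]]] := Dr3_pol_basis P; rewrite E.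
rewrite !prjD !(prj_polG _ _ Qc5) !prjQ_GD prjQ_D3 prjQ_F2 (prjQ_on5 (Gf_on5 3)).
rewrite !mulr0 !addr0 !add0r => H; have K := prjQ_relEps.
have [|||a0 b0] := @indepQ (Gf ^+ 3 * (c4`G * Wr ^+ 1 + c5`G * (1 + Wr)))
    (Gf ^+ 2 * (c2`G * Wr ^+ 1 + c5`G * ((1 + Wr) * Wr ^+ 2))).
- by on5_tac.
- by on5_tac.
- move: (prj Qc (Dr ^+ 3 * _)) (prj Qc (Ff ^+ 4)) (prj Qc Ff) H K => k f4 f1 H K.
  rewrite -[RHS](mulr0 (Wr ^+ 1)) -{}H.
  transitivity (Wr ^+ 1 * (c2`G * (Gf ^+ 2 * f1) + c4`G * (Gf ^+ 3 * f4)) + c5`G * (Wr ^+ 1 * k)).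
    by rewrite K; ring.
  by ring.
have [c20 c50] := pol_G4_indep (mulG_eq0 b0) isT.
have c40 : c4`G = 0.
  apply: (@mulW_eq0 1); apply: (@mulG_eq0 3); move: a0.
  by rewrite c50 pol0 mul0r addr0.
by exists c0, c1, c3; rewrite c20 c40 c50 !pol0 !mul0r !addr0 !expr1.
Qed.

(** J3 enters as F^8/G, so the relation is multiplied by G as well as by W. The coefficient of F^8
    has degrees 1 and 5 modulo 6 in W, which kills c0 and c5, then c1. *)
Lemma prjN_Dr3_eq0 P : prj Nc (Dr ^+ 3 * pol P Rr) = 0 -> exists c2 c3 c4,
  Dr ^+ 3 * pol P Rr = c2`G * (Gf ^+ 2 * Ff + Gf ^+ 3) + c3`G * Gf ^+ 3 +
    c4`G * (Gf ^+ 3 * Ff ^+ 4 + Gf ^+ 7).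
Proof.
have [c0 [c1 [c2 [c3 [c4 [c5 E]]]]]] := Dr3_pol_basis P; rewrite E.
rewrite !prjD !(prj_polG _ _ Nc5) !prjN_GD prjN_D3 prjN_F prjN_F4 (prjN_on5 (Gf_on5 3)).
rewrite !mulr0 !addr0 => H; have K := prjN_relEps; have J := prjN_J3.
have [|||a0 b0] := @indepN (c0`G * Wr ^+ 1 + c5`G * ((1 + Wr) * Wr ^+ 4))
    (Gf ^+ 2 * (c0`G * Wr ^+ 1 + c1`G * Wr ^+ 1 + c5`G * ((1 + Wr) * (Wr ^+ 3 + Wr ^+ 4)))).
- by on5_tac.
- by on5_tac.
- rewrite -J.
  move: (prj Nc (Dr ^+ 3 * _)) (prj Nc J3f) (prj Nc (Ff ^+ 2)) H K => k j3 f2 H K.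
  rewrite -[RHS](mulr0 (Gf * Wr ^+ 1)) -{}H.
  transitivity (Gf * (Wr ^+ 1 * (c0`G * (j3 + Gf * f2) + c1`G * (Gf ^+ 1 * f2)) + c5`G * (Wr ^+ 1 * k))).
    by rewrite K; ring.
  by ring.
have [c00 c50] := pol_G4_indep a0 isT.
have c10 : c1`G = 0.
  apply: (@mulW_eq0 1); apply: (@mulG_eq0 2); move: b0.
  by rewrite c00 c50 pol0 !mul0r addr0 add0r.
by exists c2, c3, c4; rewrite c00 c10 c50 !pol0 !mul0r !addr0 !add0r.
Qed.

Transparent Dr Wr Rr Gf Ff J3f.

(** * The theorem *)

Local Notation on4 c := (on (fun n => n %% 4 == c)%N).

Lemma on4M c d f g : on4 c f -> on4 d g -> on4 ((c + d) %% 4)%N (f * g).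
Proof. by apply: onM => i j /eqP <- /eqP <-; rewrite modnDm. Qed.

Lemma on4X c f k : on4 c f -> on4 ((c * k) %% 4)%N (f ^+ k).
Proof.
move=> hf; elim: k => [|k IH]; first by rewrite muln0 mod0n => -[|n].
by rewrite exprS mulnS -modnDmr; exact: on4M.
Qed.

Arguments on4X {c f} k _.

Lemma Dr_on4 : on4 1%N Dr.
Proof. by rewrite Dr_FG; exact: onD F_on4 G_on4. Qed.

Lemma pol_dil4 P f : on4 0%N (pol P (f ^+ 4)).
Proof.
rewrite frob4 pol_dil //; apply: (on_dil (S := predT)) => // n _.
by rewrite modnMr.
Qed.

Lemma DrP_on4 P : on4 1%N (Dr * pol P Rr).
Proof. exact: (on4M Dr_on4 (pol_dil4 _ _)). Qed.

Lemma Dr3P_on4 P : on4 3%N (Dr ^+ 3 * pol P Rr).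
Proof. exact: (on4M (on4X 3 Dr_on4) (pol_dil4 _ _)). Qed.

Lemma J3_on4 : on4 3%N J3f.
Proof.
have -> : J3f = Dr ^+ 3 + (Gf * Ff ^+ 2 + (Gf ^+ 3 + Gf ^+ 7)).
  apply: (@char2_eq _ _ (- (Gf * Ff ^+ 2 + Gf ^+ 3 + Gf ^+ 7))); rewrite Dr3_J3; ring.
apply: onD (on4X 3 Dr_on4) (onD (on4M G_on4 (on4X 2 F_on4)) (onD (on4X 3 G_on4) (on4X 7 G_on4))).
Qed.

Lemma pol_split P g : exists A B, pol P g = pol A (g ^+ 2) + g * pol B (g ^+ 2).
Proof.
elim/poly_ind: P => [|P c [A [B IH]]].
  by exists 0, 0; rewrite !pol0 mulr0 addr0.
exists (B * 'X + c%:P), A; rewrite !polD !polM !polX !polC IH.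
by move: (pol A _) (pol B _) => x y; ring.
Qed.

(** As r = D + r^2, splitting P by parity gives a series in x^2 plus D B(r^2), and oddness kills the
    former. Splitting B once more and using r^2 = D^2 + R produces the exponents 1 and 3 of D. *)
Lemma odd_pol P : (forall n, ~~ odd n -> pol P rr n = 0) ->
  exists A B, pol P rr = Dr * pol A Rr + Dr ^+ 3 * pol B Rr.
Proof.
move=> hP; have [A [B E]] := pol_split P rr.
have E2 : pol P rr = (pol A (rr ^+ 2) + rr ^+ 2 * pol B (rr ^+ 2)) + Dr * pol B (rr ^+ 2).
  rewrite E; apply: (@char2_eq _ _ (- (rr ^+ 2 * pol B (rr ^+ 2)))).
  by rewrite /Dr; move: (pol A _) (pol B _) => x y; ring.
have ev2 Q : on (fun n => ~~ odd n) (pol Q (rr ^+ 2)).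
  rewrite frob pol_dil //; apply: (on_dil (S := predT)) => // n _.
  by rewrite mul2n odd_double.
have hE : on (fun n => ~~ odd n) (pol A (rr ^+ 2) + rr ^+ 2 * pol B (rr ^+ 2)).
  have -> : pol A (rr ^+ 2) + rr ^+ 2 * pol B (rr ^+ 2) = pol (A + 'X * B) (rr ^+ 2).
    by rewrite polD polM polX.
  exact: ev2.
have hO : on odd (Dr * pol B (rr ^+ 2)).
  apply: onM Dr_on4 (ev2 B) => i j; rewrite oddD => /eqP i1 /negbTE ->.
  by rewrite addbF; lia.
have E0 : pol A (rr ^+ 2) + rr ^+ 2 * pol B (rr ^+ 2) = 0.
  apply: fps_ext => n; rewrite fps0; have [on|en] := boolP (odd n); first by apply: hE; rewrite on.
  by have := hP n en; rewrite E2 fpsD (hO n en) addr0.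
have [A' [B' E3]] := pol_split B (rr ^+ 2).
have R4 : (rr ^+ 2) ^+ 2 = Rr by rewrite -exprM.
exists (A' + 'X * B'), B'; rewrite E2 E0 add0r E3 R4 !polD polM polX.
have -> : rr ^+ 2 = Dr ^+ 2 + Rr.
  rewrite /Dr fps2_sqrD -exprM; apply: (@char2_eq _ _ (- Rr)); rewrite /Rr; ring.
by move: Dr Rr (pol A' _) (pol B' _) => d r x y; ring.
Qed.

Definition isp f := exists P, f = pol P rr.

Lemma ispD f g : isp f -> isp g -> isp (f + g).
Proof. by move=> [P ->] [Q ->]; exists (P + Q); rewrite polD. Qed.
Lemma ispM f g : isp f -> isp g -> isp (f * g).
Proof. by move=> [P ->] [Q ->]; exists (P * Q); rewrite polM. Qed.
Lemma isp_pol Q f : isp f -> isp (pol Q f).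
Proof. by move=> [P ->]; exists (Q \Po P); rewrite pol_comp. Qed.
Lemma ispX f k : isp f -> isp (f ^+ k).
Proof. by move=> h; rewrite -polXn; exact: isp_pol. Qed.
Lemma isp_rr : isp rr. Proof. by exists 'X; rewrite polX. Qed.
Lemma isp_G : isp Gf. Proof. by rewrite Gf_rr; apply: ispD; apply: ispX isp_rr. Qed.
Lemma isp_D : isp Dr. Proof. exact: ispD isp_rr (ispX 2 isp_rr). Qed.
Lemma isp_F : isp Ff. Proof. by rewrite Ff_DG; exact: ispD isp_D isp_G. Qed.
Lemma isp_J3 : isp J3f.
Proof.
have -> : J3f = Dr ^+ 3 + (Gf * Ff ^+ 2 + (Gf ^+ 3 + Gf ^+ 7)).
  apply: (@char2_eq _ _ (- (Gf * Ff ^+ 2 + Gf ^+ 3 + Gf ^+ 7))); rewrite Dr3_J3; ring.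
exact: ispD (ispX 3 isp_D) (ispD (ispM isp_G (ispX 2 isp_F)) (ispD (ispX 3 isp_G) (ispX 7 isp_G))).
Qed.

(* [A] carries the exponents 1 mod 4, [B] those 3 mod 4, [H] is the [N1] part. *)
Lemma N2aP f : inN2a_modN1 f <-> exists P1 P3 P7 P9 Q, f =
  (P1`G * Ff + P9`G * (Gf * Ff ^+ 4)) + (P3`G * J3f + P7`G * (Gf * Ff ^+ 2)) + pol Q (Gf ^+ 2) * Gf.
Proof.
have E P1 P3 P7 P9 h : psadd (psadd (psadd (psmul (pseval P1 (pspow Gser 4)) J1)
    (psmul (pseval P3 (pspow Gser 4)) J3)) (psadd (psmul (pseval P7 (pspow Gser 4)) J7)
    (psmul (pseval P9 (pspow Gser 4)) J9))) h = (P1`G * Ff + P9`G * (Gf * Ff ^+ 4)) +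
    (P3`G * J3f + P7`G * (Gf * Ff ^+ 2)) + (h : fps F2).
  rewrite /J1 /J7 /J9 !psaddE !psmulE !psevalE !pspowE -/Ff -/Gf -/J3f.
  rewrite [Gf * Ff ^+ 4]mulrC [Gf * Ff ^+ 2]mulrC.
  by move: (_ * Ff) (_ * J3f) (_ * (Ff ^+ 2 * _)) (_ * (Ff ^+ 4 * _)) => x y z t; ring.
split=> [[P1 [P3 [P7 [P9 [h [[Q hQ] fE]]]]]]|[P1 [P3 [P7 [P9 [Q fE]]]]]].
  exists P1, P3, P7, P9, Q; apply: fps_ext => n; rewrite fE E; congr ((_ + _ : fps F2) n).
  by apply: fps_ext => k; rewrite hQ psmulE psevalE pspowE.
exists P1, P3, P7, P9, (pol Q (Gf ^+ 2) * Gf); split.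
  by exists Q => k; rewrite psmulE psevalE pspowE.
by move=> n; rewrite E fE.
Qed.

Lemma N2bP f : inN2b_modN1 f <-> exists P11 P13 P17 P19 Q, f =
  (P13`G * (Gf ^+ 2 * J3f) + P17`G * (Gf ^+ 3 * Ff ^+ 2)) +
  (P11`G * (Gf ^+ 2 * Ff) + P19`G * (Gf ^+ 3 * Ff ^+ 4)) + pol Q (Gf ^+ 2) * Gf.
Proof.
have E P1 P3 P7 P9 h : psadd (psadd (psadd (psmul (pseval P1 (pspow Gser 4)) J11)
    (psmul (pseval P3 (pspow Gser 4)) J13)) (psadd (psmul (pseval P7 (pspow Gser 4)) J17)
    (psmul (pseval P9 (pspow Gser 4)) J19))) h = (P3`G * (Gf ^+ 2 * J3f) + P7`G * (Gf ^+ 3 * Ff ^+ 2)) +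
    (P1`G * (Gf ^+ 2 * Ff) + P9`G * (Gf ^+ 3 * Ff ^+ 4)) + (h : fps F2).
  rewrite /J11 /J13 /J17 /J19 /J1 /J7 /J9 !psaddE !psmulE !psevalE !pspowE -/Ff -/Gf -/J3f.
  have G3 k : Gf ^+ 2 * (Ff ^+ k * Gf) = Gf ^+ 3 * Ff ^+ k by ring.
  rewrite !G3.
  by move: (_ * (_ * Ff)) (_ * (_ * J3f)) (_ * (_ * Ff ^+ 2)) (_ * (_ * Ff ^+ 4)) => x y z t; ring.
split=> [[P1 [P3 [P7 [P9 [h [[Q hQ] fE]]]]]]|[P1 [P3 [P7 [P9 [Q fE]]]]]].
  exists P1, P3, P7, P9, Q; apply: fps_ext => n; rewrite fE E; congr ((_ + _ : fps F2) n).
  by apply: fps_ext => k; rewrite hQ psmulE psevalE pspowE.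
exists P1, P3, P7, P9, (pol Q (Gf ^+ 2) * Gf); split.
  by exists Q => k; rewrite psmulE psevalE pspowE.
by move=> n; rewrite E fE.
Qed.

Lemma N1_on5 Q : on5 (pol Q (Gf ^+ 2) * Gf).
Proof. exact: on5M (on5_pol Q (Gf_on5 2)) G_on5. Qed.

Lemma N1_odd Q : on odd (pol Q (Gf ^+ 2) * Gf).
Proof.
apply: (onM (S := fun n => ~~ odd n)) G_on4 => [i j h|].
  by rewrite oddD (negbTE h) addFb; lia.
rewrite frob pol_dil //; apply: (on_dil (S := predT)) => // n _.
by rewrite mul2n odd_double.
Qed.

Lemma Modd_isp (f : ps) : Modd f <-> isp f /\ on odd f.
Proof. by rewrite /Modd Modd_pol. Qed.

Lemma odd_parts f g h : on4 1%N f -> on4 3%N g -> on odd h -> on odd (f + g + h).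
Proof.
move=> hf hg; apply: onD; apply: onD; [apply: on_sub hf|apply: on_sub hg] => n /eqP; lia.
Qed.

(** Modulo 20 the classes 13 and 17 are 1 mod 4 and non-squares mod 5, while 11 and 19 are 3 mod 4
    and nonzero squares mod 5. The exponents of h are divisible by 5 and play no part. *)
Lemma pb_parts f g h : on4 1%N f -> on4 3%N g -> on5 h ->
  pb (f + g + h) =1 ps0 <-> prj Nc f = 0 /\ prj Qc g = 0.
Proof.
move=> hf hg hh; split=> [H|[H1 H3] n].
  split; apply: fps_ext => n; rewrite fps0 /prj; case: ifP => // cn.
    have [n4|n4] := boolP (n %% 4 == 1)%N; last exact: hf.
    have n20 : (n %% 20 \in [:: 11; 13; 17; 19])%N by move: cn n4; rewrite !inE /Nc; lia.
    have := H n; rewrite /pb n20 !fpsD [g n]hg ?[h n]hh ?addr0 //; move: cn n4; rewrite /Nc; lia.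
  have [n4|n4] := boolP (n %% 4 == 3)%N; last exact: hg.
  have n20 : (n %% 20 \in [:: 11; 13; 17; 19])%N by move: cn n4; rewrite !inE /Qc; lia.
  have := H n; rewrite /pb n20 !fpsD [f n]hf ?[h n]hh ?addr0 ?add0r //; move: cn n4; rewrite /Qc; lia.
rewrite /pb /ps0; case: ifP => // n20; rewrite !fpsD [h n]hh ?addr0; last by move: n20; rewrite !inE; lia.
have := congr1 (fun k : fps F2 => k n) H1; have := congr1 (fun k : fps F2 => k n) H3.
rewrite !fps0 /prj; have [n4|n4] := boolP (n %% 4 == 1)%N.
  rewrite [g n]hg; last by move: n4; lia.
  by rewrite (_ : Nc n) ?addr0 // /Nc; move: n20 n4; rewrite !inE; lia.
rewrite [f n]hf // (_ : Qc n) ?add0r // /Qc; move: n20 n4; rewrite !inE; lia.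
Qed.

(** Here 1 and 9 are 1 mod 4 and nonzero squares mod 5, while 3 and 7 are 3 mod 4 and non-squares
    mod 5. *)
Lemma pa_parts f g h : on4 1%N f -> on4 3%N g -> on5 h ->
  pa (f + g + h) =1 ps0 <-> prj Qc f = 0 /\ prj Nc g = 0.
Proof.
move=> hf hg hh; split=> [H|[H1 H3] n].
  split; apply: fps_ext => n; rewrite fps0 /prj; case: ifP => // cn.
    have [n4|n4] := boolP (n %% 4 == 1)%N; last exact: hf.
    have n20 : (n %% 20 \in [:: 1; 3; 7; 9])%N by move: cn n4; rewrite !inE /Qc; lia.
    have := H n; rewrite /pa n20 !fpsD [g n]hg ?[h n]hh ?addr0 //; move: cn n4; rewrite /Qc; lia.
  have [n4|n4] := boolP (n %% 4 == 3)%N; last exact: hg.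
  have n20 : (n %% 20 \in [:: 1; 3; 7; 9])%N by move: cn n4; rewrite !inE /Nc; lia.
  have := H n; rewrite /pa n20 !fpsD [f n]hf ?[h n]hh ?addr0 ?add0r //; move: cn n4; rewrite /Nc; lia.
rewrite /pa /ps0; case: ifP => // n20; rewrite !fpsD [h n]hh ?addr0; last by move: n20; rewrite !inE; lia.
have := congr1 (fun k : fps F2 => k n) H1; have := congr1 (fun k : fps F2 => k n) H3.
rewrite !fps0 /prj; have [n4|n4] := boolP (n %% 4 == 1)%N.
  rewrite [g n]hg; last by move: n4; lia.
  by rewrite (_ : Qc n) ?addr0 // /Qc; move: n20 n4; rewrite !inE; lia.
rewrite [f n]hf // (_ : Nc n) ?add0r // /Nc; move: n20 n4; rewrite !inE; lia.
Qed.

(** The summand 0 fills the slot of the series in x^5 in [pb_parts] and [pa_parts]. *)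
Lemma Modd_parts f : Modd f -> exists A B, f = Dr * pol A Rr + Dr ^+ 3 * pol B Rr + 0.
Proof.
move=> /Modd_isp[[P fE] of_]; rewrite fE in of_ *.
by have [A [B ->]] := odd_pol of_; exists A, B; rewrite addr0.
Qed.

Lemma pol_sq c : pol (c \Po 'X^2) (Gf ^+ 2) = c`G.
Proof. by rewrite pol_comp polXn -exprM. Qed.

(* Kernels are described by their preimages in M(odd) (all sets involved are
   unions of N1-cosets): ker p_b = N2a and ker p_a = N2b. *)
Theorem theorem2p17 :
  (forall f : ps, (Modd f /\ pb f =1 ps0) <-> inN2a_modN1 f) /\
  (forall f : ps, (Modd f /\ pa f =1 ps0) <-> inN2b_modN1 f).
Proof.
have on0 : on5 0 by [].
split=> f; split.
- move=> [/Modd_parts[A [B fE]]]; rewrite {}fE.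
  move=> /(pb_parts (DrP_on4 A) (Dr3P_on4 B) on0)[/prjN_Dr_eq0[c0 [c1 [c2 ->]]] /prjQ_Dr3_eq0[d0 [d1 [d3 ->]]]].
  (* The coefficients come from D = F + G and [Dr3_J3], where D^3 contributes to both J3 and G F^2.
     The remaining odd powers of G form the N1 part, and substituting X^2 passes from polynomials in
     G^4 to polynomials in G^2. *)
  apply/N2aP; exists c0, d0, (d0 + d1), c2,
    ((c0 \Po 'X^2) + (c1 \Po 'X^2) + (c2 \Po 'X^2) * 'X^2 + (d0 \Po 'X^2) * ('X + 'X^3) +
     (d1 \Po 'X^2) * 'X + (d3 \Po 'X^2) * 'X).
  rewrite !(polD, polM, polXn, polX, pol_sq) Dr3_J3 Dr_FG.
  move: Ff Gf J3f (c0`G) (c1`G) (c2`G) (d0`G) (d1`G) (d3`G) => F G J C0 C1 C2 D0 D1 D3.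
  by ring.
- move=> /N2aP[P1 [P3 [P7 [P9 [Q ->]]]]].
  have h1 : on4 1%N (P1`G * Ff + P9`G * (Gf * Ff ^+ 4)).
    exact: onD (on4M (pol_dil4 _ _) F_on4) (on4M (pol_dil4 _ _) (on4M G_on4 (on4X 4 F_on4))).
  have h3 : on4 3%N (P3`G * J3f + P7`G * (Gf * Ff ^+ 2)).
    exact: onD (on4M (pol_dil4 _ _) J3_on4) (on4M (pol_dil4 _ _) (on4M G_on4 (on4X 2 F_on4))).
  split; last first.
    apply/(pb_parts h1 h3 (N1_on5 Q)); split; rewrite prjD !(prj_polG _ _ Nc5, prj_polG _ _ Qc5).
      by rewrite prjN_F (prj_G1 _ Nc5) prjN_F4 !mulr0 addr0.
    by rewrite prjQ_J3 (prj_G1 _ Qc5) prjQ_F2 !mulr0 addr0.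
  apply/Modd_isp; split; last exact: odd_parts h1 h3 (N1_odd Q).
  have pG P : isp P`G by exact: isp_pol (ispX 4 isp_G).
  apply: ispD (ispM (isp_pol _ (ispX 2 isp_G)) isp_G); apply: ispD; apply: ispD.
  + exact: ispM (pG _) isp_F.
  + exact: ispM (pG _) (ispM isp_G (ispX 4 isp_F)).
  + exact: ispM (pG _) isp_J3.
  + exact: ispM (pG _) (ispM isp_G (ispX 2 isp_F)).
- move=> [/Modd_parts[A [B fE]]]; rewrite {}fE.
  move=> /(pa_parts (DrP_on4 A) (Dr3P_on4 B) on0)[/prjQ_Dr_eq0[c1 [c3 [c4 ->]]] /prjN_Dr3_eq0[d2 [d3 [d4 ->]]]].
  (* Here G F^8 = G^2 J3, by [G_J3], supplies the term in J13; pure powers of G again go to the N1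
     part. *)
  apply/N2bP; exists d2, c3, c4, d4,
    ((c1 \Po 'X^2) + (c3 \Po 'X^2) * 'X^4 + (c4 \Po 'X^2) * 'X^2 + (d2 \Po 'X^2) * 'X +
     (d3 \Po 'X^2) * 'X + (d4 \Po 'X^2) * 'X^3).
  rewrite !(polD, polM, polXn, polX, pol_sq) -G_J3.
  move: Ff Gf J3f (c1`G) (c3`G) (c4`G) (d2`G) (d3`G) (d4`G) => F G J C1 C3 C4 D2 D3 D4.
  by ring.
- move=> /N2bP[P11 [P13 [P17 [P19 [Q ->]]]]].
  have h1 : on4 1%N (P13`G * (Gf ^+ 2 * J3f) + P17`G * (Gf ^+ 3 * Ff ^+ 2)).
    exact: onD (on4M (pol_dil4 _ _) (on4M (on4X 2 G_on4) J3_on4))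
      (on4M (pol_dil4 _ _) (on4M (on4X 3 G_on4) (on4X 2 F_on4))).
  have h3 : on4 3%N (P11`G * (Gf ^+ 2 * Ff) + P19`G * (Gf ^+ 3 * Ff ^+ 4)).
    exact: onD (on4M (pol_dil4 _ _) (on4M (on4X 2 G_on4) F_on4))
      (on4M (pol_dil4 _ _) (on4M (on4X 3 G_on4) (on4X 4 F_on4))).
  split; last first.
    apply/(pa_parts h1 h3 (N1_on5 Q)); split; rewrite prjD !(prj_polG _ _ Nc5, prj_polG _ _ Qc5).
      by rewrite !(prj_Gf _ _ Qc5) prjQ_J3 prjQ_F2 !mulr0 addr0.
    by rewrite !(prj_Gf _ _ Nc5) prjN_F prjN_F4 !mulr0 addr0.
  apply/Modd_isp; split; last exact: odd_parts h1 h3 (N1_odd Q).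
  have pG P : isp P`G by exact: isp_pol (ispX 4 isp_G).
  apply: ispD (ispM (isp_pol _ (ispX 2 isp_G)) isp_G); apply: ispD; apply: ispD.
  + exact: ispM (pG _) (ispM (ispX 2 isp_G) isp_J3).
  + exact: ispM (pG _) (ispM (ispX 3 isp_G) (ispX 2 isp_F)).
  + exact: ispM (pG _) (ispM (ispX 2 isp_G) isp_F).
  + exact: ispM (pG _) (ispM (ispX 3 isp_G) (ispX 4 isp_F)).
Qed.
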